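(* Consider the stationary $M_1,M_2/G_1,G_2/1$ retrial queue with non-preemptive priority described in the context, with $\rho<1$. Suppose that, for a function $L$ slowly varying at $\infty$, the service times satisfy, as $t\to\infty$, $$P\{T_{\beta_1}>t\}\sim t^{-a_1}L(t)\quad\text{with } a_1>1,\qquad P\{T_{\beta_2}>t\}\sim e^{-rt}t^{-a_2}L(t),$$ where either $r>0$ and $-\infty<a_2<\infty$, or $r=0$ and $a_2>a_1$. Then, as $j\to\infty$, $$P\{R_{que}>j\mid I_{ser}=1\}\sim\frac{\lambda_1^{a_1}}{\rho_1(1-\rho_1)(a_1-1)}\cdot j^{-a_1+1}L(j),$$ $$P\{R_{orb}>j\mid I_{ser}=1\}\sim\left[\frac{\rho_2}{1-\rho}+\frac{1}{\rho_1}\right]\cdot\frac{\lambda_1\lambda_2^{a_1-1}}{(a_1-1)(1-\rho_1)^{a_1}}\cdot j^{-a_1+1}L(j),$$ $$P\{R_{que}>j\mid I_{ser}=2\}\sim\begin{cases}\dfrac{\lambda_2\lambda_1^{a_2-1}}{\rho_2(a_2-1)}\cdot j^{-a_2+1}L(j), & \text{if } r=0,\\[2mm] \dfrac{\lambda_2\lambda_1(\lambda_1+r)^{a_2-1}}{\rho_2 r}\cdot\left(\dfrac{\lambda_1}{\lambda_1+r}\right)^{j}j^{-a_2}L(j), & \text{if } r>0,\end{cases}$$ $$P\{R_{orb}>j\mid I_{ser}=2\}\sim\frac{\lambda_1\lambda_2^{a_1-1}}{(1-\rho)(a_1-1)(1-\rho_1)^{a_1-1}}\cdot j^{-a_1+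1}L(j).$$
   Context: Model. A single server serves two types of customers. Customers arrive according to a Poisson process of rate $\lambda>0$; each is independently of Type 1 with probability $q\in(0,1)$ and of Type 2 with probability $p=1-q$, so Type-1 and Type-2 customers form independent Poisson processes of rates $\lambda_1=\lambda q$ and $\lambda_2=\lambda p$. An arriving customer (of either type) who finds the server idle is served immediately and leaves after service. A Type-1 customer finding the server busy joins a priority queue of infinite capacity. A Type-2 customer finding the server busy enters the orbit; each customer in the orbit independently makes retrial attempts according to a Poisson process of rate $\mu>0$ until it finds the server idle, and is then served immediately. Type-1 customers have non-preemptive priority over Type-2 customers: as long as the priority queue is non-empty all retrials from the orbit fail, and blocked customers return to the orbit with probability one. The service time of a Type-$i$ customer is $T_{\beta_i}$ with distribution function $F_{\beta_i}$, $F_{\beta_i}(0)=0$, finite mean $\beta_{i,1}$, and Laplace–Stieltjes transform (LST) $\beta_i(s)$, $i=1,2$; all service times, arrivals and retrials are independent. Put $\rho_1=\lambda_1\beta_{1,1}$, $\rho_2=\lambda_2\beta_{2,1}$, $\rho=\rho_1+\rho_2$. The system is stable if and only if $\rho<1$. Steady-state quantities. $R_{que}$ is the number of Type-1 customers in the queue, excluding the possible one in service; $R_{orb}$ is the number of Type-2 customers in the orbit; $I_{ser}=0,1,2$ according to whether the server is idle, busy with a Type-1 customer, or busy with a Type-2 customer. All probabilities refer to the stationary regime. Known facts from the literature (Falin, Artalejo and Martin, 1993), used as the starting point: $P\{I_{ser}=0\}=1-\rho$, $P\{I_{ser}=1\}=\rho_1$, $P\{I_{ser}=2\}=\rho_2$.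 Let $\beta(s)=q\beta_1(s)+p\beta_2(s)$, $g(z_2)=q\,h(z_2)+p\,z_2$, where $h(z_2)$ is determined uniquely by $h(z_2)=\beta_1(\lambda-\lambda_1h(z_2)-\lambda_2z_2)$. With $R_0(z_2)=E(z_2^{R_{orb}}\mid I_{ser}=0)$ and $R_i(z_1,z_2)=E(z_1^{R_{que}}z_2^{R_{orb}}\mid I_{ser}=i)$, $i=1,2$, and writing $s=\lambda-\lambda_1z_1-\lambda_2z_2$, $$R_0(z_2)=\exp\Big\{-\frac{\lambda}{\mu}\int_{z_2}^1\frac{1-\beta(\lambda-\lambda g(u))}{\beta_2(\lambda-\lambda g(u))-u}\,du\Big\},$$ $$R_1(z_1,z_2)=\frac{1-\rho}{\rho_1}\cdot\frac{W(z_1,z_2)}{(\beta_2(\lambda-\lambda g(z_2))-z_2)(z_1-\beta_1(s))}\cdot\frac{1-\beta_1(s)}{s}\cdot R_0(z_2),$$ $$R_2(z_1,z_2)=\frac{1-\rho}{\rho_2}\cdot\frac{\lambda-\lambda g(z_2)}{\beta_2(\lambda-\lambda g(z_2))-z_2}\cdot\frac{1-\beta_2(s)}{s}\cdot R_0(z_2),$$ $$W(z_1,z_2)=[\lambda-\lambda_1h(z_2)-\lambda_2\beta_2(\lambda-\lambda g(z_2))](\beta_2(s)-z_2)+(\lambda-\lambda_1z_1-\lambda_2\beta_2(s))[z_2-\beta_2(\lambda-\lambda g(z_2))].$$ Conventions. $f(t)\sim g(t)$ means $f(t)/g(t)\to1$. A measurable $L:(0,\infty)\to(0,\infty)$ is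 slowly varying at $\infty$ if $L(xt)/L(t)\to1$ as $t\to\infty$ for all $x>0$. *)

(* Defs.v *)
From HB Require Import structures.
From mathcomp Require Import all_boot all_order all_algebra.
From mathcomp Require Import all_classical all_reals all_analysis.
Set Implicit Arguments.
Unset Strict Implicit.
Unset Printing Implicit Defensive.
Import Order.TTheory GRing.Theory Num.Theory.
Import numFieldNormedType.Exports.

Local Open Scope classical_set_scope.
Local Open Scope ring_scope.

Definition equivalent_at (R : realType) (T : Type) (F : set_system T)
    (f g : T -> R) : Prop :=
  f x / g x @[x --> F] --> (1 : R).

(* Only the values of L on ]0, +oo[ matter. *)
Definition slowly_varying (R : realType) (L : R -> R) : Prop :=
  [/\ measurable_fun (`]0, +oo[ : set R) L,
      forall t, 0 < t -> 0 < L t &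
      forall x, 0 < x -> L (x * t) / L t @[t --> +oo] --> (1 : R)].

Definition cond_prob d (Omega : measurableType d) (R : realType)
    (P : probability Omega R) (A B : set Omega) : R :=
  fine (P (A `&` B)) / fine (P B).

Variant customer := Type1 | Type2.

(* The service times are generic copies of the service time of each type of
   customer; no relation with the stationary state defined below, which lives
   on the same probability space, is assumed. *)
Record retrial_queue d (Omega : measurableType d) (R : realType)
    (P : probability Omega R) := RetrialQueue {
  arrival_rate : R ;
  type1_prob : R ;
  retrial_rate : R ;
  service : customer -> {RV P >-> R} ;
  arrival_rate_gt0 : 0 < arrival_rate ;
  type1_prob_gt0 : 0 < type1_prob ;
  type1_prob_lt1 : type1_prob < 1 ;
  retrial_rate_gt0 : 0 < retrial_rate ;
  service_cdf0 : forall c, cdf (service c) 0 = 0%E ;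
  service_integrable : forall c, P.-integrable setT (EFin \o service c) }.

(* Markovian state of the system:
   - idle n       : server idle, n customers in the orbit (the priority queue
                    is then empty);
   - busy c m n x : a customer of type c is in service with residual service
                    time x, m customers wait in the priority queue and n in
                    the orbit. *)
Variant qstate (R : Type) :=
  | idle of nat
  | busy of customer & nat & nat & R.
Arguments idle {R}.

Section model.
Context d (Omega : measurableType d) (R : realType) (P : probability Omega R).
Variable Q : retrial_queue P.

Definition rate (c : customer) : R :=
  arrival_rate Q * (if c is Type1 then type1_prob Q else 1 - type1_prob Q).

Definition load (c : customer) : R := rate c * fine 'E_P[service Q c]%E.

Definition total_load : R := load Type1 + load Type2.

Implicit Types f : qstate R -> R.

(* Mean value of f right after a service of type c has begun, leaving m
   customers in the queue and n in the orbit. *)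
Definition start f (c : customer) (m n : nat) : R :=
  fine 'E_P[fun w => f (busy c m n (service Q c w))]%E.

(* Mean value of f right after a service completion leaving m customers in the
   queue and n in the orbit. *)
Definition completion f (m n : nat) : R :=
  if m is m'.+1 then start f Type1 m' n else f (idle n).

(* Infinitesimal generator of the piecewise deterministic Markov process. In an
   idle state, an arriving customer, of either type, or one of the n orbiting
   customers enters service. In a busy state, the residual service time
   decreases at unit speed, and arriving customers join the queue or the orbit;
   retrials fail and leave the state unchanged. Service completions enter
   through the boundary condition at x = 0 in gen_domain. *)
Definition generator f (s : qstate R) : R :=
  match s with
  | idle n =>
      rate Type1 * (start f Type1 0 n - f (idle n))
      + rate Type2 * (start f Type2 0 n - f (idle n))
      + n%:R * retrial_rate Q * (start f Type2 0 n.-1 - f (idle n))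
  | busy c m n x =>
      - derive1 (fun y : R => f (busy c m n y)) x
      + rate Type1 * (f (busy c m.+1 n x) - f (busy c m n x))
      + rate Type2 * (f (busy c m n.+1 x) - f (busy c m n x))
  end.

Definition bounded_on_states f : Prop :=
  exists C : R, (forall n, `|f (idle n)| <= C) /\
    (forall c m n x, 0 <= x -> `|f (busy c m n x)| <= C).

(* Bounded functions, C^1 in the residual service time, with bounded image
   under the generator, and with the boundary condition of the process: its
   value when the residual service time hits 0 is its mean value after the
   jump caused by the service completion. *)
Definition gen_domain f : Prop :=
  [/\ bounded_on_states f,
      bounded_on_states (generator f),
      forall c m n (x : R), derivable (fun y : R => f (busy c m n y)) x 1,
      forall c m n, continuous (derive1 (fun y : R => f (busy c m n y))) &
      forall c m n, f (busy c m n 0) = completion f m n].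

Definition state_at (Iser Rque Rorb : Omega -> nat) (X : Omega -> R)
    (w : Omega) : qstate R :=
  match Iser w with
  | 0%N => idle (Rorb w)
  | 1%N => busy Type1 (Rque w) (Rorb w) (X w)
  | _ => busy Type2 (Rque w) (Rorb w) (X w)
  end.

(* Iser, Rque, Rorb (and the residual service time X, meaningless when the
   server is idle) are jointly distributed according to a stationary law of the
   Markov process: the global balance equations E[(A f)(state)] = 0 hold for
   every f in the domain of the generator A. *)
Definition stationary (Iser Rque Rorb : {RV P >-> nat}) (X : {RV P >-> R}) :
    Prop :=
  [/\ forall w, (Iser w <= 2)%N,
      forall w, Iser w = 0%N -> Rque w = 0%N,
      forall w, Iser w <> 0%N -> 0 < X w &
      forall f, gen_domain f ->
        'E_P[generator f \o state_at Iser Rque Rorb X]%E = 0%E].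

End model.

(* Main.v *)
(* Stationarity is tested on functions that are geometric in the two queue
   lengths and exponential in the residual service time; for well-chosen
   parameters the balance equations form a triangular linear system for the
   generating functions, which come out as rational expressions in the
   transforms phi_c(s) = int_0^oo e^(-s x) P(T_c > x) dx, evaluated at l(1 - z) or
   at the solution s = sigma(t) of s (1 - l1 phi_1(s)) = l2 (1 - e^(-t)).

   Let n = floor(a). The n-th derivative of phi_1 is, up to sign, the Laplace
   transform Phi of x^n P(T_1 > x), which diverges at 0+, while the derivatives of
   lower order are subpolynomial (o(s^(-e)) for every e > 0). Being subpolynomial
   up to order n - 1 with an n-th derivative equivalent to c Phi is stable under
   sums, products, inverses and composition with sigma, and c is computed by
   the Leibniz rule. Two distributions whose transforms have proportional n-th
   derivatives in this sense have proportional tails: the n-th derivatives are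
   replaced by n-th differences, and a power of 1 - e^(-N u) is used as a
   smooth indicator of u > 1. Karamata's theorem then gives the tails.

   If Type-2 services have an exponential tail e^(-r t) ell(t), the queue length
   during such a service is mixed Poisson; its point probabilities are integrals
   against a Gamma distribution which concentrates around k / (l1 + r), so that
   they are equivalent to those of a geometric law times ell(k / (l1 + r)), by
   Chebyshev's inequality and Potter's bounds. *)

From HB Require Import structures.
From mathcomp Require Import all_boot all_order all_algebra.
From mathcomp Require Import all_classical all_reals all_analysis.
From mathcomp Require Import measurable_realfun ring lra.
Require Import Defs.
Set Implicit Arguments.
Unset Strict Implicit.
Unset Printing Implicit Defensive.
Import Order.TTheory GRing.Theory Num.Theory.
Import numFieldNormedType.Exports.

Local Open Scope classical_set_scope.
Local Open Scope ring_scope.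

(** When a is an integer, the moment of order n - 1 of the tail behaves like the integral of L(x)/x,
    which may diverge, though more slowly than any power. Asking the lower derivatives to be
    subpolynomial, not convergent, treats integer and other a alike. The generating function [p0] of
    the orbit in idle states solves a first-order linear equation whose coefficient is a function of
    [Kf]. It is therefore one order smoother than [Kf], and the leading coefficients of the orbit
    come from [Kf] alone. The reference transform is that of a service-time tail itself, so the
    asymptotic constants of transforms cancel in the Tauberian step; a constant depending on the
    exponent enters only once, as the a - 1 of Karamata's theorem. Uniform estimates are drawn from
    monotonicity: L is replaced by the Type-1 tail, which is equivalent to t^(-a1) L(t) and
    nonincreasing. As both tails share L, e^(r y) P(T_2 > y) is equivalent to y^(a1 - a2) P(T_1 >
    y), and the Type-2 tail inherits windows and Potter bounds from the Type-1 tail. *)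

Section real_derive.
Context {R : realType}.
Implicit Types (f g : R -> R) (s a b c : R).

Lemma real_deriveM f g s a b : is_derive s 1 f a -> is_derive s 1 g b ->
  is_derive s 1 (fun x => f x * g x) (a * g s + f s * b).
Proof.
move=> fa gb; apply: (is_derive_eq (is_deriveM fa gb)).
by rewrite addrC; congr (_ + _); exact: mulrC.
Qed.

Lemma real_deriveD f g s a b : is_derive s 1 f a -> is_derive s 1 g b ->
  is_derive s 1 (fun x => f x + g x) (a + b).
Proof. by move=> fa gb; exact: (is_deriveD fa gb). Qed.

Lemma real_deriveZ f c s a : is_derive s 1 f a ->
  is_derive s 1 (fun x => c * f x) (c * a).
Proof.
move=> fa; have := @real_deriveM (cst c) f s 0 a (is_derive_cst _ _ _) fa.
by rewrite mul0r add0r.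
Qed.

Lemma real_deriveV f s a : f s != 0 -> is_derive s 1 f a ->
  is_derive s 1 (fun x => (f x)^-1) (- a * ((f s)^-1 * (f s)^-1)).
Proof.
move=> f0 fa; apply: (is_derive_eq (is_deriveV f0 fa)).
rewrite -[LHS]/(_ * _) expr2 invfM; ring.
Qed.

Lemma eq_pos_is_derive f g s a : (forall s, 0 < s -> f s = g s) -> 0 < s ->
  is_derive s 1 f a -> is_derive s 1 g a.
Proof.
move=> fg s0; apply: near_eq_is_derive.
near=> x; apply: fg; near: x; exact: lt_nbhsr.
Unshelve. all: end_near. Qed.

Lemma eq_pos_cvg f g (F : set_system R) : (forall s, 0 < s -> f s = g s) ->
  f s @[s --> 0^'+] --> F -> g s @[s --> 0^'+] --> F.
Proof.
move=> fg; apply: cvg_trans; apply: near_eq_cvg.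
by near=> s; rewrite fg.
Unshelve. all: end_near. Qed.

End real_derive.

(** * Functions with subpolynomial derivatives at 0+ *)

Section germs.
Context {R : realType}.
Implicit Types (f g u x : R -> R) (k : nat).

Definition subpoly f := forall e : R, 0 < e -> s `^ e * f s @[s --> 0^'+] --> (0 : R).

Fixpoint subpoly_derivs k f : Prop := subpoly f /\
  if k is k'.+1 then
    exists2 f', forall s : R, 0 < s -> is_derive s 1 f (f' s) &
                subpoly_derivs k' f'
  else True.

Lemma eq_subpoly f g : (forall s, 0 < s -> f s = g s) -> subpoly f -> subpoly g.
Proof. by move=> fg fs e e0; apply: eq_pos_cvg (fs e e0) => s /fg ->. Qed.

Lemma eq_subpoly_derivs k f g : (forall s, 0 < s -> f s = g s) ->
  subpoly_derivs k f -> subpoly_derivs k g.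
Proof.
case: k => [|k] fg /=; first by move=> [f0 _]; split => //; exact: eq_subpoly f0.
move=> [f0 [f' ff' f's]]; split; first exact: eq_subpoly f0.
by exists f' => // s s0; apply: eq_pos_is_derive (ff' s s0).
Qed.

Lemma cvg_subpoly f (l : R) : f s @[s --> 0^'+] --> l -> subpoly f.
Proof.
by move=> fl e e0; rewrite -[X in _ --> X](mul0r l); exact: cvgM (powR_cvg0 e0) fl.
Qed.

Lemma subpolyD f g : subpoly f -> subpoly g -> subpoly (fun s => f s + g s).
Proof.
move=> f0 g0 e e0; rewrite -[X in _ --> X](addr0 0).
apply: eq_pos_cvg (cvgD (f0 _ e0) (g0 _ e0)).
by move=> s _; rewrite mulrDr.
Qed.

Lemma subpolyM f g : subpoly f -> subpoly g -> subpoly (fun s => f s * g s).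
Proof.
move=> f0 g0 e e0; have e20 : 0 < e / 2 by rewrite divr_gt0.
rewrite -[X in _ --> X](mulr0 0); apply: eq_pos_cvg (cvgM (f0 _ e20) (g0 _ e20)).
move=> s s0; rewrite [LHS]mulrACA -powRD; last by rewrite (gt_eqF s0) implybT.
by rewrite -splitr.
Qed.

Lemma subpoly_derivsW k f : subpoly_derivs k.+1 f -> subpoly_derivs k f.
Proof.
elim: k f => [|k IH] f; first by move=> [].
by move=> [f0 [f' ff' /IH f's]]; split => //; exists f'.
Qed.

Lemma subpoly_derivs_cst k c : subpoly_derivs k (fun=> c).
Proof.
elim: k c => [|k IH] c /=; first by split=> //; exact: (cvg_subpoly (cvg_cst c)).
split; first exact: (cvg_subpoly (cvg_cst c)).
by exists (fun=> 0) => // s s0; exact: is_derive_cst.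
Qed.

Lemma subpoly_derivsD k f g : subpoly_derivs k f -> subpoly_derivs k g ->
  subpoly_derivs k (fun s => f s + g s).
Proof.
elim: k f g => [|k IH] f g /=.
  by move=> [f0 _] [g0 _]; split => //; exact: subpolyD.
move=> [f0 [f' ff' f's]] [g0 [g' gg' g's]]; split; first exact: subpolyD.
exists (fun s => f' s + g' s); last exact: IH.
by move=> s s0; apply: real_deriveD; [exact: ff'|exact: gg'].
Qed.

Lemma subpoly_derivsM k f g : subpoly_derivs k f -> subpoly_derivs k g ->
  subpoly_derivs k (fun s => f s * g s).
Proof.
elim: k f g => [|k IH] f g.
  by move=> [f0 _] [g0 _]; split => //; exact: subpolyM.
move=> fk gk; have fk1 := subpoly_derivsW fk; have gk1 := subpoly_derivsW gk.
case: fk => f0 [f' ff' f's]; case: gk => g0 [g' gg' g's].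
split; first exact: subpolyM.
exists (fun s => f' s * g s + f s * g' s).
  by move=> s s0; apply: real_deriveM; [exact: ff'|exact: gg'].
by apply: subpoly_derivsD; exact: IH.
Qed.

Lemma subpoly_derivsZ k c f : subpoly_derivs k f ->
  subpoly_derivs k (fun s => c * f s).
Proof. exact/subpoly_derivsM/subpoly_derivs_cst. Qed.

Lemma subpoly_derivsN k f : subpoly_derivs k f ->
  subpoly_derivs k (fun s => - f s).
Proof.
by move/(@subpoly_derivsZ k (-1)); apply: eq_subpoly_derivs => s _; rewrite mulN1r.
Qed.

Lemma subpoly_derivs_id k : subpoly_derivs k id.
Proof.
have id0 : subpoly (@id R).
  apply: (@cvg_subpoly _ 0); exact: cvg_at_right_filter.
case: k => [|k]; first by split.
split => //; exists (fun=> 1); last exact: subpoly_derivs_cst.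
by move=> s _; exact: is_derive_id.
Qed.

Lemma subpolyV f (c : R) : 0 < c -> (forall s, 0 < s -> c <= f s) ->
  subpoly (fun s => (f s)^-1).
Proof.
move=> c0 cf e e0.
apply: (@squeeze_cvgr _ _ _ _ (fun=> 0) (fun s => s `^ e * c^-1)); last 2 first.
- exact: cvg_cst.
- by rewrite -[X in _ --> X](mul0r c^-1); exact: cvgM (powR_cvg0 e0) (cvg_cst _).
near=> s; have s0 : 0 < s by [].
have fs0 : 0 < f s by exact: lt_le_trans (cf s s0).
rewrite mulr_ge0 ?powR_ge0 ?invr_ge0 ?(ltW fs0)//=.
by rewrite ler_wpM2l ?powR_ge0// lef_pV2 ?posrE// cf.
Unshelve. all: end_near. Qed.

Lemma subpoly_derivsV k f (c : R) : 0 < c -> (forall s, 0 < s -> c <= f s) ->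
  subpoly_derivs k f -> subpoly_derivs k (fun s => (f s)^-1).
Proof.
move=> c0 cf; elim: k => [|k IH] fk.
  by split => //; exact: subpolyV cf.
have Vk := IH (subpoly_derivsW fk); case: fk => f0 [f' ff' f's].
split; first exact: subpolyV cf.
exists (fun s => - f' s * ((f s)^-1 * (f s)^-1)).
  by move=> s s0; apply: real_deriveV; [rewrite gt_eqF ?(lt_le_trans c0 (cf _ _))|exact: ff'].
by do 2?[apply: subpoly_derivsM => //]; exact: subpoly_derivsN.
Qed.

Lemma cvg_powR {T} (F : set_system T) {FF : Filter F} (h : T -> R) (c e : R) :
  0 < c -> h x @[x --> F] --> c -> h x `^ e @[x --> F] --> c `^ e.
Proof.
move=> c0 hc; apply: (@cvg_comp _ _ _ h (fun y : R => y `^ e) _ (nbhs c)) => //.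
have /derivable1_diffP/differentiable_continuous :
    derivable (fun y : R => y `^ e) c 1.
  by apply: derivable_powR; rewrite in_itv/= c0.
exact.
Qed.

Lemma cvg_pos_at_right u : (forall t, 0 < t -> 0 < u t) ->
  u t @[t --> 0^'+] --> 0 -> u t @[t --> 0^'+] --> 0^'+.
Proof.
move=> u0 ul P [e /= e0 eP].
have /cvgrPdist_lt/(_ _ e0) ue := ul.
suff: \forall t \near 0^'+, P (u t) by [].
near=> t; apply: eP; last by apply: u0; near: t; exact: nbhs_right_gt.
by rewrite /=; near: t.
Unshelve. all: end_near. Qed.

Definition asymp_linear u (c : R) :=
  (forall t, 0 < t -> 0 < u t) /\ u t / t @[t --> 0^'+] --> c.

Lemma asymp_linear_cvg0 u c : asymp_linear u c -> u t @[t --> 0^'+] --> 0.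
Proof.
move=> [u0 uc]; rewrite -[X in _ --> X](mulr0 c).
have id0 : t @[t --> 0^'+] --> (0 : R) by exact: cvg_at_right_filter.
apply: eq_pos_cvg (cvgM uc id0) => t t0.
by rewrite /= -[RHS](divfK (lt0r_neq0 t0)).
Qed.

Lemma asymp_linear_at_right u c : asymp_linear u c ->
  u t @[t --> 0^'+] --> 0^'+.
Proof. by move=> uc; apply: cvg_pos_at_right (asymp_linear_cvg0 uc); case: uc. Qed.

(** The ratio t^e / u(t)^e converges, so powers of t and of [u t] are interchangeable. *)
Lemma subpoly_comp f u c : 0 < c -> asymp_linear u c ->
  subpoly f -> subpoly (fun t => f (u t)).
Proof.
move=> c0 uc fs e e0; rewrite -[X in _ --> X](mulr0 (c `^ (- e))).
have fu : u t `^ e * f (u t) @[t --> 0^'+] --> 0.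
  exact: cvg_comp (asymp_linear_at_right uc) (fs e e0).
have uec : (u t / t) `^ (- e) @[t --> 0^'+] --> c `^ (- e).
  by case: uc => u0 uc; exact: cvg_powR.
apply: eq_pos_cvg (cvgM uec fu) => t t0; rewrite [LHS]mulrA; congr (_ * _).
have ut0 : 0 < u t by case: uc => + _; exact.
rewrite powRM ?invr_ge0 ?ltW// -[t^-1]powR_inv1 ?ltW// -powRrM mulN1r opprK.
by rewrite mulrAC powRN mulVf ?mul1r// gt_eqF// powR_gt0.
Qed.

(* As u solves the autonomous equation u' = x(u), the derivative of f o u is
   again a function composed with u, which makes the induction possible. *)
Lemma subpoly_derivs_comp k f u x c : 0 < c -> asymp_linear u c ->
  (forall t : R, 0 < t -> is_derive t 1 u (x (u t))) -> subpoly_derivs k.-1 x ->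
  subpoly_derivs k f -> subpoly_derivs k (fun t => f (u t)).
Proof.
move=> c0 uc ux; elim: k f => [|k IH] f /= xs.
  by move=> [f0 _]; split => //; exact: (subpoly_comp c0 uc f0).
move=> [f0 [f' ff' f's]]; split; first exact: (subpoly_comp c0 uc f0).
exists (fun t => f' (u t) * x (u t)).
  move=> t t0; apply: (@is_derive1_comp _ f u t) => //; last exact: ux.
  by apply: ff'; case: uc => + _; exact.
have xs' : subpoly_derivs k.-1 x by case: k xs {IH f's} => //= k; exact: subpoly_derivsW.
by apply: subpoly_derivsM; exact: IH.
Qed.

(* f together with its first k derivatives is subpolynomial, except that the
   k-th one is equivalent to c * Phi. *)
Variable Phi : R -> R.

Fixpoint top_deriv k (c : R) f : Prop :=
  if k is k'.+1 then
    subpoly f /\ exists2 f', forall s : R, 0 < s -> is_derive s 1 f (f' s) &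
                             top_deriv k' c f'
  else f s / Phi s @[s --> 0^'+] --> c.

Lemma eq_top_deriv k c f g : (forall s, 0 < s -> f s = g s) ->
  top_deriv k c f -> top_deriv k c g.
Proof.
case: k => [|k] fg /=; first by apply: eq_pos_cvg => s /fg ->.
move=> [f0 [f' ff' f's]]; split; first exact: eq_subpoly f0.
by exists f' => // s s0; apply: eq_pos_is_derive (ff' s s0).
Qed.

Lemma top_deriv_subpoly k c f : top_deriv k.+1 c f -> subpoly_derivs k f.
Proof.
elim: k c f => [|k IH] c f /=; first by move=> [].
by move=> [f0 [f' ff' /IH f's]]; split => //; exists f'.
Qed.

Lemma top_derivD k c d f g : top_deriv k c f -> top_deriv k d g ->
  top_deriv k (c + d) (fun s => f s + g s).
Proof.
elim: k f g => [|k IH] f g /=.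
  move=> fc gd; apply: eq_pos_cvg (cvgD fc gd) => s _.
  by rewrite mulrDl.
move=> [f0 [f' ff' f's]] [g0 [g' gg' g's]]; split; first exact: subpolyD.
exists (fun s => f' s + g' s); last exact: IH.
by move=> s s0; apply: real_deriveD; [exact: ff'|exact: gg'].
Qed.

Hypothesis Phi_gt0 : forall s, 0 < s -> 0 < Phi s.
Hypothesis Phi_large :
  exists2 e : R, 0 < e & (s `^ e * Phi s)^-1 @[s --> 0^'+] --> 0.

(** [Phi] exceeds some negative power of s, hence subpolynomial functions are o([Phi]). *)
Lemma subpoly_top_deriv k f : subpoly_derivs k f -> top_deriv k 0 f.
Proof.
elim: k f => [|k IH] f; last first.
  by move=> [f0 [f' ff' /IH f's]]; split => //; exists f'.
move=> [f0 _] /=; have [e e0 Phie] := Phi_large.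
rewrite -[X in _ --> X](mulr0 0); apply: eq_pos_cvg (cvgM (f0 _ e0) Phie) => s s0.
rewrite /= invfM [LHS]mulrACA mulrA.
by rewrite mulfV ?mul1r// gt_eqF// powR_gt0.
Qed.

(** In the Leibniz sum only the term carrying the k-th derivative of [f] has the size of [Phi]; all
    others, including the one with the k-th derivative of [g], are subpolynomial. *)
Lemma top_derivMl k c d f g : top_deriv k c f -> subpoly_derivs k g ->
  g s @[s --> 0^'+] --> d -> top_deriv k (c * d) (fun s => f s * g s).
Proof.
elim: k f g d => [|k IH] f g d fc gk gd.
  by apply: eq_pos_cvg (cvgM fc gd) => s _; rewrite /= mulrAC.
have fk := top_deriv_subpoly fc; have gk1 := subpoly_derivsW gk.
case: fc => f0 [f' ff' f's]; case: gk => g0 [g' gg' g's].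
split; first exact: subpolyM.
exists (fun s => f' s * g s + f s * g' s).
  by move=> s s0; apply: real_deriveM; [exact: ff'|exact: gg'].
rewrite -[c * d]addr0; apply: top_derivD; first exact: IH.
by apply: subpoly_top_deriv; exact: subpoly_derivsM.
Qed.

Lemma top_derivZ k c d f : top_deriv k c f ->
  top_deriv k (d * c) (fun s => d * f s).
Proof.
move=> fc; rewrite mulrC.
apply: eq_top_deriv (top_derivMl fc (subpoly_derivs_cst k d) (cvg_cst d)).
by move=> s _; rewrite mulrC.
Qed.

(** The order is a successor because at order 0 a product of two functions of size [Phi] would have
    size [Phi]^2. From order 1 on, two Leibniz terms survive, and in each of them the
    undifferentiated factor tends to its limit. *)
Lemma top_derivM k c d f g (f0 g0 : R) : top_deriv k.+1 c f -> top_deriv k.+1 d g ->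
  f s @[s --> 0^'+] --> f0 -> g s @[s --> 0^'+] --> g0 ->
  top_deriv k.+1 (c * g0 + f0 * d) (fun s => f s * g s).
Proof.
move=> fc gd ff0 gg0; have fk := top_deriv_subpoly fc; have gk := top_deriv_subpoly gd.
case: fc => fs [f' ff' f's]; case: gd => gs [g' gg' g's].
split; first exact: subpolyM.
exists (fun s => f' s * g s + g' s * f s).
  move=> s s0; rewrite [g' s * _]mulrC.
  by apply: real_deriveM; [exact: ff'|exact: gg'].
by rewrite [f0 * d]mulrC; apply: top_derivD; exact: top_derivMl.
Qed.

Lemma top_derivV k c f (b f0 : R) : 0 < b -> (forall s, 0 < s -> b <= f s) ->
  f s @[s --> 0^'+] --> f0 -> top_deriv k.+1 c f ->
  top_deriv k.+1 (- c / f0 ^+ 2) (fun s => (f s)^-1).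
Proof.
move=> b0 bf ff0 fc; have fk := top_deriv_subpoly fc.
case: fc => fs [f' ff' f's]; split; first exact: subpolyV bf.
exists (fun s => - f' s * ((f s)^-1 * (f s)^-1)).
  by move=> s s0; apply: real_deriveV; [rewrite gt_eqF ?(lt_le_trans b0 (bf _ _))|exact: ff'].
have f00 : f0 != 0.
  rewrite gt_eqF// (lt_le_trans b0)//.
  by apply: (cvgr_to_ge ff0); near=> s; apply: bf.
have fV := subpoly_derivsV b0 bf fk.
apply: top_derivMl; [|exact: subpoly_derivsM|]; last first.
  by rewrite expr2 invfM; apply: cvgM; apply: cvgV.
by have := @top_derivZ k c (-1) f' f's; rewrite mulN1r; apply: eq_top_deriv => s _; rewrite mulN1r.
Unshelve. all: end_near. Qed.

(** Each differentiation brings out a factor [x (u t)], which tends to d, so d^k in all; the passage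
    from [Phi (u t)] to [Phi t] contributes d^(-b). *)
Lemma top_deriv_comp k f u x (b c d : R) : 0 < d -> asymp_linear u d ->
  Phi (u t) / Phi t @[t --> 0^'+] --> d `^ (- b) ->
  (forall t : R, 0 < t -> is_derive t 1 u (x (u t))) ->
  x s @[s --> 0^'+] --> d -> subpoly_derivs k.-1 x ->
  top_deriv k c f -> top_deriv k (c * d `^ (k%:R - b)) (fun t => f (u t)).
Proof.
move=> d0 ud Phid ux xd; elim: k f => [|k IH] f xs.
  move=> fc; rewrite sub0r.
  have fu : f (u t) / Phi (u t) @[t --> 0^'+] --> c.
    exact: cvg_comp (asymp_linear_at_right ud) fc.
  apply: eq_pos_cvg (cvgM fu Phid) => t t0; rewrite [LHS]mulrA divfK// gt_eqF// Phi_gt0//.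
  by case: ud => + _; exact.
move=> [fs [f' ff' f's]]; split; first exact: (subpoly_comp d0 ud fs).
exists (fun t => f' (u t) * x (u t)).
  move=> t t0; apply: (@is_derive1_comp _ f u t) => //; last exact: ux.
  by apply: ff'; case: ud => + _; exact.
have -> : c * d `^ (k.+1%:R - b) = c * d `^ (k%:R - b) * d.
  rewrite -mulrA; congr (_ * _); rewrite -[X in _ * X]powRr1 ?ltW//.
  by rewrite -powRD ?(gt_eqF d0) ?implybT// -[k.+1]addn1 natrD addrAC.
have xs' : subpoly_derivs k.-1 x by case: k xs {IH f's} => //= k; exact: subpoly_derivsW.
apply: top_derivMl; [exact: IH|exact: (subpoly_derivs_comp d0 ud ux xs' xs)|].
exact: cvg_comp (asymp_linear_at_right ud) xd.
Qed.

End germs.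

(** * Laplace transforms of positive functionals *)

Section positive_functionals.
Context {R : realType}.
Implicit Types (f g : R -> R) (J : (R -> R) -> R) (s y h : R) (k : nat).

Definition admissible f := measurable_fun setT f /\
  exists C, forall y, 0 <= y -> `|f y| <= C.

Lemma admissible_cst c : admissible (fun=> c).
Proof. by split; [exact: measurable_cst|exists `|c|]. Qed.

Lemma admissibleD f g : admissible f -> admissible g ->
  admissible (fun y => f y + g y).
Proof.
move=> [mf [C fC]] [mg [D gD]]; split; first exact: (measurable_funD mf mg).
exists (C + D) => y y0; apply: le_trans (ler_normD _ _) _.
by rewrite lerD ?fC ?gD.
Qed.

Lemma admissibleM f g : admissible f -> admissible g ->
  admissible (fun y => f y * g y).
Proof.
move=> [mf [C fC]] [mg [D gD]]; split; first exact: measurable_funM.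
by exists (C * D) => y y0; rewrite normrM ler_pM ?fC ?gD.
Qed.

Lemma admissibleZ c f : admissible f -> admissible (fun y => c * f y).
Proof. by apply: admissibleM; exact: admissible_cst. Qed.

Lemma admissibleB f g : admissible f -> admissible g ->
  admissible (fun y => f y - g y).
Proof.
move=> fa ga; have := admissibleD fa (admissibleZ (-1) ga).
by under eq_fun do rewrite mulN1r.
Qed.

Lemma admissibleX k f : admissible f -> admissible (fun y => f y ^+ k).
Proof.
move=> fa; elim: k => [|k IH]; first exact: admissible_cst.
by under eq_fun do rewrite exprS; exact: admissibleM.
Qed.

Lemma measurable_expRM s : measurable_fun setT (fun y => expR (- (s * y))).
Proof.
by apply: measurableT_comp => //; apply: measurableT_comp => //.
Qed.

Lemma admissible_exp s : 0 <= s -> admissible (fun y => expR (- (s * y))).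
Proof.
move=> s0; split; first exact: measurable_expRM.
by exists 1 => y y0; rewrite ger0_norm ?expR_ge0// -expR0 ler_expR oppr_le0 mulr_ge0.
Qed.

(** The k-th power of the inequality s y / k <= e^(s y / k). *)
Lemma pow_exp_le k s y : 0 < s -> 0 <= y ->
  y ^+ k * expR (- (s * y)) <= (k%:R / s) ^+ k.
Proof.
move=> s0 y0; case: k => [|k].
  by rewrite !expr0 mul1r -expR0 ler_expR oppr_le0 mulr_ge0// ltW.
have k0 : 0 < k.+1%:R :> R by [].
rewrite expRN ler_pdivrMr ?expR_gt0//.
have -> : expR (s * y) = expR (s * y / k.+1%:R) ^+ k.+1.
  by rewrite -expRM_natl [_ * (_ / _)]mulrC divfK.
have ks0 : 0 < k.+1%:R / s by rewrite divr_gt0.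
rewrite -exprMn lerXn2r ?nnegrE// ?mulr_ge0 ?expR_ge0 ?invr_ge0// ?(ltW s0)//.
rewrite -ler_pdivrMl//.
have -> : (k.+1%:R / s)^-1 * y = s * y / k.+1%:R by rewrite invfM invrK; ring.
by apply: le_trans (expR_ge1Dx _); rewrite lerDr.
Qed.

Lemma admissible_pow_exp k s : 0 < s ->
  admissible (fun y => y ^+ k * expR (- (s * y))).
Proof.
move=> s0; split.
  by apply: measurable_funM; [exact: measurable_funX|exact: measurable_expRM].
exists ((k%:R / s) ^+ k) => y y0; rewrite ger0_norm ?pow_exp_le//.
by rewrite mulr_ge0 ?exprn_ge0 ?expR_ge0.
Qed.

Lemma admissible_gt x : admissible (fun y => (x < y)%R%:R).
Proof.
split; last by exists 1 => y _; rewrite ger0_norm ?lern1 ?leq_b1.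
have -> : (fun y : R => (x < y)%R%:R : R) = \1_(`]x, +oo[%classic).
  by apply/funext => y; rewrite indicE mem_setE in_itv/= andbT.
exact: measurable_indic.
Qed.

(* Abstract integration against a finite measure on [0, +oo[: the only
   continuity ever needed is that the tails vanish. *)
Record positive_functional J : Prop := PositiveFunctional {
  pfD : forall f g, admissible f -> admissible g ->
    J (fun y => f y + g y) = J f + J g ;
  pfZ : forall c f, admissible f -> J (fun y => c * f y) = c * J f ;
  pf_le : forall f g, admissible f -> admissible g ->
    (forall y, 0 <= y -> f y <= g y) -> J f <= J g ;
  pf_tail0 : J (fun y => (x < y)%R%:R) @[x --> +oo] --> 0 }.

Section laplace.
Variables (J : (R -> R) -> R) (PJ : positive_functional J).

Lemma pfB f g : admissible f -> admissible g ->
  J (fun y => f y - g y) = J f - J g.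
Proof.
move=> fa ga; rewrite -[- J g]mulN1r -pfZ// -pfD//; last exact: admissibleZ.
by congr J; apply/funext => y; rewrite mulN1r.
Qed.

Lemma pf_ge0 f : admissible f -> (forall y, 0 <= y -> 0 <= f y) -> 0 <= J f.
Proof.
move=> fa f0; rewrite -(mul0r (J f)) -pfZ//; apply: pf_le => //.
  exact: admissibleZ.
by move=> y /f0; rewrite mul0r.
Qed.

Lemma pf_norm f g : admissible f -> admissible g ->
  (forall y, 0 <= y -> `|f y| <= g y) -> `|J f| <= J g.
Proof.
move=> fa ga fg; rewrite ler_norml -mulN1r -pfZ// !pf_le//.
- by move=> y /fg; exact: le_trans (ler_norm _).
- exact: admissibleZ.
- by move=> y /fg; rewrite mulN1r ler_norml => /andP[].
Qed.

(** Up to the sign (-1)^k, the k-th derivative of the Laplace transform of the measure behind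
    [J]. *)
Definition lap k s := J (fun y => y ^+ k * expR (- (s * y))).
Definition ftail x := J (fun y => (x < y)%R%:R).

Lemma ftail_ge0 x : 0 <= ftail x.
Proof. by apply: pf_ge0 => //; exact: admissible_gt. Qed.

Lemma ftail_le x y : x <= y -> ftail y <= ftail x.
Proof.
move=> xy; apply: pf_le; [exact: PJ|exact: admissible_gt|exact: admissible_gt|].
move=> z _; rewrite ler_nat; case: (ltP y z) => // yz.
by rewrite (le_lt_trans xy yz).
Qed.

Lemma lap_ge0 k s : 0 < s -> 0 <= lap k s.
Proof.
move=> s0; apply: pf_ge0; first exact: admissible_pow_exp.
by move=> y y0; rewrite mulr_ge0 ?exprn_ge0 ?expR_ge0.
Qed.

Lemma lap_le k s h : 0 < s -> s <= h -> lap k h <= lap k s.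
Proof.
move=> s0 sh; apply: pf_le => //; try exact: admissible_pow_exp.
  by apply: admissible_pow_exp; exact: lt_le_trans sh.
move=> y y0; rewrite ler_wpM2l ?exprn_ge0// ler_expR lerN2.
by rewrite ler_wpM2r.
Qed.

Lemma expR_quad (x : R) : `|expR x - 1 - x| <= x ^+ 2 * expR (`|x| : R).
Proof.
rewrite ger0_norm; last by have := expR_ge1Dx x; lra.
have e0 := expR_gt0 `|x|.
have [x0|x0] := leP 0 x.
  rewrite ger0_norm//; rewrite ger0_norm// in e0.
  have : 1 - x <= expR (- x) by have := expR_ge1Dx (- x); lra.
  rewrite expRN -div1r ler_pdivlMr// => h.
  nra.
rewrite ltr0_norm//; rewrite ltr0_norm// in e0.
have h1 := expR_ge1Dx (- x).
have h2 : expR x * expR (- x) = 1 by rewrite -expRD subrr expR0.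
have h3 := expR_ge1Dx x.
have h4 : expR x <= 1 by rewrite -expR0 ler_expR ltW.
have h5 := expR_gt0 x.
have : expR x - 1 - x <= x ^+ 2 by nra.
have : 1 <= expR (- x) by lra.
nra.
Qed.

Lemma is_derive_quad (f : R -> R) (s d K e : R) : 0 < e ->
  (forall h, `|h| <= e -> `|f (s + h) - f s - h * d| <= K * h ^+ 2) ->
  is_derive s 1 f d.
Proof.
move=> e0 fK.
have fd : h^-1 *: ((f \o shift s) (h *: 1) - f s) @[h --> 0^'] --> d.
  apply/cvgrPdist_le => eps eps0; near=> h.
  have h0 : h != 0 by near: h; exact: nbhs_dnbhs_neq.
  have he : `|h| <= e by near: h; apply: dnbhs0_le.
  have hK : `|h| <= eps / (`|K| + 1).
    by near: h; apply: dnbhs0_le; rewrite divr_gt0// ltr_wpDl.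
  have -> : d - h^-1 *: ((f \o shift s) (h *: 1) - f s) =
      - (h^-1 * (f (s + h) - f s - h * d)).
    rewrite /= scaler1 [h + s]addrC -[_ *: _]/(_ * _); field.
    by [].
  rewrite normrN normrM normfV ler_pdivrMl ?normr_gt0//.
  have Kh : K * `|h| <= eps.
    apply: le_trans (_ : (`|K| + 1) * `|h| <= _).
      by rewrite ler_wpM2r// (le_trans (ler_norm _))// lerDl.
    by rewrite mulrC -ler_pdivlMr ?ltr_wpDl.
  apply: le_trans (fK h he) _; rewrite -[h ^+ 2]real_normK ?num_real//.
  by rewrite expr2 mulrA mulrC ler_wpM2l.
apply: DeriveDef; first by apply/cvg_ex; exists d.
exact: cvg_lim fd.
Unshelve. all: end_near. Qed.

(** [J] is monotone and linear, so a pointwise quadratic bound on the remainder is enough. With |h|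
    <= s/2, half of e^(-s y) absorbs the growth e^(|h| y), and the constant is a transform at
    s/2. *)
Lemma is_derive_lap k s : 0 < s -> is_derive s 1 (lap k) (- lap k.+1 s).
Proof.
move=> s0; apply: (@is_derive_quad _ _ _ (lap k.+2 (s / 2)) (s / 2)).
  by rewrite divr_gt0.
move=> h hs; have sh0 : 0 < s + h.
  by move: hs; rewrite ler_norml => /andP[]; lra.
have a0 := admissible_pow_exp k s0; have a1 := admissible_pow_exp k.+1 s0.
have a2 := admissible_pow_exp k sh0.
rewrite mulrN opprK.
have -> : lap k (s + h) - lap k s + h * lap k.+1 s =
    J (fun y => y ^+ k * expR (- ((s + h) * y)) - y ^+ k * expR (- (s * y)) +
                h * (y ^+ k.+1 * expR (- (s * y)))).
  by rewrite pfD ?pfB ?pfZ//; [exact: admissibleB|exact: admissibleZ].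
rewrite [_ * h ^+ 2]mulrC -pfZ//; last first.
  by apply: admissible_pow_exp; rewrite divr_gt0.
apply: pf_norm.
- by apply: admissibleD; [exact: admissibleB|exact: admissibleZ].
- by apply: admissibleZ; apply: admissible_pow_exp; rewrite divr_gt0.
move=> y y0; have -> : y ^+ k * expR (- ((s + h) * y)) - y ^+ k * expR (- (s * y)) +
    h * (y ^+ k.+1 * expR (- (s * y))) =
    y ^+ k * expR (- (s * y)) * (expR (- (h * y)) - 1 - (- (h * y))).
  rewrite mulrDl opprD expRD exprS; ring.
have -> : h ^+ 2 * (y ^+ k.+2 * expR (- (s / 2 * y))) =
    y ^+ k * expR (- (s * y)) * ((- (h * y)) ^+ 2 * expR (s / 2 * y)).
  rewrite sqrrN exprMn.
  have -> : - (s * y) = - (s / 2 * y) - s / 2 * y by field.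
  rewrite expRD [X in _ = _ * X * _]mulrC !exprS.
  have := expRxMexpNx_1 (s / 2 * y) => E.
  rewrite [RHS](_ : _ = h * (h * 1) * (y * (y * y ^+ k)) * expR (- (s / 2 * y)) *
    (expR (s / 2 * y) * expR (- (s / 2 * y)))); last ring.
  rewrite E; ring.
rewrite normrM ger0_norm; last by rewrite mulr_ge0 ?exprn_ge0 ?expR_ge0.
rewrite ler_wpM2l ?mulr_ge0 ?exprn_ge0 ?expR_ge0//.
apply: le_trans (expR_quad _) _; rewrite ler_wpM2l ?sqr_ge0// ler_expR.
by rewrite normrN normrM (ger0_norm y0) ler_wpM2r.
Qed.

(** 1 - e^(-s y) is at most s K up to K and at most 1 beyond, where the tail of [J] is small. *)
Lemma lap_cvg0 : lap 0 s @[s --> 0^'+] --> J (fun=> 1).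
Proof.
apply/cvgrPdist_le => e e0.
have tail0 : \forall x \near pinfty_nbhs R, ftail x <= e / 2.
  by have /cvgr_le := pf_tail0 PJ; apply; rewrite divr_gt0.
near (pinfty_nbhs R) => K.
have K0 : 0 < K by near: K; exact: nbhs_pinfty_gt.
have KT : ftail K <= e / 2 by near: K.
have J0 : 0 <= J (fun=> 1) by apply: pf_ge0 => //; exact: admissible_cst.
near=> s.
have s0 : 0 < s by near: s; exact: nbhs_right_gt.
have sK : s <= e / 2 / (K * (J (fun=> 1) + 1)).
  near: s; apply: nbhs_right_le; rewrite !divr_gt0// mulr_gt0// ltr_wpDl//.
have a1 := admissible_cst (1 : R); have ae := admissible_pow_exp 0 s0.
have at_ := admissible_gt K.
rewrite /lap -pfB//; apply: (@le_trans _ _ (J (fun y => s * K * 1 + (K < y)%R%:R))).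
  apply: pf_norm.
  - exact: admissibleB.
  - by apply: admissibleD => //; exact: admissibleZ.
  move=> y y0; rewrite expr0 mul1r mulr1 ger0_norm; last first.
    by rewrite subr_ge0 -expR0 ler_expR oppr_le0 mulr_ge0// ltW.
  have [yK|yK] := ltP K y.
    have := expR_ge0 (- (s * y)); have : 0 <= s * K by rewrite mulr_ge0// ltW.
    by rewrite /=; lra.
  have := expR_ge1Dx (- (s * y)); have : s * y <= s * K by rewrite ler_wpM2l// ltW.
  rewrite addr0; lra.
rewrite pfD//; last exact: admissibleZ.
rewrite pfZ// [e]splitr lerD//.
move: sK; rewrite ler_pdivlMr; last by rewrite mulr_gt0// ltr_wpDl.
apply: le_trans; rewrite -mulrA ler_wpM2l ?(ltW s0)// ler_wpM2l ?(ltW K0)//.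
by rewrite lerDl.
Unshelve. all: end_near. Qed.

Lemma lap0_le s : 0 < s -> lap 0 s <= J (fun=> 1).
Proof.
move=> s0; apply: pf_le => //; [exact: admissible_pow_exp|exact: admissible_cst|].
by move=> y y0; rewrite expr0 mul1r -expR0 ler_expR oppr_le0 mulr_ge0// ltW.
Qed.

End laplace.
End positive_functionals.

(** * Finite differences *)

Section finite_differences.
Context {R : realType}.
Implicit Types (f g : R -> R) (a h s K : R) (k n m : nat).

(** The last derivative is outermost, contrary to [top_deriv]: the mean value theorem is to be
    applied to the derivative of order n - 1. *)
Fixpoint is_nderive n f g : Prop :=
  if n is n'.+1 then
    exists2 g', is_nderive n' f g' & forall s : R, 0 < s -> is_derive s 1 g' (g s)
  else forall s, 0 < s -> f s = g s.

Lemma is_nderiveS n f f' g : (forall s : R, 0 < s -> is_derive s 1 f (f' s)) ->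
  is_nderive n f' g -> is_nderive n.+1 f g.
Proof.
move=> ff'; elim: n g => [|n IH] g /=.
  move=> f'g; exists f => // s s0; rewrite -f'g//; exact: ff'.
by move=> [g' f'g' g'g]; exists g' => //; exact: IH.
Qed.

Lemma top_deriv_nderive Phi n c f : top_deriv Phi n c f ->
  exists2 g, is_nderive n f g & g s / Phi s @[s --> 0^'+] --> c.
Proof.
elim: n f => [|n IH] f /=; first by exists f.
by move=> [f0 [f' ff' /IH[g f'g gc]]]; exists g => //; exact: is_nderiveS f'g.
Qed.

Lemma real_derive_shift g h s d : is_derive (s + h) 1 g d ->
  is_derive s 1 (fun x => g (x + h)) d.
Proof.
move=> gd; have := @is_derive1_comp _ g (fun x => x + h) s d 1.
rewrite mulr1; apply => //.
have := @real_deriveD _ id (cst h) s 1 0 (is_derive_id _ _) (is_derive_cst _ _ _).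
by rewrite addr0.
Qed.

Lemma is_nderive_diff n f g h : 0 <= h -> is_nderive n f g ->
  is_nderive n (fun x => f x - f (x + h)) (fun x => g x - g (x + h)).
Proof.
move=> h0; elim: n g => [|n IH] g /=.
  by move=> fg s s0; rewrite !fg// ltr_wpDr.
move=> [g' /IH fg' g'g]; exists (fun x => g' x - g' (x + h)) => // s s0.
have sh0 : 0 < s + h by rewrite ltr_wpDr.
have := @real_deriveZ _ _ (-1) _ _ (real_derive_shift (g'g _ sh0)).
move/(real_deriveD (g'g _ s0)); rewrite mulN1r.
by under [X in is_derive _ _ X _]funext => x do rewrite mulN1r.
Qed.

Fixpoint fdiff n h f a : R :=
  if n is n'.+1 then fdiff n' h f a - fdiff n' h f (a + h) else f a.

Lemma fdiffS n h f a : fdiff n.+1 h f a = fdiff n h (fun x => f x - f (x + h)) a.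
Proof.
elim: n a => [//|n IH] a; rewrite [LHS]/= -/(fdiff n.+1 h f a).
by rewrite -/(fdiff n.+1 h f (a + h)) !IH.
Qed.

(** Induction on the function: one difference is moved inside, and the mean value theorem trades one
    order of derivation for a factor h. *)
Lemma fdiff_bound n h f g a K : 0 < a -> 0 <= h -> is_nderive n f g ->
  (forall x, a <= x <= a + n%:R * h -> `|g x| <= K) ->
  `|fdiff n h f a| <= h ^+ n * K.
Proof.
move=> a0 h0; elim: n f g K => [|n IH] f g K.
  by move=> fg gK; rewrite /= fg// expr0 mul1r gK// mul0r addr0 lexx.
move=> [g' fg' g'g] gK; rewrite fdiffS exprSr -mulrA.
apply: (IH _ (fun x => g' x - g' (x + h))); first exact: is_nderive_diff.
move=> x /andP[ax xan]; have x0 : 0 < x by exact: lt_le_trans ax.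
have nh0 : 0 <= n%:R * h by rewrite mulr_ge0.
move: h0; rewrite le_eqVlt => /predU1P[<-|h0].
  by rewrite addr0 subrr normr0 mul0r.
have [|||c cx E] := @MVT R g' g x (x + h); first by rewrite ltrDl.
- move=> y; rewrite in_itv/= => /andP[xy _]; apply: g'g; exact: lt_trans xy.
- apply: derivable_within_continuous => y; rewrite in_itv/= => /andP[xy _].
  by have [] := g'g y (lt_le_trans x0 xy).
rewrite distrC E addrAC subrr add0r normrM mulrC (gtr0_norm h0) ler_wpM2l ?(ltW h0)//.
move: cx; rewrite in_itv/= => /andP[xc cxh]; apply: gK.
rewrite (le_trans ax (ltW xc))/= -natr1 mulrDl mul1r addrA (le_trans (ltW cxh))//.
by rewrite lerD2r.
Qed.

(** Each difference in excess of the n controlled derivatives at most doubles the bound. *)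
Lemma fdiff_bound_add m n h f g a K : 0 < a -> 0 <= h -> is_nderive n f g ->
  (forall x, a <= x <= a + (m + n)%:R * h -> `|g x| <= K) ->
  `|fdiff (m + n) h f a| <= 2 ^+ m * (h ^+ n * K).
Proof.
move=> + h0 fg; elim: m a => [|m IH] a a0 gK.
  by rewrite expr0 mul1r; exact: fdiff_bound gK.
rewrite addSn /= exprS -mulrA mulr_natl mulr2n (le_trans (ler_normB _ _))//.
rewrite addSn -natr1 mulrDl mul1r in gK.
apply: lerD; apply: IH => //.
- move=> x /andP[ax xa]; apply: gK; rewrite ax/=.
  by rewrite (le_trans xa)// addrA lerDl.
- by rewrite ltr_wpDr.
- move=> x /andP[ax xa]; apply: gK; rewrite (le_trans _ ax) ?lerDl//=.
  by rewrite [_ * h + h]addrC addrA.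
Qed.

Lemma fdiffB n h f g a c :
  fdiff n h (fun s => f s - c * g s) a = fdiff n h f a - c * fdiff n h g a.
Proof. by elim: n a => [//|n IH] a /=; rewrite !IH; ring. Qed.

Variables (J : (R -> R) -> R) (PJ : positive_functional J).

Lemma admissible_1Bexp h : 0 <= h -> admissible (fun y => 1 - expR (- (h * y))).
Proof. by move=> h0; apply: admissibleB; [exact: admissible_cst|exact: admissible_exp]. Qed.

(** Differences of exponentials factorize: differences of the transform are thereby integrals of [J]
    against a positive weight, whose shape near 0 is that of y^n. *)
Lemma fdiff_lap n h a : 0 < a -> 0 <= h ->
  fdiff n h (lap J 0) a = J (fun y => expR (- (a * y)) * (1 - expR (- (h * y))) ^+ n).
Proof.
move=> + h0; elim: n a => [|n IH] a a0.
  by congr J; apply/funext => y; rewrite !expr0 mul1r mulr1.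
have ah0 : 0 < a + h by rewrite ltr_wpDr.
rewrite /= !IH// -pfB//.
- by congr J; apply/funext => y; rewrite mulrDl opprD expRD exprS; ring.
- by apply: admissibleM; [apply: admissible_exp; exact: ltW|apply: admissibleX; exact: admissible_1Bexp].
- by apply: admissibleM; [apply: admissible_exp; exact: ltW|apply: admissibleX; exact: admissible_1Bexp].
Qed.

(** By uniqueness of derivatives, the witnesses hidden in [top_deriv] are the transforms of higher
    order. *)
Lemma top_deriv_lap_cvg Phi n k c d :
  top_deriv Phi n c (fun s => d * lap J k s) ->
  (-1) ^+ n * d * lap J (n + k) s / Phi s @[s --> 0^'+] --> c.
Proof.
elim: n k d => [|n IH] k d /=; first by rewrite expr0 mul1r.
move=> [_ [f' ff' f'c]]; rewrite addSn -addnS exprSr mulrN1 mulNr -mulrN.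
apply: IH; apply: eq_top_deriv f'c => s s0.
have H := real_deriveZ d (is_derive_lap PJ k s0); have H' := ff' s s0.
by rewrite mulNr -mulrN -(@derive_val _ _ _ _ _ _ _ H) (@derive_val _ _ _ _ _ _ _ H').
Qed.

Lemma lap_top_deriv Phi n k c d :
  (forall i, (k <= i < n + k)%N -> subpoly (lap J i)) ->
  lap J (n + k) s / Phi s @[s --> 0^'+] --> c ->
  top_deriv Phi n ((-1) ^+ n * d * c) (fun s => d * lap J k s).
Proof.
elim: n k d => [|n IH] k d ks kc /=.
  rewrite expr0 mul1r; apply: eq_pos_cvg (cvgM (cvg_cst d) kc) => s _.
  by rewrite mulrA.
split.
  apply: subpolyM; first exact: (cvg_subpoly (cvg_cst d)).
  by apply: ks; rewrite leqnn addSn ltnS leq_addl.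
exists (fun s => (- d) * lap J k.+1 s).
  by move=> s s0; rewrite mulNr -mulrN; apply: real_deriveZ; exact: is_derive_lap.
rewrite exprSr mulrN1 mulNr -mulrN; apply: IH; last by rewrite addnS.
by move=> i /andP[ki ik]; apply: ks; rewrite (ltnW ki) addSnnS.
Qed.

End finite_differences.

(** * A Tauberian theorem by comparison *)

Section near_points.
Context {R : realType}.
Implicit Types (P : R -> Prop).

Lemma near0P P : (\forall s \near 0^'+, P s) <->
  exists2 e : R, 0 < e & forall s, 0 < s < e -> P s.
Proof.
split=> [[e /= e0 eP]|[e e0 eP]].
  exists e => // s /andP[s0 se]; apply: eP => //=.
  by rewrite sub0r normrN gtr0_norm.
near=> s; apply: eP; apply/andP; split; near: s; first exact: nbhs_right_gt.
exact: nbhs_right_lt.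
Unshelve. all: end_near. Qed.

Lemma nearyP P : (\forall x \near pinfty_nbhs R, P x) <->
  exists2 M : R, 0 < M & forall x, M <= x -> P x.
Proof.
split=> [[M [Mr MP]]|[M M0 MP]].
  exists (`|M| + 1); first by rewrite ltr_wpDl.
  by move=> x Mx; apply: MP; rewrite (lt_le_trans _ Mx)// (le_lt_trans (ler_norm _))// ltrDl.
near=> x; apply: MP; near: x; exact: nbhs_pinfty_ge (num_real _).
Unshelve. all: end_near. Qed.

Lemma near_inv P : (\forall s \near 0^'+, P s) ->
  \forall x \near pinfty_nbhs R, P x^-1.
Proof.
move=> /near0P[e e0 eP]; near=> x; apply: eP.
have x0 : 0 < x by near: x; exact: nbhs_pinfty_gt (num_real _).
rewrite invr_gt0 x0/= invf_plt ?posrE//.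
by near: x; exact: nbhs_pinfty_gt (num_real _).
Unshelve. all: end_near. Qed.

Lemma near_scale P (q : R) : 0 < q -> (\forall x \near pinfty_nbhs R, P x) ->
  \forall x \near pinfty_nbhs R, P (q * x).
Proof.
move=> q0 /nearyP[M M0 MP]; near=> x; apply: MP.
by rewrite -ler_pdivrMl//; near: x; exact: nbhs_pinfty_ge (num_real _).
Unshelve. all: end_near. Qed.

Lemma near_unscale P (q : R) : 0 < q ->
  (\forall x \near pinfty_nbhs R, P (q * x)) -> \forall x \near pinfty_nbhs R, P x.
Proof.
move=> q0 /(@near_scale (fun x => P (q * x)) q^-1).
rewrite invr_gt0 => /(_ q0); apply: filterS => x.
by rewrite mulrA mulfV ?mul1r// gt_eqF.
Qed.

End near_points.

Section regular_variation.
Context {R : realType}.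
Implicit Types (T t : R -> R) (a q x : R).

Definition regularly_varying a T := (forall x, 0 < x -> 0 < T x) /\
  forall q, 0 < q -> T (q * x) / T x @[x --> pinfty_nbhs R] --> q `^ a.

Lemma regularly_varying_ratio a T p q : 0 < p -> 0 < q -> regularly_varying a T ->
  T (p * x) / T (q * x) @[x --> pinfty_nbhs R] --> (p / q) `^ a.
Proof.
move=> p0 q0 [T0 Ta].
rewrite powRM ?invr_ge0 ?ltW// -[q^-1]powR_inv1 ?ltW// -powRrM mulN1r powRN.
have qa0 : q `^ a != 0 by rewrite gt_eqF// powR_gt0.
apply: cvg_trans (cvgM (Ta p p0) (cvgV qa0 (Ta q q0))); apply: near_eq_cvg.
near=> x; have x0 : 0 < x by near: x; exact: nbhs_pinfty_gt (num_real _).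
have Tx := T0 _ x0; rewrite /= invfM invrK [X in _ / _ * X]mulrC [LHS]mulrA.
by rewrite divfK// gt_eqF.
Unshelve. all: end_near. Qed.

(** Telescoping along x, 2 x, 4 x, ... gives a geometric series of ratio [theta]; the remainder
    vanishes because t tends to 0. *)
Lemma tail_le_of_dyadic T t (C theta x0 : R) : 0 < x0 -> 0 <= C -> 0 <= theta < 1 ->
  t x @[x --> pinfty_nbhs R] --> 0 ->
  (forall x, x0 <= x -> 0 <= T x) ->
  (forall x, x0 <= x -> T (2 * x) <= theta * T x) ->
  (forall x, x0 <= x -> t x <= t (2 * x) + C * T x) ->
  forall x, x0 <= x -> t x <= C / (1 - theta) * T x.
Proof.
move=> x00 C0 /andP[th0 th1] t0 T0 Tth tC x x0x.
have th' : 0 < 1 - theta by rewrite subr_gt0.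
have le_pow n : x <= 2 ^+ n * x.
  by rewrite ler_peMl ?exprn_ege1 ?ler1n// (le_trans (ltW x00)).
have Tn n : T (2 ^+ n * x) <= theta ^+ n * T x.
  elim: n => [|n IH]; first by rewrite !expr0 !mul1r.
  rewrite !exprS -!mulrA (le_trans (Tth _ (le_trans x0x (le_pow n))))//.
  by rewrite ler_wpM2l.
have tn n : t x <= t (2 ^+ n * x) + C / (1 - theta) * (1 - theta ^+ n) * T x.
  elim: n => [|n IH]; first by rewrite !expr0 subrr mul1r mulr0 mul0r addr0.
  apply: le_trans IH _; apply: le_trans (lerD (tC _ (le_trans x0x (le_pow n))) (lexx _)) _.
  rewrite [2 * _]mulrA -exprS -addrA lerD2l.
  apply: le_trans (lerD (ler_wpM2l C0 (Tn n)) (lexx _)) _.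
  by rewrite exprS le_eqVlt; apply/orP; left; apply/eqP; field; rewrite gt_eqF.
apply/ler_addgt0Pr => e e0.
have /nearyP[M M0 Me] : \forall y \near pinfty_nbhs R, `|t y| <= e.
  by move/cvgr0_norm_le : t0; apply.
pose n := (Num.truncn (M / x)).+1.
have x0' : 0 < x by exact: lt_le_trans x0x.
have Mn : M <= 2 ^+ n * x.
  rewrite -ler_pdivrMr// (le_trans (ltW (truncnS_gt _)))//.
  by rewrite -natrX ler_nat ltnW// ltn_expl.
apply: le_trans (tn n) _; rewrite addrC lerD//; last exact: le_trans (ler_norm _) (Me _ Mn).
rewrite ler_wpM2r ?T0// ler_piMr ?divr_ge0 ?(ltW th')//.
by rewrite lerBlDr lerDl exprn_ge0.
Qed.

End regular_variation.

(** * Smooth step functions *)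

Section step_weights.
Context {R : realType}.
Implicit Types (n M : nat) (d e x u N : R).

Lemma bernoulli_ineq n x : 0 <= x <= 1 -> 1 - n%:R * x <= (1 - x) ^+ n.
Proof.
move=> /andP[x0 x1]; elim: n => [|n IH]; first by rewrite mul0r subr0 expr0.
rewrite exprSr; apply: le_trans (ler_wpM2r _ IH); last by rewrite subr_ge0.
rewrite -natr1; have : 0 <= n%:R * x * x by rewrite !mulr_ge0.
nra.
Qed.

(* The M-th power of 1 - e^(-Nu) with M close to e^N is a smooth step at u = 1
   which moreover vanishes to order n at u = 0. *)
Lemma step_weight n d e : 0 < d < 1 -> 0 < e -> exists N M,
  [/\ 0 < N, (n <= M)%N,
     forall u, 1 + d <= u -> 1 - e <= (1 - expR (- (N * u))) ^+ M &
     forall u, 0 <= u <= 1 - d -> (1 - expR (- (N * u))) ^+ M <= e * u ^+ n].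
Proof.
move=> /andP[d0 d1] e0.
pose C := (n.+1%:R / d) ^+ n.+1 : R.
have C0 : 0 < C by rewrite exprn_gt0// divr_gt0.
(* The first summand yields N^n e^(-d N) <= e, the second one (n + 2) e^(-d N) <= e. *)
pose N := C / e + n.+2%:R / (d * e).
have N0 : 0 < N by rewrite addr_gt0// divr_gt0// mulr_gt0.
have hC : N ^+ n * expR (- (d * N)) <= e.
  have := @pow_exp_le _ n.+1 d N d0 (ltW N0); rewrite -/C exprS -mulrA.
  rewrite -ler_pdivlMl// => /le_trans; apply.
  rewrite mulrC ler_pdivrMr// mulrC -ler_pdivrMr//.
  by rewrite lerDl divr_ge0// mulr_ge0// ltW.
have hn : n.+2%:R * expR (- (d * N)) <= e.
  have := @pow_exp_le _ 1 d N d0 (ltW N0); rewrite !expr1.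
  rewrite -ler_pdivlMl// => h; apply: le_trans (ler_wpM2l _ h) _ => //.
  rewrite mulrCA mulrC ler_pdivrMr//.
  have -> : n.+2%:R * (1 / d) = e * (n.+2%:R / (d * e)).
    by field; rewrite !gt_eqF.
  by rewrite ler_wpM2l ?(ltW e0)// lerDr divr_ge0// ltW.
pose m := (Num.truncn (expR N)).+1.
have mN : expR N <= m%:R by exact/ltW/truncnS_gt.
have Nm : m%:R <= expR N + 1.
  by rewrite -natr1 lerD2r truncn_le ?expR_ge0.
exists N, (n + m)%N; split => //; first exact: leq_addr.
(* By Bernoulli the defect is at most (n + 1 + e^N) e^(-N) e^(-d N), hence at most (n + 2) e^(-d
   N). *)
- move=> u du; have Nu0 : 0 <= N * u by rewrite mulr_ge0 ?(ltW N0)//; lra.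
  apply: le_trans (bernoulli_ineq _ _); last first.
    by rewrite expR_ge0/= -expR0 ler_expR oppr_le0.
  rewrite lerD2l lerN2; apply: le_trans hn.
  have h1 : expR (- (N * u)) <= expR (- N) * expR (- (d * N)).
    rewrite -expRD ler_expR; nra.
  apply: le_trans (ler_wpM2l _ h1) _ => //; rewrite mulrA ler_wpM2r ?expR_ge0//.
  have E1 : expR N * expR (- N) = 1 by rewrite expRxMexpNx_1.
  have E2 : expR (- N) <= 1 by rewrite -expR0 ler_expR oppr_le0 ltW.
  have E3 := expR_gt0 (- N).
  rewrite natrD -addn2 natrD.
  have n0 : 0 <= n%:R :> R by [].
  nra.
(* The power m is at most exp(- m e^(-N u)) <= exp(- e^(d N)) <= e^(-d N), and the power n is at
   most (N u)^n. *)
- move=> u /andP[u0 u1]; have Nu0 : 0 <= N * u by rewrite mulr_ge0 ?(ltW N0).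
  have w1 : expR (- (N * u)) <= 1 by rewrite -expR0 ler_expR oppr_le0.
  have w0 := expR_ge0 (- (N * u)).
  have wN : 1 - expR (- (N * u)) <= N * u by have := expR_ge1Dx (- (N * u)); lra.
  rewrite exprD mulrC; apply: (@le_trans _ _ (expR (- (d * N)) * (N * u) ^+ n)).
    apply: ler_pM; rewrite ?exprn_ge0 ?subr_ge0//.
      apply: (@le_trans _ _ (expR (- (m%:R * expR (- (N * u)))))).
        rewrite -(mulrN m%:R) expRM_natl lerXn2r ?nnegrE ?subr_ge0 ?expR_ge0//.
        by have := expR_ge1Dx (- expR (- (N * u))); lra.
      rewrite ler_expR lerN2.
      apply: (@le_trans _ _ (expR N * expR (- (N * u)))); last by rewrite ler_wpM2r.
      rewrite -expRD; apply: le_trans (_ : expR (d * N) <= _); last first.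
        by rewrite ler_expR; nra.
      by apply: le_trans (expR_ge1Dx _); rewrite lerDr.
    by rewrite lerXn2r ?nnegrE ?subr_ge0//.
  by rewrite exprMn mulrA [_ * N ^+ n]mulrC ler_wpM2r ?exprn_ge0.
Qed.

End step_weights.

(** * Comparison of tails through their transforms *)

Section tauberian.
Context {R : realType}.
Implicit Types (J : (R -> R) -> R) (T : R -> R) (x s d e a c C : R).

(** By [fdiff_lap], the weight attached to the M-th difference of step N s taken at the point eps s.
    The damping exponential keeps the differences away from 0, where the derivatives blow up. *)
Definition step_fun (s eps N : R) (M : nat) (y : R) :=
  expR (- (eps * s * y)) * (1 - expR (- (N * s * y))) ^+ M.

Lemma admissible_step s eps N M : 0 < s -> 0 < eps -> 0 < N ->
  admissible (step_fun s eps N M).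
Proof.
move=> s0 eps0 N0; apply: admissibleM; first by apply: admissible_exp; rewrite mulr_ge0// ltW.
by apply: admissibleX; apply: admissible_1Bexp; rewrite mulr_ge0// ltW.
Qed.

(* Only the bound T controls the part of J2 below the step. *)
Lemma tail_comparison J1 J2 T (n : nat) c C C1 d :
  positive_functional J1 -> positive_functional J2 ->
  0 < c -> 0 < C -> 0 < d < 1 / 2 ->
  (\forall s \near 0^'+, s ^+ n * lap J2 n s <= C * T s^-1) ->
  (forall eps N M, 0 < eps <= 1 -> 0 < N -> (n <= M)%N -> forall e, 0 < e ->
     \forall s \near 0^'+,
       `|J1 (step_fun s eps N M) - c * J2 (step_fun s eps N M)| <= e * T s^-1) ->
  (\forall x \near pinfty_nbhs R, ftail J1 x <= C1 * T x) ->
  \forall x \near pinfty_nbhs R,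
    ftail J1 ((1 + d) * x) <=
      (c * ftail J2 ((1 - d) * x) + (c * expR 1 * C + 1) * d * T x) / (1 - d) ^+ 2
      + C1 * T (d^-1 * x).
Proof.
move=> PJ1 PJ2 c0 C0 /andP[d0 d12] HC Hstep HC1.
have d1 : d < 1 by lra.
have [N [M [N0 nM Wge Wle]]] := @step_weight _ n d d (introT andP (conj d0 d1)) d0.
(* On ](1 + d) x, x / d] the damping exponent eps y / x is at most d, so that the damping factor is
   at least 1 - d. The mass beyond x / d is left to the rough bound [HC1]. *)
pose eps := d ^+ 2.
have eps0 : 0 < eps by rewrite exprn_gt0.
have eps1 : eps <= 1 by rewrite exprn_ile1 ?ltW.
have Hs := near_inv (Hstep eps N M (introT andP (conj eps0 eps1)) N0 nM d d0).
have di0 : 0 < d^-1 by rewrite invr_gt0.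
have Hd := near_scale di0 HC1; have HC' := near_inv HC.
near=> x.
have x0 : 0 < x by near: x; exact: nbhs_pinfty_gt (num_real _).
have s0 : 0 < x^-1 by rewrite invr_gt0.
have aW := @admissible_step x^-1 eps N M s0 eps0 N0.
have W0 y : 0 <= y -> 0 <= step_fun x^-1 eps N M y.
  move=> y0; rewrite mulr_ge0 ?expR_ge0// exprn_ge0// subr_ge0 -expR0 ler_expR.
  by rewrite oppr_le0 !mulr_ge0// ltW.
pose W := step_fun x^-1 eps N M.
have lower : (1 - d) ^+ 2 * (ftail J1 ((1 + d) * x) - ftail J1 (d^-1 * x)) <= J1 W.
  have a12 := admissibleB (admissible_gt ((1 + d) * x)) (admissible_gt (d^-1 * x)).
  rewrite /ftail -(pfB PJ1) ?admissible_gt//; try exact: admissible_gt.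
  rewrite -(pfZ PJ1)//; apply: (pf_le PJ1) => //; first exact: admissibleZ.
  move=> y y0.
  have xy : (1 + d) * x <= d^-1 * x.
    by rewrite ler_wpM2r ?(ltW x0)// -[leRHS]mul1r ler_pdivlMr//; nra.
  have [y1|y1] := ltP ((1 + d) * x) y; last first.
    by rewrite ltNge (le_trans y1 xy)/= subrr mulr0 W0.
  have [y2|y2] := ltP (d^-1 * x) y; first by rewrite subrr mulr0 W0.
  rewrite subr0 mulr1 expr2; apply: ler_pM; rewrite ?subr_ge0 ?(ltW d1)//.
    apply: le_trans (_ : expR (- d) <= _); first by have := expR_ge1Dx (- d).
    rewrite ler_expR lerN2 /eps -mulrA [x^-1 * y]mulrC expr2 -mulrA ler_piMr ?(ltW d0)//.
    rewrite mulrA ler_pdivrMr// mul1r -ler_pdivlMl//.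
  rewrite -mulrA; apply: Wge.
  by rewrite [_ * y]mulrC ler_pdivlMr// ltW.
(* Below (1 - d) x the weight is at most d (y / x)^n, and the factor e e^(-y / x) >= 1 turns this
   into the integrand of [lap J2 n] at 1 / x. *)
have upper : J2 W <= ftail J2 ((1 - d) * x) + d * expR 1 * (x^-1 ^+ n * lap J2 n x^-1).
  have a1 := admissible_gt ((1 - d) * x); have a2 := admissible_pow_exp n s0.
  have a3 := admissibleZ (d * expR 1 * x^-1 ^+ n) a2.
  rewrite mulrA /lap -(pfZ PJ2)// /ftail -(pfD PJ2)//; apply: (pf_le PJ2) => //.
    exact: admissibleD.
  move=> y y0; have sy0 : 0 <= x^-1 * y by rewrite mulr_ge0// ltW.
  have rest0 : 0 <= d * expR 1 * x^-1 ^+ n * (y ^+ n * expR (- (x^-1 * y))).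
    by rewrite !mulr_ge0 ?exprn_ge0 ?expR_ge0 ?(ltW d0) ?(ltW s0).
  have e1 : expR (- (eps * x^-1 * y)) <= 1.
    by rewrite -expR0 ler_expR oppr_le0 -mulrA mulr_ge0// ltW.
  have w0 : 0 <= 1 - expR (- (N * x^-1 * y)).
    by rewrite subr_ge0 -expR0 ler_expR oppr_le0 -mulrA mulr_ge0// ltW.
  have [y1|y1] := ltP ((1 - d) * x) y.
    apply: le_trans (_ : 1 <= _); last by rewrite /= lerDl.
    rewrite /W /step_fun -[X in _ <= X]mulr1 ler_pM ?expR_ge0 ?exprn_ge0//.
    by rewrite exprn_ile1// lerBlDr lerDl expR_ge0.
  rewrite add0r; apply: le_trans (_ : d * (x^-1 * y) ^+ n <= _).
    rewrite /W /step_fun -[X in _ <= X]mul1r ler_pM ?expR_ge0 ?exprn_ge0//.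
    rewrite -mulrA; apply: Wle; rewrite sy0/= mulrC ler_pdivrMr//.
  rewrite exprMn [X in _ <= X](_ : _ = d * (x^-1 ^+ n * y ^+ n) *
    (expR 1 * expR (- (x^-1 * y)))); last by ring.
  rewrite ler_peMr// ?mulr_ge0 ?exprn_ge0 ?(ltW d0) ?(ltW s0)// -expRD.
  apply: le_trans (expR_ge1Dx _); rewrite lerDl subr_ge0 mulrC ler_pdivrMr// mul1r (le_trans y1)// ler_piMl ?(ltW x0)//.
  by rewrite lerBlDr lerDl ltW.
have hs : `|J1 W - c * J2 W| <= d * T x.
  by rewrite -[X in T X](invrK x) /W; near: x; exact: Hs.
have hC : x^-1 ^+ n * lap J2 n x^-1 <= C * T x.
  by rewrite -[X in T X](invrK x); near: x; exact: HC'.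
have hd : ftail J1 (d^-1 * x) <= C1 * T (d^-1 * x) by near: x.
have d10 : 0 < (1 - d) ^+ 2 by rewrite exprn_gt0// subr_gt0.
rewrite -lerBlDr ler_pdivlMr//.
apply: (@le_trans _ _ (J1 W)).
  by apply: le_trans lower; rewrite mulrC ler_wpM2l ?(ltW d10)// lerD2l lerN2.
move: hs; rewrite ler_norml => /andP[_]; rewrite lerBlDl => hs.
apply: le_trans hs _.
apply: (@le_trans _ _ (c * (ftail J2 ((1 - d) * x) + d * expR 1 * (C * T x)) + d * T x)).
  rewrite lerD2r ler_wpM2l ?(ltW c0)// (le_trans upper)// lerD2l ler_wpM2l//.
  by rewrite mulr_ge0 ?expR_ge0// ltW.
by rewrite le_eqVlt; apply/orP; left; apply/eqP; ring.
Unshelve. all: end_near. Qed.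

Section comparison.
Variables (Jm Jn : (R -> R) -> R) (n : nat) (a c C : R).
Hypotheses (PJm : positive_functional Jm) (PJn : positive_functional Jn).
Hypotheses (a0 : 0 < a) (c0 : 0 < c) (C0 : 0 < C).
Let T := ftail Jm.
Let Phi := lap Jm n.
Hypothesis rvT : regularly_varying (- a) T.
Hypothesis Phi_gt0 : forall s, 0 < s -> 0 < Phi s.
Hypothesis Phi_large :
  exists2 e : R, 0 < e & (s `^ e * Phi s)^-1 @[s --> 0^'+] --> 0.
Hypothesis Phi_le : \forall s \near 0^'+, s ^+ n * Phi s <= C * T s^-1.
Hypothesis topm : top_deriv Phi n ((-1) ^+ n) (lap Jm 0).
Hypothesis topn : top_deriv Phi n ((-1) ^+ n * c) (lap Jn 0).

Let T_gt0 x : 0 < x -> 0 < T x. Proof. by case: rvT => + _; apply. Qed.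

(** The n-th derivative of the difference of the two transforms is o([Phi]), and [Phi] is
    nonincreasing: its value at the left end eps s bounds it at all the points involved. *)
Let fdiff_small (N : R) M eps e : 0 < eps <= 1 -> 0 < N -> (n <= M)%N -> 0 < e ->
  \forall s \near 0^'+,
    `|Jn (step_fun s eps N M) - c * Jm (step_fun s eps N M)| <= e * T s^-1.
Proof.
move=> /andP[eps0 eps1] N0 nM e0.
have := top_derivD topn (top_derivZ Phi_large (- c) topm).
have -> : (-1) ^+ n * c + - c * (-1) ^+ n = 0 by ring.
move/top_deriv_nderive => [g fg g0].
(* The constants of [fdiff_bound_add]; the power of eps converts s^n into (eps s)^n, for which
   [Phi_le] is available. *)
pose K := 2 ^+ (M - n) * N ^+ n / eps ^+ n * C.
have K0 : 0 < K by rewrite !mulr_gt0 ?invr_gt0 ?exprn_gt0.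
have eK0 : 0 < e / K by rewrite divr_gt0.
have /near0P[s1 s10 gs1] : \forall s \near 0^'+, `|g s / Phi s| <= e / K.
  by move/cvgr0_norm_le : g0; apply.
have /near0P[s2 s20 Phis2] := Phi_le.
near=> s.
have s0 : 0 < s by near: s; exact: nbhs_right_gt.
have es0 : 0 < eps * s by rewrite mulr_gt0.
have Ns0 : 0 <= N * s by rewrite mulr_ge0// ltW.
rewrite /step_fun -!fdiff_lap// -fdiffB -(subnK nM).
apply: le_trans.
  apply: (@fdiff_bound_add _ (M - n) n (N * s) _ g _ (e / K * Phi (eps * s))) => //.
    move: fg; rewrite (_ : (fun s => _) = (fun s => lap Jn 0 s - c * lap Jm 0 s))//.
    by apply/funext => x; rewrite mulNr.
  move=> x /andP[ex xe]; have x0 : 0 < x by exact: lt_le_trans ex.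
  have xs1 : x < s1.
    apply: le_lt_trans xe _; rewrite mulrA -mulrDl -ltr_pdivlMl ?ltr_wpDr// ?mulr_ge0 ?(ltW N0)//.
    near: s; apply: nbhs_right_lt; rewrite mulr_gt0// invr_gt0 ltr_wpDr//.
    by rewrite mulr_ge0 ?(ltW N0).
  have := gs1 x (introT andP (conj x0 xs1)).
  rewrite normrM normfV (gtr0_norm (Phi_gt0 x0)) ler_pdivrMr ?Phi_gt0// => /le_trans; apply.
  by rewrite ler_wpM2l ?(ltW eK0)//; exact: lap_le.
have es2 : eps * s < s2.
  apply: le_lt_trans (_ : s < _); first by rewrite ler_piMl ?(ltW s0).
  by near: s; exact: nbhs_right_lt.
have := Phis2 _ (introT andP (conj es0 es2)).
have Tes : T (eps * s)^-1 <= T s^-1.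
  by apply: (ftail_le PJm); rewrite lef_pV2 ?posrE// ler_piMl ?(ltW s0).
move=> /le_trans/(_ (ler_wpM2l (ltW C0) Tes)) h.
rewrite [leLHS](_ : _ = e / C * ((eps * s) ^+ n * Phi (eps * s))); last first.
  rewrite /K !exprMn; field.
  by rewrite !expf_neq0 ?gt_eqF.
apply: le_trans (ler_wpM2l _ h) _; first by rewrite divr_ge0// ltW.
by rewrite mulrA divfK ?gt_eqF.
Unshelve. all: end_near. Qed.

Let lapn_le : \forall s \near 0^'+, s ^+ n * lap Jn n s <= (c + 1) * C * T s^-1.
Proof.
have topn' : top_deriv Phi n ((-1) ^+ n * c) (fun s => 1 * lap Jn 0 s).
  by apply: eq_top_deriv topn => s _; rewrite mul1r.
have nn1 : (-1) ^+ n * (-1) ^+ n = 1 :> R by rewrite -exprMn mulrNN mulr1 expr1n.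
have H : lap Jn n s / Phi s @[s --> 0^'+] --> c.
  rewrite -[X in _ --> X]mul1r -nn1 -mulrA.
  have H0 := top_deriv_lap_cvg PJn topn'.
  apply: eq_pos_cvg (cvgM (cvg_cst ((-1) ^+ n : R)) H0) => s _.
  by rewrite /= addn0 mulr1 !mulrA nn1 mul1r.
have Hc : \forall s \near 0^'+, lap Jn n s / Phi s <= c + 1.
  by move/cvgr_le : H; apply; rewrite ltrDl.
near=> s; have s0 : 0 < s by near: s; exact: nbhs_right_gt.
rewrite -mulrA; apply: (@le_trans _ _ ((c + 1) * (s ^+ n * Phi s))).
  rewrite mulrCA ler_wpM2l ?exprn_ge0 ?(ltW s0)// -ler_pdivrMr ?Phi_gt0//.
  by near: s.
by rewrite ler_wpM2l ?addr_ge0 ?(ltW c0)//; near: s.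
Unshelve. all: end_near. Qed.

(** A rough bound, used to discard the mass of [Jn] far beyond the step. On ]x, 2 x] one has (y /
    x)^n e^(2 - y / x) >= 1, so the mass of this block is controlled by [lapn_le]; dyadic blocks are
    then summed. *)
Let tailn_le : exists2 C1, 0 < C1 & \forall x \near pinfty_nbhs R, ftail Jn x <= C1 * T x.
Proof.
pose C2 := expR 2 * ((c + 1) * C).
have C20 : 0 < C2 by rewrite !mulr_gt0 ?expR_gt0// addr_gt0.
(* Any ratio strictly between 2^(-a) and 1; it exists as a > 0. *)
pose theta := (2 `^ (- a) + 1) / 2.
have th : 2 `^ (- a) < (1 : R).
  rewrite powRN invf_lt1 ?powR_gt0//.
  have := @gt0_ltr_powR _ a a0 1 2; rewrite !nnegrE powR1.
  by apply=> //; rewrite ltr1n.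
have th0 : 0 <= 2 `^ (- a) :> R by rewrite powR_ge0.
have [theta0 theta1 thta] : [/\ 0 <= theta, theta < 1 & 2 `^ (- a) < theta].
  by rewrite /theta; split; lra.
have /nearyP[x1 x10 hx1] : \forall x \near pinfty_nbhs R, T (2 * x) / T x <= theta.
  by case: rvT => _ /(_ 2 (ltr0n _ 2))/cvgr_le; apply.
have /nearyP[x2 x20 hx2] := near_inv lapn_le.
exists (C2 / (1 - theta)); first by rewrite divr_gt0// subr_gt0.
apply/nearyP; exists (Num.max x1 x2); first by rewrite lt_max x10.
apply: (@tail_le_of_dyadic _ T (ftail Jn) C2 theta) => //.
- by rewrite lt_max x10.
- exact: ltW.
- by rewrite theta0.
- exact: (pf_tail0 PJn).
- move=> x; rewrite ge_max => /andP[x1x _].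
  by rewrite ltW// T_gt0// (lt_le_trans x10).
- move=> x; rewrite ge_max => /andP[x1x _].
  by rewrite -ler_pdivrMr ?T_gt0// ?(lt_le_trans x10)// hx1.
move=> x; rewrite ge_max => /andP[_ x2x].
have x0 : 0 < x by exact: lt_le_trans x2x.
have s0 : 0 < x^-1 by rewrite invr_gt0.
rewrite -lerBlDl; apply: (@le_trans _ _ (expR 2 * (x^-1 ^+ n * lap Jn n x^-1))); last first.
  by rewrite -mulrA ler_wpM2l ?expR_ge0// -[X in T X](invrK x); exact: hx2.
have a1 := admissible_gt x; have a2 := admissible_gt (2 * x).
have a3 := admissible_pow_exp n s0.
rewrite mulrA /lap -(pfZ PJn)// /ftail -(pfB PJn)//; apply: (pf_le PJn).
- exact: admissibleB.
- exact: admissibleZ.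
move=> y y0; rewrite [leRHS](_ : _ = (x^-1 * y) ^+ n * (expR 2 * expR (- (x^-1 * y)))); last first.
  by rewrite exprMn; ring.
have r0 : 0 <= (x^-1 * y) ^+ n * (expR 2 * expR (- (x^-1 * y))).
  by rewrite mulr_ge0 ?mulr_ge0 ?expR_ge0// exprn_ge0// mulr_ge0// ltW.
have [xy|xy] := ltP x y; last first.
  rewrite ltNge (le_trans xy) ?subrr//= ler_peMl ?(ltW x0)//; exact: ler1n.
have [x2y|y2x] := ltP (2 * x) y; first by rewrite subrr.
rewrite subr0 -[leLHS]mulr1 ler_pM//.
  by rewrite exprn_ege1// mulrC ler_pdivlMr// mul1r ltW.
rewrite -expRD; apply: le_trans (expR_ge1Dx _); rewrite lerDl subr_ge0.
by rewrite mulrC ler_pdivrMr.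
Qed.

(** [tail_comparison] is used twice: for the upper bound as it is, for the lower bound with the two
    functionals exchanged and c inverted. *)
Lemma tail_of_top_deriv : ftail Jn x / T x @[x --> pinfty_nbhs R] --> c.
Proof.
have [C1 C10 HC1] := tailn_le.
have powN (x : R) : 0 < x -> (x^-1) `^ (- a) = x `^ a.
  by move=> x0; rewrite -powR_inv1 ?ltW// -powRrM mulN1r opprK.
have pow_cvg (u : R -> R) : u d @[d --> 0^'+] --> (1 : R) ->
    u d `^ (- a) @[d --> 0^'+] --> (1 : R).
  move=> u1; have E : 1 `^ (- a) = 1 :> R by rewrite powR1.
  by rewrite -[X in _ --> X]E; apply: cvg_powR.
have id0 : d @[d --> 0^'+] --> (0 : R) by exact: cvg_at_right_filter.
have p1 : 1 + d @[d --> 0^'+] --> (1 : R).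
  by rewrite -[X in _ --> X]addr0; apply: cvgD => //; exact: cvg_cst.
have m1 : 1 - d @[d --> 0^'+] --> (1 : R).
  by rewrite -[X in _ --> X]subr0; apply: cvgB => //; exact: cvg_cst.
have da : d `^ a @[d --> 0^'+] --> (0 : R) by exact: powR_cvg0.
pose K1 := c * expR 1 * C + 1; pose K2 := c^-1 * expR 1 * ((c + 1) * C) + 1.
(* [U d] and [V d] are the limits, for x tending to infinity and d fixed, of the two bounds on
   [ftail Jn x / T x]. Letting d tend to 0 comes last. *)
pose U d := ((c * (1 - d) `^ (- a) + K1 * d) / (1 - d) ^+ 2 + C1 * d `^ a) /
            (1 + d) `^ (- a).
pose V d := c * ((1 - d) ^+ 2 * ((1 + d) `^ (- a) - d `^ a) - K2 * d) /
            (1 - d) `^ (- a).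
have UV : U d @[d --> 0^'+] --> c /\ V d @[d --> 0^'+] --> c.
  have m2 : (1 - d) ^+ 2 @[d --> 0^'+] --> (1 : R).
    rewrite -[X in _ --> X](mulr1 1); apply: eq_pos_cvg (cvgM m1 m1) => d _.
    by rewrite expr2.
  split.
    have -> : c = ((c * 1 + K1 * 0) / 1 + C1 * 0) / 1 by field.
    apply: cvgM; last by apply: cvgV; [exact: oner_neq0|exact: pow_cvg].
    apply: cvgD; last by apply: cvgM => //; exact: cvg_cst.
    apply: cvgM; last by apply: cvgV => //; exact: oner_neq0.
    apply: cvgD; apply: cvgM => //; try exact: cvg_cst.
    exact: pow_cvg.
  have -> : c = c * (1 * (1 - 0) - K2 * 0) / 1 by field.
  apply: cvgM; last by apply: cvgV; [exact: oner_neq0|exact: pow_cvg].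
  apply: cvgM; first exact: cvg_cst.
  apply: cvgB; last by apply: cvgM => //; exact: cvg_cst.
  by apply: cvgM => //; apply: cvgB => //; exact: pow_cvg.
have rat p q : 0 < p -> 0 < q ->
    T (p * x) / T (q * x) @[x --> pinfty_nbhs R] --> p `^ (- a) / q `^ (- a).
  move=> p0 q0; have := regularly_varying_ratio p0 q0 rvT.
  by rewrite powRM ?invr_ge0 ?ltW// powN// [q `^ (- a)]powRN invrK.
apply/cvgrPdist_le => e e0.
have [d [d0 d12 Ue Ve]] : exists d, [/\ 0 < d, d < 1 / 2, U d < c + e & c - e < V d].
  have [Uc Vc] := UV.
  near (0 : R)^'+ => d; exists d; split.
  - by near: d; exact: nbhs_right_gt.
  - by near: d; apply: nbhs_right_lt.
  - by near: d; apply: (cvgr_lt _ Uc); rewrite ltrDl.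
  - by near: d; apply: (cvgr_gt _ Vc); rewrite ltrBlDr ltrDl.
have dd : 0 < d < 1 / 2 by rewrite d0.
have d1 : 0 < 1 - d by lra.
have d1' : 0 < 1 + d by lra.
have di : 0 < d^-1 by rewrite invr_gt0.
have d2 : 0 < (1 - d) ^+ 2 by rewrite exprn_gt0.
have up := tail_comparison PJn PJm c0 C0 dd Phi_le
  (fun eps N M h1 h2 h3 e h4 => fdiff_small h1 h2 h3 h4) HC1.
have CC0 : 0 < (c + 1) * C by rewrite mulr_gt0// addr_gt0.
have low : \forall x \near pinfty_nbhs R,
    T ((1 + d) * x) <=
      (c^-1 * ftail Jn ((1 - d) * x) + K2 * d * T x) / (1 - d) ^+ 2
      + 1 * T (d^-1 * x).
  apply: (@tail_comparison Jm Jn T n c^-1 ((c + 1) * C) 1 d) => //.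
  - by rewrite invr_gt0.
  - move=> eps N M h1 h2 h3 e' e'0.
    have ce' : 0 < c * e' by rewrite mulr_gt0.
    apply: filterS (fdiff_small h1 h2 h3 ce') => s h.
    rewrite -(ler_pM2l c0) mulrA; apply: le_trans h.
    rewrite -[X in X * `|_|](gtr0_norm c0) -normrM mulrBr mulrA mulfV ?gt_eqF// mul1r.
    by rewrite distrC.
  - by near=> x; rewrite mul1r.
have {}up : \forall x \near pinfty_nbhs R, ftail Jn x / T x <= c + e.
  apply: (near_unscale d1').
  pose G x := (c * (T ((1 - d) * x) / T ((1 + d) * x)) +
      K1 * d * (T (1 * x) / T ((1 + d) * x))) / (1 - d) ^+ 2 +
      C1 * (T (d^-1 * x) / T ((1 + d) * x)).
  have E : G x @[x --> pinfty_nbhs R] --> U d.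
    have -> : U d = (c * ((1 - d) `^ (- a) / (1 + d) `^ (- a)) +
       K1 * d * (1 `^ (- a) / (1 + d) `^ (- a))) / (1 - d) ^+ 2 +
       C1 * (d^-1 `^ (- a) / (1 + d) `^ (- a)).
      rewrite powN// powR1 /U; field.
      by rewrite !gt_eqF// powR_gt0.
    apply: cvgD; last by apply: cvgM; [exact: cvg_cst|exact: rat].
    apply: cvgM; last exact: cvg_cst.
    by apply: cvgD; apply: cvgM; try exact: cvg_cst; exact: rat.
  have /cvgr_le/(_ _ Ue) E' := E.
  near=> x; have x0 : 0 < x by near: x; exact: nbhs_pinfty_gt (num_real _).
  have Tx : 0 < T ((1 + d) * x) by rewrite T_gt0// mulr_gt0.
  apply: (@le_trans _ _ (G x)); last by near: x; exact: E'.
  rewrite ler_pdivrMr// /G mul1r.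
  have : ftail Jn ((1 + d) * x) <= (c * ftail Jm ((1 - d) * x) + K1 * d * T x) / (1 - d) ^+ 2 +
      C1 * T (d^-1 * x) by near: x; exact: up.
  move=> /le_trans; apply; rewrite le_eqVlt; apply/orP; left; apply/eqP.
  rewrite -/T; field.
  by rewrite !gt_eqF.
have {}low : \forall x \near pinfty_nbhs R, c - e <= ftail Jn x / T x.
  apply: (near_unscale d1).
  pose G x := c * ((1 - d) ^+ 2 * (T ((1 + d) * x) / T ((1 - d) * x) -
      T (d^-1 * x) / T ((1 - d) * x)) -
      K2 * d * (T (1 * x) / T ((1 - d) * x))).
  have E : G x @[x --> pinfty_nbhs R] --> V d.
    have -> : V d = c * ((1 - d) ^+ 2 * ((1 + d) `^ (- a) / (1 - d) `^ (- a) -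
       d^-1 `^ (- a) / (1 - d) `^ (- a)) - K2 * d * (1 `^ (- a) / (1 - d) `^ (- a))).
      rewrite powN// powR1 /V; field.
      by rewrite gt_eqF// powR_gt0.
    apply: cvgM; first exact: cvg_cst.
    apply: cvgB; last by apply: cvgM; [exact: cvg_cst|exact: rat].
    apply: cvgM; first exact: cvg_cst.
    by apply: cvgB; exact: rat.
  have /cvgr_ge/(_ _ Ve) E' := E.
  near=> x; have x0 : 0 < x by near: x; exact: nbhs_pinfty_gt (num_real _).
  have Tx : 0 < T ((1 - d) * x) by rewrite T_gt0// mulr_gt0.
  apply: (@le_trans _ _ (G x)); first by near: x; exact: E'.
  rewrite ler_pdivlMr// /G mul1r.
  have : T ((1 + d) * x) <= (c^-1 * ftail Jn ((1 - d) * x) + K2 * d * T x) / (1 - d) ^+ 2 +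
      1 * T (d^-1 * x) by near: x; exact: low.
  rewrite mul1r -lerBlDr ler_pdivlMr// -lerBlDr -(ler_pM2l c0) [X in _ <= X -> _]mulrA.
  rewrite mulfV ?gt_eqF// mul1r; apply: le_trans.
  rewrite le_eqVlt; apply/orP; left; apply/eqP; field.
  by rewrite !gt_eqF.
near=> x; rewrite distrC ler_distl; apply/andP; split; first by near: x; exact: low.
by near: x; exact: up.
Unshelve. all: end_near. Qed.

End comparison.
End tauberian.

(** * Laplace transforms of regularly varying densities *)

Section integral_functional.
Context d {Tp : measurableType d} {R : realType} (m : {measure set Tp -> \bar R}).
Variables (D : set Tp) (w Y : Tp -> R).
Hypotheses (mD : measurable D) (mY : measurable_fun D Y).
Hypotheses (w0 : forall x, D x -> 0 <= w x) (Y0 : forall x, D x -> 0 <= Y x).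
Hypothesis iw : m.-integrable D (EFin \o w).

Lemma integrable_weighted (g : R -> R) : admissible g ->
  m.-integrable D (EFin \o (fun x => w x * g (Y x))).
Proof.
move=> [mg [C gC]].
have C0 : 0 <= C by exact: le_trans (normr_ge0 _) (gC 0 (lexx _)).
have mw : measurable_fun D w by apply/measurable_EFinP; exact: measurable_int iw.
apply: (@le_integrable _ _ _ m D mD _ (fun x => (C * w x)%:E)).
- by apply/measurable_EFinP; apply: measurable_funM => //; exact: measurableT_comp.
- move=> x Dx; rewrite lee_fin normrM (ger0_norm (w0 Dx)) mulrC.
  by rewrite normrM (ger0_norm (w0 Dx)) (ger0_norm C0) ler_wpM2r ?w0// gC// Y0.
- by under eq_fun do rewrite EFinM; exact: integrableZl.
Qed.

Lemma integral_functional :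
  positive_functional (fun g => \int[m]_(x in D) (w x * g (Y x))).
Proof.
split.
- move=> f g fa ga; rewrite -RintegralD//; try exact: integrable_weighted.
  by apply: eq_Rintegral => x _; rewrite mulrDr.
- move=> c f fa; rewrite -RintegralZl//; last exact: integrable_weighted.
  by apply: eq_Rintegral => x _; rewrite mulrCA.
- move=> f g fa ga fg; apply: le_Rintegral => //; try exact: integrable_weighted.
  by move=> x Dx; rewrite ler_wpM2l ?w0// fg// Y0.
(* Dominated convergence along the integers; monotonicity of the tail extends the limit to the
   reals. *)
have cvgn : \int[m]_(x in D) (w x * (n%:R < Y x)%R%:R) @[n --> \oo] --> (0 : R).
  have mf n : measurable_fun D (fun x => (w x * (n%:R < Y x)%R%:R)%:E).
    exact: measurable_int (integrable_weighted (admissible_gt n%:R)).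
  have [||||_ _] := @dominated_convergence _ _ _ m D mD
    (fun n x => (w x * (n%:R < Y x)%R%:R)%:E) (cst 0%E) (EFin \o w) mf.
  - exact: measurable_cst.
  - apply: aeW => x Dx; apply: cvg_near_cst; near=> n.
    rewrite ltNge (_ : Y x <= n%:R) ?mulr0//.
    by near: n; exact: nbhs_infty_ger.
  - exact: iw.
  - apply: aeW => x n Dx; rewrite lee_fin normrM (ger0_norm (w0 Dx)) ger0_norm//.
    by rewrite ler_piMr ?w0// lern1 leq_b1.
  rewrite integral0 => /fine_cvg.
  by [].
apply/cvgrPdist_le => e e0.
have [N _ HN] : \forall n \near \oo, `|\int[m]_(x in D) (w x * (n%:R < Y x)%R%:R)| <= e.
  by move/cvgr0_norm_le : cvgn; apply.
near=> x; rewrite sub0r normrN.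
have Nx : N%:R <= x by near: x; exact: nbhs_pinfty_ge (num_real _).
apply: le_trans (HN N (leqnn _)); rewrite !ger0_norm; last 2 first.
- by apply: Rintegral_ge0 => y Dy; rewrite mulr_ge0 ?w0.
- by apply: Rintegral_ge0 => y Dy; rewrite mulr_ge0 ?w0.
apply: le_Rintegral => //.
- exact: (integrable_weighted (admissible_gt x)).
- exact: (integrable_weighted (admissible_gt _)).
move=> y Dy; rewrite ler_wpM2l ?w0// ler_nat.
by case: (ltP x) => // xy; rewrite (le_lt_trans Nx xy).
Unshelve. all: end_near. Qed.

End integral_functional.

Section scaling.
Context {R : realType}.
Notation mu := (@lebesgue_measure R).
Local Open Scope ereal_scope.

(** k times the image of the Lebesgue measure under the dilation agrees with it on intervals, hence
    everywhere. *)
Lemma ge0_integral_scale (k : R) (f : R -> \bar R) : (0 < k)%R ->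
  measurable_fun setT f -> (forall y, 0 <= f y) ->
  \int[mu]_(y in `[0%R, +oo[) f y = k%:E * \int[mu]_(y in `[0%R, +oo[) f (k * y)%R.
Proof.
move=> k0 mf f0; pose K := NngNum (ltW k0).
pose dil : measurableTypeR R -> measurableTypeR R := *%R k.
have mdil : measurable_fun setT dil by exact: mulrl_measurable.
pose dil' := @measure_function_pushforward__canonical__measure_function_Measure
  _ _ _ _ _ mu dil mdil.
have E A : measurable A -> mu A = mscale K dil' A.
  apply: lebesgue_measure_unique => //= _ [[a b]] _ <-.
  rewrite /mscale/= /pushforward (_ : dil @^-1` _ =
      `](a / k)%R, (b / k)%R]%classic); last first.
    apply/seteqP; split => x /=; rewrite !in_itv/= /dil.
      by rewrite ltr_pdivrMr// ler_pdivlMr// mulrC.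
    by rewrite ltr_pdivrMr// ler_pdivlMr// mulrC.
  rewrite !lebesgue_measure_itv/= !lte_fin ltr_pM2r ?invr_gt0//.
  case: ifPn => _; last by rewrite mule0.
  by rewrite -!EFinB -EFinM -mulrBl mulrCA divff ?mulr1// gt_eqF.
transitivity (\int[mscale K dil']_(y in `[0%R, +oo[) f y).
  by apply: eq_measure_integral => A mA _; exact: E.
rewrite ge0_integral_mscale//=; last exact: measurable_funTS.
congr (_ * _).
rewrite ge0_integral_pushforward//=; last exact: measurable_funTS.
rewrite (_ : _ @^-1` _ = `[0%R, +oo[%classic)//.
apply/seteqP; split => x /=; rewrite !in_itv/= !andbT.
  by rewrite pmulr_rge0.
by rewrite pmulr_rge0.
Qed.

End scaling.

Section density_functionals.
Context {R : realType}.
Notation mu := (@lebesgue_measure R).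
Implicit Types (F g : R -> R) (c s x y : R) (k n : nat).

Definition density F := [/\ measurable_fun setT F, forall y, 0 <= F y &
  mu.-integrable `[0, +oo[ (EFin \o F)].

Definition dens F g := \int[mu]_(y in `[0, +oo[) (F y * g y).

Lemma positive_dens F : density F -> positive_functional (dens F).
Proof.
move=> [mF F0 iF]; apply: (@integral_functional _ _ _ mu `[0, +oo[%classic F id) => //.
by move=> x /=; rewrite in_itv/= andbT.
Qed.

Lemma integrable_dens F g : density F -> admissible g ->
  mu.-integrable `[0, +oo[ (EFin \o (fun y => F y * g y)).
Proof.
move=> [mF F0 iF] ga; apply: (@integrable_weighted _ _ _ mu `[0, +oo[%classic F id) => //.
by move=> x /=; rewrite in_itv/= andbT.
Qed.

Lemma density_scale F c : 0 < c -> density F -> density (fun y => F (c * y)).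
Proof.
move=> c0 [mF F0 iF]; split => //; first exact: measurableT_comp.
apply/integrableP; split; first by apply/measurable_EFinP/measurable_funTS/measurableT_comp.
have /integrableP[_] := iF.
have mF' : measurable_fun setT (fun y => `|(EFin \o F) y|%E).
  by apply: measurableT_comp => //; exact/measurable_EFinP.
rewrite (ge0_integral_scale c0 mF')//.
have key (I : \bar R) : (c%:E * I < +oo)%E -> (I < +oo)%E.
  by case: I => [r _||] //=; rewrite ?ltry// gt0_muley ?ltxx// lte_fin.
exact: key.
Qed.

Lemma dens_scale F g c : 0 < c -> density F -> admissible g ->
  (forall y, 0 <= y -> 0 <= g y) ->
  dens F g = c * dens (fun y => F (c * y)) (fun y => g (c * y)).
Proof.
move=> c0 [mF F0 iF] [mg _] g0.
have mh : measurable_fun setT (fun y => (F y * `|g y|)%:E).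
  by apply/measurable_EFinP/measurable_funM => //; exact: measurableT_comp.
(* [ge0_integral_scale] asks for nonnegativity on the whole line, while g is nonnegative on the
   half-line only: |g| replaces it. *)
have gE y : `[0, +oo[%classic y -> g y = `|g y|.
  by rewrite /= in_itv/= andbT => /g0 /ger0_norm.
rewrite /dens /Rintegral.
have E1 : (\int[mu]_(x in `[0%R, +oo[) (F x * g x)%:E =
    \int[mu]_(x in `[0%R, +oo[) (F x * `|g x|)%:E)%E.
  by apply: eq_integral => y /set_mem /gE <-.
have E2 : (\int[mu]_(x in `[0%R, +oo[) (F (c * x) * g (c * x))%:E =
    \int[mu]_(x in `[0%R, +oo[) (F (c * x) * `|g (c * x)|)%:E)%E.
  apply: eq_integral => y /set_mem; rewrite /= in_itv/= andbT => y0.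
  by rewrite ger0_norm// g0// mulr_ge0// ltW.
rewrite E1 E2 (ge0_integral_scale c0 mh); last by move=> y; rewrite lee_fin mulr_ge0.
have key (I : \bar R) : (0 <= I)%E -> fine (c%:E * I) = c * fine I.
  by case: I => [r|_|//] //=; rewrite gt0_muley ?mulr0.
by apply: key; apply: integral_ge0 => y _; rewrite lee_fin mulr_ge0.
Qed.

Lemma dens_cmp F1 F2 g c x0 : density F1 -> density F2 -> admissible g ->
  (forall y, x0 < y -> F1 y <= c * F2 y) ->
  (forall y, 0 <= y -> 0 <= g y) -> (forall y, y <= x0 -> g y = 0) ->
  dens F1 g <= c * dens F2 g.
Proof.
move=> d1 d2 ga F12 g0 gx0; rewrite /dens -RintegralZl//; last exact: integrable_dens.
apply: le_Rintegral => //; first exact: integrable_dens.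
  exact: (integrableZl _ _ (integrable_dens d2 ga)).
move=> y; rewrite /= in_itv/= andbT => y0.
have [yx|xy] := leP y x0; first by rewrite gx0// !mulr0.
by rewrite mulrA ler_wpM2r ?g0// F12.
Qed.

Lemma dens_ftail_cmp F1 F2 c x0 x : density F1 -> density F2 ->
  (forall y, x0 < y -> F1 y <= c * F2 y) -> x0 <= x ->
  ftail (dens F1) x <= c * ftail (dens F2) x.
Proof.
move=> d1 d2 F12 x0x; apply: dens_cmp F12 _ _ => //; first exact: admissible_gt.
by move=> y yx0; rewrite ltNge (le_trans yx0 x0x).
Qed.

(** The integrand is at most x0^k below x0. This constant term becomes negligible when the
    transforms diverge. *)
Lemma dens_lap_cmp F1 F2 c x0 k s : density F1 -> density F2 -> 0 <= c -> 0 <= x0 -> 0 < s ->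
  (forall y, x0 < y -> F1 y <= c * F2 y) ->
  lap (dens F1) k s <= x0 ^+ k * dens F1 (fun=> 1) + c * lap (dens F2) k s.
Proof.
move=> d1 d2 c0 x00 s0 F12.
have P1 := positive_dens d1; have P2 := positive_dens d2.
have ae := admissible_pow_exp k s0.
have a1 := admissible_cst (1 : R).
have ag := admissible_gt x0.
have aeg := admissibleM ag ae.
apply: (@le_trans _ _ (dens F1 (fun y => x0 ^+ k * 1 +
    (x0 < y)%R%:R * (y ^+ k * expR (- (s * y)))))).
  apply: (pf_le P1) => //; first by apply: admissibleD => //; exact: admissibleZ.
  move=> y y0; have [xy|yx] := ltP x0 y.
    by rewrite mul1r lerDr mulr1 exprn_ge0.
  rewrite mul0r addr0; apply: ler_pM; rewrite ?exprn_ge0 ?expR_ge0//.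
    by rewrite lerXn2r ?nnegrE.
  by rewrite -expR0 ler_expR oppr_le0 mulr_ge0// ltW.
rewrite (pfD P1)//; last exact: admissibleZ.
rewrite (pfZ P1)// lerD2l.
apply: le_trans (_ : c * dens F2 (fun y => (x0 < y)%R%:R * (y ^+ k * expR (- (s * y)))) <= _).
  apply: dens_cmp F12 _ _ => //.
    by move=> y y0; rewrite !mulr_ge0 ?exprn_ge0 ?expR_ge0.
  by move=> y yx; rewrite ltNge yx mul0r.
rewrite ler_wpM2l// (pf_le P2)// => y y0.
by rewrite ler_piMl ?mulr_ge0 ?exprn_ge0 ?expR_ge0// lern1 leq_b1.
Qed.

Lemma dens_lap_scale F c k s : 0 < c -> 0 < s -> density F ->
  lap (dens F) k (c * s) = c^-1 ^+ k.+1 * lap (dens (fun y => F (c^-1 * y))) k s.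
Proof.
move=> c0 s0 dF; have ci : 0 < c^-1 by rewrite invr_gt0.
have cs0 : 0 < c * s by rewrite mulr_gt0.
rewrite /lap (dens_scale ci dF (admissible_pow_exp k cs0)); last first.
  by move=> y y0; rewrite mulr_ge0 ?exprn_ge0 ?expR_ge0.
rewrite exprS -mulrA; congr (_ * _).
rewrite -(pfZ (positive_dens (density_scale ci dF)) _ (admissible_pow_exp k s0)).
congr dens; apply/funext => y; rewrite exprMn [RHS]mulrA; congr (_ * expR (- _)).
by field; rewrite gt_eqF.
Qed.

End density_functionals.

Section density_more.
Context {R : realType}.
Notation mu := (@lebesgue_measure R).
Implicit Types (F g : R -> R) (c s x y p r : R) (k n : nat).

Lemma dens_le F1 F2 g1 g2 : density F1 -> density F2 -> admissible g1 -> admissible g2 ->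
  (forall y, 0 <= y -> F1 y * g1 y <= F2 y * g2 y) -> dens F1 g1 <= dens F2 g2.
Proof.
move=> d1 d2 a1 a2 h; apply: le_Rintegral => //; try exact: integrable_dens.
by move=> y; rewrite /= in_itv/= andbT; exact: h.
Qed.

Lemma Rintegral_ind p r : 0 <= p <= r ->
  \int[mu]_(y in `[0, +oo[) ((p < y)%R%:R - (r < y)%R%:R) = r - p.
Proof.
move=> /andP[p0 pr]; rewrite /Rintegral.
rewrite (_ : (\int[mu]_(y in `[0%R, +oo[) ((p < y)%R%:R - (r < y)%R%:R)%:E)%E =
   \int[mu]_(y in `[0%R, +oo[) (\1_(`]p, r]%classic) y)%:E)%E; last first.
  apply: eq_integral => y _; congr EFin; rewrite indicE mem_setE in_itv/=.
  have [py|yp] := ltP p y; rewrite ?ltNge ?(le_trans yp pr) ?subrr//=.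
  by case: (y <= r); rewrite ?subr0 ?subrr.
rewrite integral_indic//= setIC (_ : _ `&` _ = `]p, r]%classic); last first.
  apply/seteqP; split => y; rewrite /= !in_itv/= ?andbT; first by case.
  by move=> /andP[py yr]; rewrite py yr (le_trans p0 (ltW py)).
rewrite lebesgue_measure_itv/= lte_fin; case: ifPn => [//|].
by rewrite -leNgt => rp; rewrite (le_anti (introT andP (conj pr rp))) subrr.
Qed.

Lemma real_deriveX f s (a : R) k : is_derive s 1 f a ->
  is_derive s 1 (fun x => f x ^+ k.+1) (k.+1%:R * f s ^+ k * a).
Proof.
move=> fa; elim: k => [|k IH]; first by rewrite expr0 mulr1 mul1r.
apply: (is_derive_eq (real_deriveM fa IH)).
rewrite -[in RHS]natr1 exprS; ring.
Qed.

Lemma density_exp1 : density (fun y => expR (- y)).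
Proof.
split; first by apply: measurableT_comp => //.
  by move=> y; exact: expR_ge0.
have i1 : mu.-integrable `[0, +oo[ (EFin \o @exponential_pdf R 1).
  by apply: integrableS (integrable_exponential_pdf ltr01).
move: i1; apply: eq_integrable => // y /set_mem; rewrite /= in_itv/= andbT => y0.
by rewrite exponential_pdfE// mul1r mulN1r.
Qed.

(** Order 0 is the total mass of the exponential law of parameter 1 + s; the rest follows by
    differentiation. *)
Lemma lap_exp1 k s : 0 < s ->
  lap (dens (fun y => expR (- y))) k s = k`!%:R / (1 + s) ^+ k.+1.
Proof.
move=> s0; have P1 := positive_dens density_exp1.
elim: k s s0 => [|k IH] s s0.
  have s1 : 0 < 1 + s by rewrite addr_gt0.
  rewrite fact0 expr1; apply: (mulfI (lt0r_neq0 s1)).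
  rewrite mulrCA mulfV ?gt_eqF// mulr1 /lap -(pfZ P1); last exact: admissible_pow_exp.
  transitivity (\int[mu]_y exponential_pdf (1 + s) y).
    rewrite /exponential_pdf -Rintegral_mkcond; apply: eq_Rintegral => y _.
    rewrite expr0 mul1r mulrCA -expRD; congr (_ * expR _); ring.
  by rewrite /Rintegral integral_exponential_pdf// ltW.
have H := is_derive_lap P1 k s0.
have s1 : 0 < 1 + s by rewrite addr_gt0.
have H2 : is_derive s 1 (fun s => k`!%:R * (((1 + s) ^+ k.+1)^-1)) (- (k.+1)`!%:R / (1 + s) ^+ k.+2).
  have d1 : is_derive s 1 (fun x => 1 + x) (0 + 1) := real_deriveD (is_derive_cst (1 : R) s 1) (is_derive_id s (1 : R)).
  have s1k : (1 + s) ^+ k.+1 != 0 by rewrite expf_neq0// gt_eqF.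
  apply: (is_derive_eq (real_deriveZ _ (@real_deriveV _ (fun x => (1 + x) ^+ k.+1) _ _ s1k (real_deriveX k d1)))).
  rewrite factS natrM !exprS; field.
  by rewrite expf_neq0 gt_eqF.
have H3 : is_derive s 1 (lap (dens (fun y => expR (- y))) k)
    (- (k.+1)`!%:R / (1 + s) ^+ k.+2).
  by apply: eq_pos_is_derive H2 => // x x0; rewrite IH.
 apply/eqP; rewrite -eqr_opp -mulNr; apply/eqP.
by rewrite -(@derive_val _ _ _ _ _ _ _ H) (@derive_val _ _ _ _ _ _ _ H3).
Qed.

End density_more.

Section ftail_dens.
Context {R : realType}.
Notation mu := (@lebesgue_measure R).
Variable F : R -> R.
Hypotheses (dF : density F) (Fdec : forall x y : R, x <= y -> F y <= F x).
Implicit Types (p r x : R).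

Lemma ftail_dens_diff p r : 0 <= p <= r ->
  F r * (r - p) <= ftail (dens F) p - ftail (dens F) r <= F p * (r - p).
Proof.
move=> pr; have /andP[p0 pr'] := pr.
have ap := admissible_gt p; have ar := admissible_gt r.
have ai := admissibleB ap ar.
have ind0 y : 0 <= (p < y)%R%:R - (r < y)%R%:R :> R.
  by rewrite subr_ge0 ler_nat; case: (ltP r y) => // ry; rewrite (le_lt_trans pr' ry).
have indp y : (p < y)%R%:R - (r < y)%R%:R != 0 :> R -> p < y <= r.
  have [py|yp] := ltP p y; have [ry|yr] := ltP r y; rewrite /= ?subrr ?eqxx//.
  by move: (lt_le_trans ry yp); rewrite ltNge pr'.
(* Domination of the indicator of ]p, r] by e^r e^(-y). *)
have ind_int : mu.-integrable `[0, +oo[ (EFin \o (fun y => (p < y)%R%:R - (r < y)%R%:R)).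
  apply: le_integrable (integrable_dens density_exp1 (admissible_cst (expR r))) => //.
    by apply/measurable_EFinP/measurable_funTS; case: ai.
  move=> y _; rewrite lee_fin ger0_norm// ger0_norm ?mulr_ge0 ?expR_ge0//.
  have [->|/indp/andP[py yr]] := eqVneq ((p < y)%R%:R - (r < y)%R%:R : R) 0.
    by rewrite mulr_ge0 ?expR_ge0.
  rewrite py ltNge yr subr0 /= -expRD; apply: le_trans (expR_ge1Dx _).
  by rewrite lerDl addrC subr_ge0.
have iZ c : mu.-integrable `[0, +oo[ (EFin \o (fun y => c * ((p < y)%R%:R - (r < y)%R%:R))).
  exact: (integrableZl _ _ ind_int).
rewrite /ftail -(pfB (positive_dens dF))// -(Rintegral_ind pr).
rewrite -!RintegralZl//; apply/andP; split; apply: le_Rintegral => //.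
- exact: integrable_dens.
- move=> y _; have [->|/indp/andP[py yr]] := eqVneq ((p < y)%R%:R - (r < y)%R%:R : R) 0.
    by rewrite !mulr0.
  by rewrite ler_wpM2r// Fdec.
- exact: integrable_dens.
- move=> y _; have [->|/indp/andP[py yr]] := eqVneq ((p < y)%R%:R - (r < y)%R%:R : R) 0.
    by rewrite !mulr0.
  by rewrite ler_wpM2r// Fdec// ltW.
Qed.

End ftail_dens.

Section dyadic.
Context {R : realType}.

Lemma dyadic_ind (P : R -> Prop) (x0 : R) : 0 < x0 ->
  (forall x, x0 <= x <= 2 * x0 -> P x) -> (forall x, x0 <= x -> P x -> P (2 * x)) ->
  forall x, x0 <= x -> P x.
Proof.
move=> x00 P0 P2.
have Pn n x : x0 <= x -> x <= 2 ^+ n * x0 -> P x.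
  elim: n x => [|n IH] x x0x xn.
    by apply: P0; rewrite x0x (le_trans xn)// expr0 mul1r ler_peMl ?ler1n// ltW.
  have [x2|x2] := leP x (2 * x0); first by apply: P0; rewrite x0x.
  have -> : x = 2 * (x / 2) by field.
  apply: P2; first by rewrite ler_pdivlMr// mulrC ltW.
  apply: IH; first by rewrite ler_pdivlMr// mulrC ltW.
  by rewrite ler_pdivrMr// mulrC mulrA -exprS.
move=> x x0x; apply: (Pn (Num.truncn (x / x0)).+1) => //.
rewrite -ler_pdivrMr// (le_trans (ltW (truncnS_gt _)))//.
by rewrite -natrX ler_nat ltnW// ltn_expl.
Qed.

Lemma le_powRl (e x y : R) : 0 <= e -> 0 <= x -> x <= y -> x `^ e <= y `^ e.
Proof.
by move=> e0 x0 xy; apply: ge0_ler_powR; rewrite ?nnegrE// (le_trans x0).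
Qed.

(** [u t] is eventually between q (1 - h) t and q (1 + h) t, and [Phi] is monotone. *)
Lemma cvg_ratio_of_scale (Phi u : R -> R) (b q : R) : (forall s, 0 < s -> 0 < Phi s) ->
  (forall s t, 0 < s -> s <= t -> Phi t <= Phi s) ->
  (forall q, 0 < q -> Phi (q * s) / Phi s @[s --> 0^'+] --> q `^ b) ->
  0 < q -> asymp_linear u q -> Phi (u t) / Phi t @[t --> 0^'+] --> q `^ b.
Proof.
move=> Phi_gt0 Phi_le Phi_scale q0 [u0 uq]; apply/cvgrPdist_le => e e0.
have hb : (q * (1 + h)) `^ b @[h --> 0^'+] --> q `^ b.
  apply: cvg_powR => //; rewrite -[X in _ --> X]mulr1.
  apply: cvgM; first exact: cvg_cst.
  rewrite -[X in _ --> X]addr0; apply: cvgD; first exact: cvg_cst.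
  exact: cvg_at_right_filter.
have hb' : (q * (1 - h)) `^ b @[h --> 0^'+] --> q `^ b.
  apply: cvg_powR => //; rewrite -[X in _ --> X]mulr1.
  apply: cvgM; first exact: cvg_cst.
  rewrite -[X in _ --> X]subr0; apply: cvgB; first exact: cvg_cst.
  exact: cvg_at_right_filter.
have e2 : 0 < e / 2 by rewrite divr_gt0.
have [h [h0 h1 hl hr]] : exists h, [/\ 0 < h, h < 1,
    q `^ b - e / 2 <= (q * (1 + h)) `^ b & (q * (1 - h)) `^ b <= q `^ b + e / 2].
  near (0 : R)^'+ => h; exists h; split.
  - by near: h; exact: nbhs_right_gt.
  - by near: h; exact: nbhs_right_lt.
  - by near: h; apply: (cvgr_ge _ hb); rewrite ltrBlDr ltrDl.
  - by near: h; apply: (cvgr_le _ hb'); rewrite ltrDl.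
have qp : 0 < q * (1 + h) by rewrite mulr_gt0// addr_gt0.
have qm : 0 < q * (1 - h) by rewrite mulr_gt0// subr_gt0.
have /cvgrPdist_le/(_ _ e2) Hp := Phi_scale _ qp.
have /cvgrPdist_le/(_ _ e2) Hm := Phi_scale _ qm.
have up : \forall t \near 0^'+, u t / t <= q * (1 + h).
  by move/cvgr_le : uq; apply; rewrite ltr_pMr// ltrDl.
have um : \forall t \near 0^'+, q * (1 - h) <= u t / t.
  by move/cvgr_ge : uq; apply; rewrite gtr_pMr// gtrDl oppr_lt0.
have t00 : \forall t \near (0 : R)^'+, 0 < t by exact: nbhs_right_gt.
apply: filterS (filterI (filterI Hp Hm) (filterI (filterI up um) t00)).
move=> t [[Hpt Hmt] [[upt umt] t0]].
have P0 := Phi_gt0 t t0.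
have ut := u0 t t0.
rewrite ler_pdivrMr// in upt; rewrite ler_pdivlMr// in umt.
have Pp : Phi (q * (1 + h) * t) / Phi t <= Phi (u t) / Phi t.
  by rewrite ler_pM2r ?invr_gt0//; exact: Phi_le.
have Pm : Phi (u t) / Phi t <= Phi (q * (1 - h) * t) / Phi t.
  by rewrite ler_pM2r ?invr_gt0//; apply: Phi_le => //; rewrite mulr_gt0.
move: Hpt Hmt; rewrite !ler_norml => /andP[_ Hp1] /andP[Hm1 _].
apply/andP; split; lra.
Unshelve. all: end_near. Qed.


(** A suitable additive constant makes the inequality homogeneous, so that s^(e/2) g(s) stays
    bounded along dyadic scales; the other half of the exponent gives the limit 0. *)
Lemma subpoly_of_doubling (g : R -> R) :
  (forall s, 0 < s -> 0 <= g s) ->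
  (forall s t, 0 < s -> s <= t -> g t <= g s) ->
  (forall e, 0 < e -> exists2 C, 0 <= C & forall s, 0 < s ->
     g (s / 2) <= 2 `^ e * g s + C) -> subpoly g.
Proof.
move=> g0 gdec gd e e0; have e2 : 0 < e / 2 by rewrite divr_gt0.
have [C C0 hC] : exists2 C, 0 <= C & forall s, 0 < s ->
    g (s / 2) + C <= 2 `^ (e / 2) * (g s + C).
  have e4 : 0 < e / 4 by rewrite divr_gt0.
  have [C C0 hC] := gd _ e4.
  have p0 : 1 < 2 `^ (e / 4) :> R.
    have := @gt0_ltr_powR _ (e / 4) e4 1 2; rewrite !nnegrE powR1.
    by apply=> //; rewrite ltr1n.
  have p2 : 2 `^ (e / 2) = 2 `^ (e / 4) * 2 `^ (e / 4) :> R.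
    rewrite -powRD; last by rewrite pnatr_eq0 implybT.
    by congr (_ `^ _); field.
  set p : R := 2 `^ (e / 4) in p0 p2 hC.
  have pp : 0 < p * p - 1 by nra.
  (* The solution k of C + k = p^2 k, with p^2 = 2^(e/2). *)
  exists (C / (p * p - 1)); first by rewrite divr_ge0// ltW.
  move=> s s0; have := hC s s0; have gs := g0 s s0.
  have -> : 2 `^ (e / 2) * (g s + C / (p * p - 1)) =
      p * p * g s + C + C / (p * p - 1) by rewrite p2; field; rewrite gt_eqF.
  have : p * g s <= p * p * g s by rewrite ler_wpM2r// ler_peMl ?ltW// (lt_trans _ p0).
  move=> h1 h2; rewrite lerD2r (le_trans h2)// lerD2r//.
pose B := (1 : R) `^ (- (e / 2)) * (g (1 / 2) + C).
have H x : 1 <= x -> x `^ (- (e / 2)) * (g x^-1 + C) <= B.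
  apply: (@dyadic_ind (fun x => x `^ (- (e / 2)) * (g x^-1 + C) <= B) 1) => //.
    move=> y /andP[y1 y2]; rewrite mulr1 in y2; have y0 : 0 < y by exact: lt_le_trans y1.
    rewrite /B powR1; apply: ler_pM; rewrite ?powR_ge0 ?addr_ge0 ?g0 ?invr_gt0//.
      rewrite powRN invf_le1 ?powR_gt0//.
      by have := le_powRl (ltW e2) ler01 y1; rewrite powR1.
    rewrite lerD2r; apply: gdec; first by rewrite divr_gt0.
    by rewrite div1r lef_pV2 ?posrE.
  move=> y y1; apply: le_trans; have y0 : 0 < y by exact: lt_le_trans y1.
  have yi : 0 < y^-1 by rewrite invr_gt0.
  have := hC _ yi; rewrite (_ : y^-1 / 2 = (2 * y)^-1); last by field; rewrite gt_eqF.
  move=> h; apply: le_trans (ler_wpM2l (powR_ge0 _ _) h) _.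
  rewrite powRM ?(ltW y0)//; have E : 2 `^ (- (e / 2)) * 2 `^ (e / 2) = 1 :> R.
    by rewrite powRN mulVf// gt_eqF// powR_gt0.
  rewrite [leLHS](_ : _ = 2 `^ (- (e / 2)) * 2 `^ (e / 2) *
    (y `^ (- (e / 2)) * (g y^-1 + C))); last by ring.
  by rewrite E mul1r.
apply: (@squeeze_cvgr _ _ _ _ (fun=> 0) (fun s => s `^ (e / 2) * B)); last 2 first.
- exact: cvg_cst.
- rewrite -[X in _ --> X](mul0r B).
  by apply: cvgM; [exact: powR_cvg0|exact: cvg_cst].
near=> s; have s0 : 0 < s by near: s; exact: nbhs_right_gt.
have s1 : s <= 1 by near: s; exact: nbhs_right_le.
rewrite mulr_ge0 ?powR_ge0 ?g0//=.
have si : 1 <= s^-1 by rewrite invf_ge1.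
have := H _ si; rewrite invrK -[s^-1]powR_inv1 ?(ltW s0)// -powRrM mulN1r opprK => h.
rewrite [e in s `^ e]splitr powRD ?(gt_eqF s0) ?implybT// -mulrA ler_wpM2l ?powR_ge0//.
by apply: le_trans h; rewrite ler_wpM2l ?powR_ge0// lerDl.
Unshelve. all: end_near. Qed.

End dyadic.

(** * Transforms and tail integrals of regularly varying functions *)

Section regularly_varying_density.
Context {R : realType}.
Variables (F : R -> R) (a : R) (n : nat).
Hypotheses (dF : density F) (Fdec : forall x y : R, x <= y -> F y <= F x).
Hypotheses (rvF : regularly_varying (- a) F) (a1 : 1 < a) (na : n%:R <= a < n.+1%:R).
Let J := dens F.
Let PJ : positive_functional J := positive_dens dF.
Let F0 x : 0 <= F x. Proof. by case: dF. Qed.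
Let Fgt0 x : 0 < x -> 0 < F x. Proof. by case: rvF => + _; exact. Qed.

Let a0 : 0 < a. Proof. exact: lt_trans a1. Qed.

Let powV (q : R) : 0 < q -> q^-1 `^ (- a) = q `^ a.
Proof. by move=> q0; rewrite -powR_inv1 ?ltW// -powRrM mulN1r opprK. Qed.

Lemma rv_cmp q d : 0 < q -> 0 < d ->
  exists2 x0, 0 < x0 & forall y, x0 < y ->
    (q `^ (- a) - d) * F y <= F (q * y) <= (q `^ (- a) + d) * F y.
Proof.
move=> q0 d0; have [_ /(_ q q0)/cvgrPdist_le/(_ d d0)/nearyP[x0 x00 h]] := rvF.
exists x0 => // y xy; have y0 : 0 < y by exact: lt_trans xy.
have := h y (ltW xy); rewrite distrC ler_distl.
by rewrite ler_pdivlMr ?Fgt0// ler_pdivrMr ?Fgt0.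
Qed.

(** The substitution moves q into F, and F(y / q) <= (q^a + d) F(y) for large y. The constant
    accounts for the remaining y, uniformly in k. *)
Lemma lap_scale_le q d : 0 < q -> 0 < d ->
  exists2 C, 0 <= C & forall s, 0 < s -> forall k, (k <= n)%N ->
    lap J k (q * s) <= q^-1 ^+ k.+1 * (C + (q `^ a + d) * lap J k s).
Proof.
move=> q0 d0; have qi : 0 < q^-1 by rewrite invr_gt0.
have [x0 x00 h] := rv_cmp qi d0; rewrite powV// in h.
have dFq := density_scale qi dF.
have C1 : 0 <= dens (fun y => F (q^-1 * y)) (fun=> 1).
  by apply: (pf_ge0 (positive_dens dFq)) => //; exact: admissible_cst.
exists ((1 + x0) ^+ n * dens (fun y => F (q^-1 * y)) (fun=> 1)).
  by rewrite mulr_ge0// exprn_ge0// addr_ge0 ?ltW.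
move=> s s0 k kn; rewrite /J dens_lap_scale// ler_wpM2l ?exprn_ge0 ?(ltW qi)//.
apply: (le_trans (dens_lap_cmp (c := q `^ a + d) (x0 := x0) k dFq dF _ _ s0 _)).
- by rewrite addr_ge0 ?powR_ge0 ?ltW.
- exact: ltW.
- by move=> y /h /andP[].
rewrite lerD2r ler_wpM2r//; apply: (@le_trans _ _ ((1 + x0) ^+ k)).
  by rewrite lerXn2r ?nnegrE ?addr_ge0 ?(ltW x00)// lerDr.
by rewrite ler_weXn2l// lerDl ltW.
Qed.

Lemma lap_scale_ge q d : 0 < q -> 0 < d < q `^ a ->
  exists2 C, 0 <= C & forall s, 0 < s ->
    q^-1 ^+ n.+1 * ((q `^ a - d) * lap J n s - C) <= lap J n (q * s).
Proof.
move=> q0 /andP[d0 dq]; have qi : 0 < q^-1 by rewrite invr_gt0.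
have [x0 x00 h] := rv_cmp qi d0; rewrite powV// in h.
have dFq := density_scale qi dF.
have qd : 0 < q `^ a - d by rewrite subr_gt0.
exists ((q `^ a - d) * (x0 ^+ n * dens F (fun=> 1))).
  rewrite !mulr_ge0 ?exprn_ge0 ?(ltW qd) ?(ltW x00)//.
  by apply: (pf_ge0 PJ) => //; exact: admissible_cst.
move=> s s0; rewrite /J dens_lap_scale// ler_wpM2l ?exprn_ge0 ?(ltW qi)//.
rewrite -mulrBr -ler_pdivlMl// lerBlDl.
apply: (dens_lap_cmp _ dF dFq) => //.
- by rewrite invr_ge0 ltW.
- exact: ltW.
- by move=> y /h /andP[h1 _]; rewrite ler_pdivlMl.
Qed.

Let Phi := lap J n.

Lemma lap_gt0 k s : 0 < s -> 0 < lap J k s.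
Proof.
move=> s0; have x0 : 0 < s^-1 by rewrite invr_gt0.
have p : 0 <= s^-1 <= 2 * s^-1 by rewrite (ltW x0) ler_peMl ?ler1n// ltW.
have /andP[h _] := ftail_dens_diff dF Fdec p.
have h2 : 0 < F (2 * s^-1) * (2 * s^-1 - s^-1).
  by rewrite mulr_gt0 ?Fgt0 ?mulr_gt0//; lra.
have c0 : 0 < s^-1 ^+ k * expR (- 2) by rewrite mulr_gt0 ?exprn_gt0 ?expR_gt0.
apply: lt_le_trans (_ : s^-1 ^+ k * expR (- 2) *
  (ftail J s^-1 - ftail J (2 * s^-1)) <= _).
  by rewrite mulr_gt0// (lt_le_trans h2).
have ag1 := admissible_gt s^-1; have ag2 := admissible_gt (2 * s^-1).
rewrite /ftail -(pfB PJ)// -(pfZ PJ); last exact: admissibleB.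
apply: (pf_le PJ); [by apply: admissibleZ; exact: admissibleB|exact: admissible_pow_exp|].
move=> y y0; have [sy|ys] := ltP s^-1 y; last first.
  rewrite ltNge (le_trans ys)/=; last by case/andP: p.
  by rewrite subrr mulr0 mulr_ge0 ?exprn_ge0 ?expR_ge0.
have [sy2|ys2] := ltP (2 * s^-1) y.
  by rewrite subrr mulr0 mulr_ge0 ?exprn_ge0 ?expR_ge0.
rewrite subr0 mulr1 ler_pM ?exprn_ge0 ?expR_ge0 ?(ltW x0)//.
  by rewrite lerXn2r ?nnegrE ?(ltW x0)// ltW.
by rewrite ler_expR lerN2 mulrC -ler_pdivlMr.
Qed.

(** The integral restricted to ]x / 2, x], where F is at least F(x). *)
Lemma Phi_ge : exists2 c, 0 < c & forall x, 0 < x -> c * (x ^+ n.+1 * F x) <= Phi x^-1.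
Proof.
exists (2^-1 ^+ n.+1 * expR (- 1)); first by rewrite mulr_gt0 ?exprn_gt0 ?expR_gt0 ?invr_gt0.
move=> x x0; have s0 : 0 < x^-1 by rewrite invr_gt0.
have x2 : 0 < x / 2 by rewrite divr_gt0.
have p : 0 <= x / 2 <= x by rewrite (ltW x2)/=; lra.
have /andP[h _] := ftail_dens_diff dF Fdec p.
apply: le_trans (_ : (x / 2) ^+ n * expR (- 1) * (ftail J (x / 2) - ftail J x) <= _).
  rewrite [leLHS](_ : _ = (x / 2) ^+ n * expR (- 1) * (F x * (x - x / 2))); last first.
    by rewrite !exprS !exprMn; field.
  by rewrite ler_wpM2l// mulr_ge0 ?exprn_ge0 ?expR_ge0 ?(ltW x2).
have ag1 := admissible_gt (x / 2); have ag2 := admissible_gt x.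
rewrite /ftail -(pfB PJ)// -(pfZ PJ); last exact: admissibleB.
apply: (pf_le PJ); [by apply: admissibleZ; exact: admissibleB|exact: admissible_pow_exp|].
move=> y y0; have [sy|ys] := ltP (x / 2) y; last first.
  rewrite ltNge (le_trans ys)/=; last by case/andP: p.
  by rewrite subrr mulr0 mulr_ge0 ?exprn_ge0 ?expR_ge0.
have [sy2|ys2] := ltP x y.
  by rewrite subrr mulr0 mulr_ge0 ?exprn_ge0 ?expR_ge0.
rewrite subr0 mulr1 ler_pM ?exprn_ge0 ?expR_ge0 ?(ltW x2)//.
  by rewrite lerXn2r ?nnegrE ?(ltW x2)// ltW.
by rewrite ler_expR lerN2 mulrC ler_pdivrMr// mul1r.
Qed.


Let pow2 (k : nat) (e : R) : 2 `^ (k%:R + e) = 2 ^+ k * 2 `^ e.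
Proof.
by rewrite powRD ?pnatr_eq0 ?implybT// powR_mulrn.
Qed.

Lemma Phi_pow_ge : exists e c x0, [/\ 0 < e, 0 < c, 0 < x0 &
  forall x, x0 <= x -> c * x `^ e <= Phi x^-1].
Proof.
have /andP[_ an] := na.
pose e := (n.+1%:R - a) / 2.
have e0 : 0 < e by rewrite divr_gt0// subr_gt0.
(* With this slack F(2 y) >= 2^(e - n - 1) F(y), so y^(n + 1) F(y) gains at least 2^e at each
   doubling. Positivity amounts to a < n + 1. *)
pose d := 2 `^ (- a) - 2 `^ (e - n.+1%:R).
have d0 : 0 < d.
  rewrite subr_gt0 /powR pnatr_eq0/= ltr_expR ltr_pM2r ?ln_gt0 ?ltr1n//.
  rewrite /e; lra.
have [x0 x00 h] := @rv_cmp 2 d (ltr0n _ 2) d0.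
pose x1 := 2 * x0.
have x10 : 0 < x1 by rewrite mulr_gt0.
have x01 : x0 < x1 by rewrite /x1; lra.
have [c c0 hc] := Phi_ge.
pose B := x1 ^+ n.+1 * F (2 * x1) / (2 * x1) `^ e.
have B0 : 0 < B by rewrite divr_gt0 ?powR_gt0 ?mulr_gt0 ?exprn_gt0 ?Fgt0 ?mulr_gt0.
exists e, (c * B), x1; split => //; first exact: mulr_gt0.
move=> x x1x; apply: le_trans (hc _ (lt_le_trans x10 x1x)).
rewrite -mulrA ler_wpM2l ?(ltW c0)//.
apply: (@dyadic_ind _ (fun x => B * x `^ e <= x ^+ n.+1 * F x) x1) => //.
  move=> y /andP[x1y yx1]; have y0 : 0 < y by exact: lt_le_trans x1y.
  apply: (@le_trans _ _ (B * (2 * x1) `^ e)).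
    by rewrite ler_wpM2l ?(ltW B0)// le_powRl// ltW.
  rewrite /B divfK ?gt_eqF ?powR_gt0 ?mulr_gt0//.
  by rewrite ler_pM ?exprn_ge0 ?F0 ?(ltW x10)// ?lerXn2r ?nnegrE ?(ltW x10) ?(ltW y0)// Fdec.
move=> y x1y IH; have y0 : 0 < y by exact: lt_le_trans x1y.
have /andP[h1 _] := h y (lt_le_trans x01 x1y).
rewrite powRM ?(ltW y0)// mulrCA exprMn.
apply: le_trans (_ : 2 ^+ n.+1 * y ^+ n.+1 * (2 `^ (e - n.+1%:R) * F y) <= _).
  rewrite mulrACA -pow2 addrC subrK; apply: ler_wpM2l IH; exact: powR_ge0.
rewrite ler_wpM2l ?mulr_ge0 ?exprn_ge0 ?(ltW y0)//.
by move: h1; rewrite /d opprB addrCA subrr addr0.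
Qed.

Lemma Phi_large : exists2 e : R, 0 < e & (s `^ e * Phi s)^-1 @[s --> 0^'+] --> 0.
Proof.
have [e [c [x0 [e0 c0 x00 h]]]] := Phi_pow_ge.
have e2 : 0 < e / 2 by rewrite divr_gt0.
exists (e / 2) => //.
apply: (@squeeze_cvgr _ _ _ _ (fun=> 0) (fun s => c^-1 * s `^ (e / 2))); last 2 first.
- exact: cvg_cst.
- rewrite -[X in _ --> X](mulr0 c^-1).
  by apply: cvgM; [exact: cvg_cst|exact: powR_cvg0].
near=> s.
have s0 : 0 < s by near: s; exact: nbhs_right_gt.
have sx : x0 <= s^-1.
  rewrite -[x0]invrK lef_pV2 ?posrE ?invr_gt0//.
  by near: s; apply: nbhs_right_le; rewrite invr_gt0.
have := h _ sx; rewrite invrK => hs.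
have P0 := @lap_gt0 n s s0; rewrite -/Phi in P0.
have p0 : 0 < s `^ (e / 2) by rewrite powR_gt0.
rewrite invr_ge0 mulr_ge0 ?(ltW p0) ?(ltW P0)//=.
rewrite -[c^-1 * _]invrK lef_pV2 ?posrE ?mulr_gt0 ?invr_gt0 ?mulr_gt0 ?invr_gt0//.
rewrite invfM invrK; apply: le_trans (_ : s `^ (e / 2) * (c * s^-1 `^ e) <= _).
  rewrite -[s^-1]powR_inv1 ?(ltW s0)// -powRrM mulN1r mulrCA -powRD ?(gt_eqF s0) ?implybT//.
  have -> : e / 2 - e = - (e / 2) by field.
  by rewrite powRN.
by rewrite ler_wpM2l ?(ltW p0).
Unshelve. all: end_near. Qed.

Lemma Phi_near_ge (B : R) : 0 < B -> \forall s \near 0^'+, B <= Phi s.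
Proof.
move=> B0; have [e e0 /cvgr_le h] := Phi_large.
have B1 : 0 < B^-1 by rewrite invr_gt0.
have {}h := h _ B1; near=> s.
have s0 : 0 < s by near: s; exact: nbhs_right_gt.
have s1 : s <= 1 by near: s; exact: nbhs_right_le.
have P0 := @lap_gt0 n s s0; rewrite -/Phi in P0.
have sp : 0 < s `^ e by rewrite powR_gt0.
have : (s `^ e * Phi s)^-1 <= B^-1 by near: s.
rewrite lef_pV2 ?posrE ?mulr_gt0// => /le_trans; apply.
rewrite ler_piMl ?(ltW P0)//.
by have := le_powRl (ltW e0) (ltW s0) s1; rewrite powR1.
Unshelve. all: end_near. Qed.

(** The additive constants of the two scaling bounds disappear because [Phi] tends to infinity. *)
Let Phi_scale q : 0 < q ->
  Phi (q * s) / Phi s @[s --> 0^'+] --> q `^ (- (n.+1%:R - a)).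
Proof.
move=> q0; apply/cvgrPdist_le => e e0.
have qn : 0 < q^-1 ^+ n.+1 by rewrite exprn_gt0// invr_gt0.
have qE : q `^ (- (n.+1%:R - a)) = q^-1 ^+ n.+1 * q `^ a.
  rewrite opprB powRD ?(gt_eqF q0) ?implybT// mulrC; congr (_ * _).
  by rewrite powRN powR_mulrn ?exprVn// ltW.
pose d := Num.min (e / q^-1 ^+ n.+1 / 2) (q `^ a / 2).
have qa : 0 < q `^ a by rewrite powR_gt0.
have d0 : 0 < d by rewrite lt_min !divr_gt0.
have dq : d < q `^ a by rewrite gt_min; apply/orP; right; lra.
have de : q^-1 ^+ n.+1 * (2 * d) <= e.
  rewrite -ler_pdivlMl// mulrC [X in _ <= X]mulrC -ler_pdivlMr//.
  by rewrite ge_min lexx.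
have [C1 C10 h1] := lap_scale_le q0 d0.
have [C2 C20 h2] := lap_scale_ge q0 (introT andP (conj d0 dq)).
have B1 : 0 < (C1 + C2 + 1) / d by rewrite divr_gt0// ltr_wpDl// addr_ge0.
have PB := Phi_near_ge B1.
near=> s.
have s0 : 0 < s by near: s; exact: nbhs_right_gt.
have P0 := @lap_gt0 n s s0; rewrite -/Phi in P0.
have PC : (C1 + C2 + 1) / d <= Phi s by near: s.
rewrite ler_pdivrMr// in PC.
rewrite distrC ler_distl qE ler_pdivlMr// ler_pdivrMr//; apply/andP; split.
  apply: le_trans (h2 s s0); rewrite -/Phi.
  apply: (@le_trans _ _ (q^-1 ^+ n.+1 * (q `^ a - 2 * d) * Phi s)).
    by rewrite ler_wpM2r ?(ltW P0)// mulrBr lerD2l lerN2.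
  by rewrite -mulrA ler_wpM2l ?(ltW qn)//; nra.
apply: le_trans (h1 s s0 n (leqnn n)) _; rewrite -/Phi.
apply: (@le_trans _ _ (q^-1 ^+ n.+1 * (q `^ a + 2 * d) * Phi s)).
  by rewrite -mulrA ler_wpM2l ?(ltW qn)//; nra.
by rewrite ler_wpM2r ?(ltW P0)// mulrDr lerD2l.
Unshelve. all: end_near. Qed.

Lemma Phi_asymp (u : R -> R) q : 0 < q -> asymp_linear u q ->
  Phi (u t) / Phi t @[t --> 0^'+] --> q `^ (- (n.+1%:R - a)).
Proof.
move=> q0 uq; apply: cvg_ratio_of_scale => //; first exact: lap_gt0.
by move=> s t s0 st; exact: lap_le.
Qed.


(** Halving s multiplies the transform by at most about 2^(k + 1 - a), which is at most 1 since k +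
    1 <= n <= a. Equality, possible for integer a, is the case of slow divergence. *)
Lemma subpoly_lap k : (k < n)%N -> subpoly (lap J k).
Proof.
move=> kn; apply: subpoly_of_doubling => [s s0|s t s0 st|e e0].
- exact: lap_ge0.
- exact: lap_le.
have p1 : 1 < 2 `^ e :> R.
  have := @gt0_ltr_powR _ e e0 1 2; rewrite !nnegrE powR1.
  by apply=> //; rewrite ltr1n.
pose d := (2 `^ e - 1) / 2 ^+ k.+1.
have d0 : 0 < d by rewrite divr_gt0 ?exprn_gt0// subr_gt0.
have hi : 0 < 2^-1 :> R by rewrite invr_gt0.
have [C C0 h] := lap_scale_le hi d0.
exists (2 ^+ k.+1 * C); first by rewrite mulr_ge0// exprn_ge0.
move=> s s0; rewrite [s / 2]mulrC (le_trans (h s s0 k (ltnW kn)))//.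
rewrite invrK mulrDr addrC lerD2r mulrA ler_wpM2r ?lap_ge0//.
rewrite mulrDr /d mulrCA mulfV ?mulr1 ?expf_neq0 ?pnatr_eq0//.
rewrite -lerBrDr opprB addrCA subrr addr0.
rewrite -(invrK (2 ^+ k.+1)) ler_pdivrMl ?invr_gt0 ?exprn_gt0// mulr1.
have -> : (2 ^+ k.+1)^-1 = 2^-1 `^ k.+1%:R :> R by rewrite powR_mulrn ?exprVn ?invr_ge0.
have /andP[na' _] := na.
have ka : k.+1%:R <= a by rewrite (le_trans _ na')// ler_nat.
rewrite /powR invr_eq0 pnatr_eq0/= ler_expR ler_wnM2r//.
by rewrite ln_le0// invf_le1 ?ler1n.
Qed.

(** The factor s pays for one power of y: s y e^(-s y) <= 2 e^(-s y / 2) reduces order k to order k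
    - 1 at s / 2. *)
Lemma subpoly_M_lap k : (k <= n)%N -> (0 < k)%N -> subpoly (fun s => s * lap J k s).
Proof.
case: k => // k kn _ e e0.
have half : asymp_linear (fun t : R => t / 2) 2^-1.
  split; first by move=> t t0; rewrite divr_gt0.
  apply: cvg_near_cst; near=> t.
  by rewrite mulrC mulrA mulVf ?mul1r// gt_eqF.
have hi : 0 < 2^-1 :> R by rewrite invr_gt0.
have h := subpoly_comp hi half (subpoly_lap kn) e0.
apply: (@squeeze_cvgr _ _ _ _ (fun=> 0) (fun s => 2 * (s `^ e * lap J k (s / 2)))); last 2 first.
- exact: cvg_cst.
- by rewrite -[X in _ --> X](mulr0 2); apply: cvgM => //; exact: cvg_cst.
near=> s; have s0 : 0 < s by near: s; exact: nbhs_right_gt.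
have s2 : 0 < s / 2 by rewrite divr_gt0.
rewrite !mulr_ge0 ?powR_ge0 ?lap_ge0 ?(ltW s0)//= [leRHS]mulrCA.
apply: ler_wpM2l; first exact: powR_ge0.
have ae := admissible_pow_exp k s2.
rewrite /lap -!(pfZ PJ)//; last exact: admissible_pow_exp.
apply: (pf_le PJ); [by apply: admissibleZ; exact: admissible_pow_exp|exact: admissibleZ|].
move=> y y0.
have -> : - (s * y) = - (s / 2 * y) - (s / 2 * y) by field.
have := @pow_exp_le _ 1 _ _ s2 y0; rewrite !expr1 ler_pdivlMr// => h1.
rewrite expRD exprS; set E := expR _ in h1 *.
rewrite [leLHS](_ : _ = (y * E * (s / 2)) * (2 * (y ^+ k * E))); last by field.
by rewrite ler_piMl// !mulr_ge0 ?exprn_ge0 ?expR_ge0.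
Unshelve. all: end_near. Qed.

Lemma ftail_dens_gt0 x : 0 < x -> 0 < ftail J x.
Proof.
move=> x0; have p : 0 <= x <= x + 1 by rewrite (ltW x0) lerDl ler01.
have /andP[h _] := ftail_dens_diff dF Fdec p.
apply: (lt_le_trans (_ : 0 < F (x + 1) * (x + 1 - x))).
  by rewrite addrAC subrr add0r mulr1 Fgt0// addr_gt0.
by apply: le_trans h _; rewrite lerBlDr lerDl; exact: ftail_ge0.
Qed.

Let ftail_scale q x : 0 < q -> ftail J (q * x) = q * ftail (dens (fun y => F (q * y))) x.
Proof.
move=> q0; rewrite /ftail /J (dens_scale q0 dF (admissible_gt _)) => [|y _]; last exact: ler0n.
by congr (_ * dens _ _); apply/funext => y; rewrite ltr_pM2l.
Qed.

Lemma regularly_varying_ftail : regularly_varying (1 - a) (ftail J).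
Proof.
split; first exact: ftail_dens_gt0.
move=> q q0; rewrite powRD ?(gt_eqF q0) ?implybT// powRr1 ?(ltW q0)//.
apply/cvgrPdist_le => e e0.
have qa : 0 < q `^ (- a) by rewrite powR_gt0.
pose d := Num.min (e / q) (q `^ (- a) / 2).
have d0 : 0 < d by rewrite lt_min !divr_gt0.
have de : q * d <= e by rewrite mulrC -ler_pdivlMr// ge_min lexx.
have dq : 0 < q `^ (- a) - d by rewrite subr_gt0 gt_min; apply/orP; right; lra.
have [x0 x00 h] := rv_cmp q0 d0.
have dFq := density_scale q0 dF.
near=> x.
have x0x : x0 <= x by near: x; exact: nbhs_pinfty_ge (num_real _).
have x_gt0 : 0 < x by exact: lt_le_trans x0x.
have M0 := ftail_dens_gt0 x_gt0.
rewrite ftail_scale//; set M := ftail J x in M0 *.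
have up : ftail (dens (fun y => F (q * y))) x <= (q `^ (- a) + d) * M.
  by apply: (dens_ftail_cmp dFq dF _ x0x) => y /h /andP[].
have lo : (q `^ (- a) - d) * M <= ftail (dens (fun y => F (q * y))) x.
  rewrite -ler_pdivlMl//; apply: (dens_ftail_cmp dF dFq _ x0x) => y /h /andP[h1 _].
  by rewrite ler_pdivlMl.
rewrite distrC ler_distl ler_pdivlMr// ler_pdivrMr//; apply/andP; split.
  apply: le_trans (_ : q * ((q `^ (- a) - d) * M) <= _); last by rewrite ler_wpM2l ?(ltW q0).
  by rewrite mulrA mulrBr ler_wpM2r ?(ltW M0)// lerD2l lerN2.
apply: le_trans (ler_wpM2l (ltW q0) up) _.
by rewrite mulrA mulrDr ler_wpM2r ?(ltW M0)// lerD2l.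
Unshelve. all: end_near. Qed.

End regularly_varying_density.

(** * Karamata's theorem *)

Section karamata.
Context {R : realType}.
Variables (F : R -> R) (a : R) (n : nat).
Hypotheses (dF : density F) (Fdec : forall x y : R, x <= y -> F y <= F x).
Hypotheses (rvF : regularly_varying (- a) F) (a1 : 1 < a).
Let J := dens F.
Let PJ : positive_functional J := positive_dens dF.
Let rvM : regularly_varying (1 - a) (ftail J).
Proof. exact: regularly_varying_ftail. Qed.
Let M_gt0 x : 0 < x -> 0 < ftail J x. Proof. by case: rvM => + _; exact. Qed.
Let M_ge0 x : 0 <= ftail J x. Proof. exact: ftail_ge0. Qed.
Let M_cvg q : 0 < q -> ftail J (q * x) / ftail J x @[x --> pinfty_nbhs R] --> q `^ (1 - a).
Proof. by case: rvM => _; exact. Qed.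

(** Dyadic induction on x = 1 / s. Doubling x multiplies the transform by at most b, up to a term K
    (2 x)^n [ftail J (2 * x)], while x^n [ftail J x] grows by at least b^2. Their ratio is thus
    contracted by 1 / b up to K, and stays below any bound larger than K b / (b - 1). *)
Lemma lap_le_ftail : n%:R <= a < n.+1%:R -> exists2 C, 0 < C &
  \forall s \near 0^'+, s ^+ n * lap J n s <= C * ftail J s^-1.
Proof.
move=> /andP[_ an].
pose e := (n.+1%:R - a) / 2.
have e0 : 0 < e by rewrite divr_gt0// subr_gt0.
(* Chosen so that b = e^h satisfies b^2 = 2^e. *)
pose h := e * ln 2 / 2.
have l2 : 0 < ln 2 :> R by rewrite ln_gt0// ltr1n.
have h0 : 0 < h by rewrite divr_gt0// mulr_gt0.
pose b : R := expR h.
have b1 : 1 < b by rewrite expR_gt1.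
have b2 : 2 `^ e = b * b :> R.
  by rewrite /b -expRD /powR pnatr_eq0/=; congr expR; rewrite /h; field.
have low : \forall x \near pinfty_nbhs R, 2 `^ (e - n%:R) <= ftail J (2 * x) / ftail J x.
  have /cvgr_ge := M_cvg (ltr0n R 2); apply.
  rewrite /powR pnatr_eq0/= ltr_expR ltr_pM2r// /e -natr1; lra.
have h2 : 0 < h by [].
pose C1 := h `^ (1 - a) + 1.
have up : \forall x \near pinfty_nbhs R, ftail J (h * x) / ftail J x <= C1.
  by have /cvgr_le := M_cvg h0; apply; rewrite ltrDl.
have up2 := near_scale (ltr0n R 2) up.
have [x1 x10 hx1] := (nearyP _).1 (filterI low up2).
pose K := n%:R ^+ n * C1.
have C10 : 0 < C1 by rewrite ltr_wpDl ?powR_ge0.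
have K0 : 0 <= K by rewrite mulr_ge0 ?exprn_ge0// ltW.
pose B0 := lap J n (2 * x1)^-1 / (x1 ^+ n * ftail J (2 * x1)).
have B00 : 0 <= B0.
  apply: divr_ge0; first by apply: lap_ge0 => //; rewrite invr_gt0 mulr_gt0.
  by apply: mulr_ge0 => //; rewrite exprn_ge0// ltW.
pose B := B0 + K * b / (b - 1) + 1.
have bb : 0 < b - 1 by rewrite subr_gt0.
have b0 : 0 < b by exact: lt_trans b1.
have Kb0 : 0 <= K * b / (b - 1).
  by rewrite divr_ge0 ?(ltW bb)// mulr_ge0// ltW.
have B_gt0 : 0 < B by rewrite ltr_wpDl// addr_ge0.
suff H x : x1 <= x -> lap J n x^-1 <= B * (x ^+ n * ftail J x).
  exists B => //; apply/near0P; exists x1^-1; first by rewrite invr_gt0.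
  move=> s /andP[s0 sx].
  have xs : x1 <= s^-1 by rewrite -[x1]invrK lef_pV2 ?posrE ?invr_gt0// ltW.
  have := H _ xs; rewrite invrK => /(ler_wpM2l (exprn_ge0 n (ltW s0))) /le_trans; apply.
  by rewrite exprVn [leLHS]mulrCA mulVKf// expf_neq0// gt_eqF.
move: x; apply: dyadic_ind => // [x /andP[x1x xx1]|x x1x IH].
  have x0 : 0 < x by exact: lt_le_trans x1x.
  apply: (@le_trans _ _ (B0 * (x1 ^+ n * ftail J (2 * x1)))).
    rewrite /B0 divfK; last by rewrite gt_eqF// mulr_gt0 ?exprn_gt0 ?M_gt0 ?mulr_gt0.
    by apply: lap_le => //; rewrite ?lef_pV2 ?posrE ?invr_gt0 ?mulr_gt0.
  apply: ler_pM => //.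
  - by rewrite mulr_ge0 ?exprn_ge0 ?M_ge0 ?(ltW x10).
  - by rewrite /B -addrA lerDl addr_ge0.
  - apply: ler_pM; rewrite ?exprn_ge0 ?M_ge0 ?(ltW x10)//.
      by rewrite lerXn2r ?nnegrE ?(ltW x10) ?(ltW x0).
    exact: ftail_le.
have x0 : 0 < x by exact: lt_le_trans x1x.
have [lx ux] := hx1 x x1x.
have M2 : 0 < ftail J (2 * x) by rewrite M_gt0// mulr_gt0.
rewrite ler_pdivlMr ?M_gt0// in lx; rewrite ler_pdivrMr// in ux.
have sx : 0 < (2 * x)^-1 by rewrite invr_gt0 mulr_gt0.
have xi : 0 < x^-1 by rewrite invr_gt0.
(* For y <= 2 h x, e^(-y / (2 x)) <= e^h e^(-y / x); beyond, y^n e^(-y / (2 x)) <= (2 n x)^n. *)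
have step : lap J n (2 * x)^-1 <= b * lap J n x^-1 +
    (n%:R / (2 * x)^-1) ^+ n * ftail J (h * (2 * x)).
  have a1' := admissible_pow_exp n xi; have a2' := admissible_pow_exp n sx.
  have a3' := admissible_gt (h * (2 * x)).
  rewrite /lap /ftail -!(pfZ PJ)// -(pfD PJ); try exact: admissibleZ.
  apply: (pf_le PJ) => //; first by apply: admissibleD; exact: admissibleZ.
  move=> y y0.
  have [hy|yh] := ltP (h * (2 * x)) y.
    rewrite mulr1 -[leLHS]add0r lerD ?pow_exp_le//.
    by rewrite !mulr_ge0 ?exprn_ge0 ?expR_ge0 ?(ltW b0).
  rewrite mulr0 addr0 mulrCA ler_wpM2l ?exprn_ge0// /b -expRD ler_expR.
  have : y / (2 * x) <= h by rewrite ler_pdivrMr// mulr_gt0.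
  have -> : x^-1 * y = y / (2 * x) + y / (2 * x) by field; rewrite gt_eqF.
  have -> : (2 * x)^-1 * y = y / (2 * x) by rewrite mulrC.
  lra.
apply: le_trans step _.
have k2 : b * b * (x ^+ n * ftail J x) <= (2 * x) ^+ n * ftail J (2 * x).
  rewrite -b2 -[e](subrK n%:R) addrC powRD ?pnatr_eq0 ?implybT// powR_mulrn// exprMn.
  by rewrite mulrACA; apply: ler_wpM2l lx; rewrite mulr_ge0 ?exprn_ge0 ?(ltW x0).
set k := (2 * x) ^+ n * ftail J (2 * x) in k2 *.
set k1 := x ^+ n * ftail J x in k2 IH.
have last : (n%:R / (2 * x)^-1) ^+ n * ftail J (h * (2 * x)) <= K * k.
  rewrite invrK exprMn /K /k [leRHS]mulrACA ler_wpM2l// mulr_ge0 ?exprn_ge0//.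
  by rewrite mulr_ge0// ltW.
apply: le_trans (lerD (ler_wpM2l (ltW b0) IH) last) _.
have k0 : 0 < k by rewrite mulr_gt0 ?exprn_gt0 ?mulr_gt0.
apply: (@le_trans _ _ (b^-1 * B * k + K * k)).
  rewrite lerD2r mulrCA mulrAC [leRHS]mulrC ler_wpM2l ?(ltW B_gt0)//.
  by rewrite ler_pdivlMl// mulrA.
rewrite -mulrDl ler_wpM2r ?(ltW k0)// -lerBrDl.
rewrite [leRHS](_ : _ = B * ((b - 1) / b)); last by field; rewrite gt_eqF.
apply: (@le_trans _ _ (K * b / (b - 1) * ((b - 1) / b))).
  by rewrite [leRHS](_ : _ = K)//; field; rewrite !gt_eqF.
by rewrite ler_wpM2r ?divr_ge0 ?(ltW bb) ?(ltW b0)// /B -addrA addrC -addrA lerDl addr_ge0.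
Qed.

Let powR_quot (b : R) : h^-1 * ((1 + h) `^ b - 1) @[h --> 0^'+] --> b.
Proof.
have d1 : derivable (fun y : R => y `^ b) 1 1.
  by apply: derivable_powR; rewrite in_itv/= ltr01.
have := @powR_derive1 R b 1; rewrite in_itv/= ltr01 powR1 mulr1 => /(_ isT) E.
move: d1 => /cvg_ex[l /= hl].
have lE : l = b by rewrite -E derive1E; apply/esym/cvg_lim.
rewrite -[X in _ --> X]lE; apply: cvg_trans (cvg_dnbhs_at_right hl).
apply: near_eq_cvg; near=> h.
rewrite -[LHS]/(h^-1 * ((h * 1 + 1) `^ b - 1 `^ b)).
by rewrite powR1 mulr1 [h + 1]addrC.
Unshelve. all: end_near. Qed.

(** As F is monotone, h x F(x) is at least the mass of [x, (1 + h) x] and at most 1 + h times that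
    of [x / (1 + h), x]. Regular variation of [ftail] gives the limit in x, and the derivative of a
    power at 1 the limit in h. *)
Lemma karamata_tail : x * F x / ftail J x @[x --> pinfty_nbhs R] --> a - 1.
Proof.
have hc (u : R) : u + h @[h --> 0^'+] --> u.
  by rewrite -[X in _ --> X]addr0; apply: cvgD; [exact: cvg_cst|exact: cvg_at_right_filter].
have lo : - (h^-1 * ((1 + h) `^ (1 - a) - 1)) @[h --> 0^'+] --> a - 1.
  by rewrite -[a - 1]opprB; apply: cvgN.
have up : (1 + h) * (h^-1 * ((1 + h) `^ (a - 1) - 1)) @[h --> 0^'+] --> a - 1.
  by rewrite -[X in _ --> X]mul1r; apply: cvgM.
apply/cvgrPdist_le => e e0.
have e2 : 0 < e / 2 by rewrite divr_gt0.
have [h [h0 hl hu]] : exists h, [/\ 0 < h,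
    a - 1 - e / 2 <= - (h^-1 * ((1 + h) `^ (1 - a) - 1)) &
    (1 + h) * (h^-1 * ((1 + h) `^ (a - 1) - 1)) <= a - 1 + e / 2].
  near (0 : R)^'+ => h; exists h; split.
  - by near: h; exact: nbhs_right_gt.
  - by near: h; apply: (cvgr_ge _ lo); rewrite ltrBlDr ltrDl.
  - by near: h; apply: (cvgr_le _ up); rewrite ltrDl.
have q0 : 0 < 1 + h by rewrite addr_gt0.
have qi : 0 < (1 + h)^-1 by rewrite invr_gt0.
have qE : (1 + h)^-1 `^ (1 - a) = (1 + h) `^ (a - 1).
  by rewrite -powR_inv1 ?(ltW q0)// -powRrM mulN1r opprB.
pose d := Num.min (e / 2 * h) (e / 2 * h / (1 + h)).
have d0 : 0 < d by rewrite lt_min !mulr_gt0.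
have d1 : d <= e / 2 * h by rewrite ge_min lexx.
have d2 : d <= e / 2 * h / (1 + h) by rewrite ge_min lexx orbT.
have /cvgrPdist_le/(_ _ d0) H1 := M_cvg q0.
have /cvgrPdist_le/(_ _ d0) H2 := M_cvg qi.
have [x1 x10 hx1] := (nearyP _).1 (filterI H1 H2).
apply/nearyP; exists x1 => // x x1x.
have x0 : 0 < x by exact: lt_le_trans x1x.
have [] := hx1 x x1x.
have p1 : 0 <= x <= (1 + h) * x.
  by rewrite (ltW x0)/= ler_peMl ?(ltW x0)// lerDl ltW.
have p2 : 0 <= (1 + h)^-1 * x <= x.
  by rewrite mulr_ge0 ?(ltW x0) ?(ltW qi)//= ler_piMl ?(ltW x0)// invf_le1// lerDl ltW.
have /andP[_ D1] := ftail_dens_diff dF Fdec p1.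
have /andP[D2 _] := ftail_dens_diff dF Fdec p2.
rewrite -/J in D1 D2; move: D1 D2; rewrite qE.
have M0 := M_gt0 x0; set M := ftail J x in M0 *.
set M1 := ftail J ((1 + h) * x); set M2 := ftail J ((1 + h)^-1 * x).
set P1 := (1 + h) `^ (1 - a) in hl *; set P2 := (1 + h) `^ (a - 1) in hu *.
move=> D1 D2; rewrite !ler_distlC => /andP[_ h1] /andP[_ h2].
rewrite ler_pdivrMr// in h1; rewrite ler_pdivrMr// in h2.
rewrite -[leRHS]mulrN opprB ler_pdivlMl// in hl.
rewrite mulrCA ler_pdivrMl// in hu.
rewrite ler_pdivlMr// ler_pdivrMr//; apply/andP; split.
  rewrite -(ler_pM2l h0); apply: le_trans (_ : M - M1 <= _); last first.
    apply: le_trans D1 _; rewrite le_eqVlt; apply/orP; left; apply/eqP; ring.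
  nra.
have Dx : h * (x * F x) <= (1 + h) * (M2 - M).
  rewrite [leLHS](_ : _ = (1 + h) * (F x * (x - (1 + h)^-1 * x))).
    by rewrite ler_wpM2l// ltW.
  by field; rewrite gt_eqF.
rewrite -(ler_pM2l h0); apply: le_trans Dx _.
rewrite ler_pdivlMr// in d2.
have : (1 + h) * (M2 - M) <= (1 + h) * ((P2 + d) * M - M).
  by rewrite ler_wpM2l ?(ltW q0)// lerD2r.
nra.
Unshelve. all: end_near. Qed.

End karamata.

(** * Transforms of the service times *)

Section laplace_ccdf.
Context d {T : measurableType d} {R : realType} (P : probability T R).
Variable X : {RV P >-> R}.
Notation mu := (@lebesgue_measure R).

Lemma measurable_bool_natr d' (T' : measurableType d') (f : T' -> bool) :
  measurable_fun setT f -> measurable_fun setT (fun x => (f x)%:R : R).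
Proof.
move=> mf; rewrite (_ : (fun x => _) = \1_(f @^-1` [set true])).
  apply: measurable_indic; rewrite -[X in measurable X]setTI; exact: mf.
apply/funext => x; rewrite indicE; congr ((nat_of_bool _)%:R).
by apply/idP/idP => [fx|/set_mem//]; exact/mem_set.
Qed.

Lemma fubini_ccdf (w : R -> R) : measurable_fun setT w -> (forall y, 0 <= w y) ->
  (\int[mu]_(y in `[0%R, +oo[) ((w y)%:E * ccdf X y) =
   \int[P]_om \int[mu]_(y in `[0%R, +oo[) (w y * (y < X om)%R%:R)%:E)%E.
Proof.
move=> mw w0.
pose f (p : T * measurableTypeR R) : \bar R :=
  (w p.2 * (0 <= p.2)%R%:R * (p.2 < X p.1)%R%:R)%:E.
have mf : measurable_fun setT f.
  apply/measurable_EFinP; apply: measurable_funM; first apply: measurable_funM.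
  - exact: (measurableT_comp mw).
  - have m1 : measurable_fun setT (fun p : T * measurableTypeR R => (0 <= p.2)%R).
      by apply: measurable_fun_ler => //; exact: measurable_snd.
    exact: measurable_bool_natr m1.
  - have m1 : measurable_fun setT (fun p : T * measurableTypeR R => (p.2 < X p.1)%R).
      apply: measurable_fun_ltr; first exact: measurable_snd.
      exact: measurableT_comp measurable_fst.
    exact: measurable_bool_natr m1.
have f0 p : (0 <= f p)%E by rewrite lee_fin !mulr_ge0.
transitivity (\int[mu]_y \int[P]_om f (om, y))%E; last first.
  rewrite -(fubini_tonelli f mf f0); apply: eq_integral => om _.
  rewrite [in RHS]integral_mkcond; apply: eq_integral => y _.
  rewrite patchE /f/=; have [y0|y0] := boolP (y \in `[0%R, +oo[%classic).
    by move: y0; rewrite inE/= in_itv/= andbT => ->; rewrite mulr1.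
  move: y0; rewrite notin_setE/= in_itv/= andbT => /negP/negPf ->.
  by rewrite mulr0 mul0r.
rewrite [in LHS]integral_mkcond; apply: eq_integral => y _.
rewrite patchE /f/=; have [y0|y0] := boolP (y \in `[0%R, +oo[%classic); last first.
  move: y0; rewrite notin_setE/= in_itv/= andbT => /negP/negPf ->.
  by under eq_integral do rewrite mulr0 mul0r; rewrite integral0.
move: y0; rewrite inE/= in_itv/= andbT => ->.
under eq_integral do rewrite mulr1 EFinM.
rewrite ge0_integralZl//; last 2 first.
- apply/measurable_EFinP; apply: measurable_bool_natr.
  exact: measurable_fun_ltr.
- by rewrite lee_fin.
rewrite /ccdf /distribution /pushforward -[in LHS](setIT (_ @^-1` _)) -integral_indic//; last first.
  by rewrite -[X in measurable X]setTI; exact: measurable_funPT.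
congr (_ * _)%E; apply: eq_integral => om _; rewrite indicE.
have -> : (y < X om) = (X om \in `]y, +oo[) by rewrite in_itv/= andbT.
congr ((nat_of_bool _)%:R%:E).
by apply/idP/idP => [/set_mem//|yX]; exact/mem_set.
Qed.


Hypotheses (X_cdf0 : cdf X 0 = 0%E) (iX : P.-integrable setT (EFin \o X)).

Definition rccdf y := fine (ccdf X y).

Lemma rccdf_fin y : ccdf X y = (rccdf y)%:E.
Proof. by rewrite fineK// fin_num_measure. Qed.

Lemma rccdf_ge0 y : 0 <= rccdf y.
Proof. by rewrite fine_ge0. Qed.

Lemma rccdf_le1 y : rccdf y <= 1.
Proof. by rewrite -lee_fin -rccdf_fin probability_le1. Qed.

Lemma rccdf_le x y : x <= y -> rccdf y <= rccdf x.
Proof. by move=> xy; rewrite -lee_fin -!rccdf_fin ccdf_nonincreasing. Qed.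

Lemma measurable_rccdf : measurable_fun setT rccdf.
Proof.
apply/measurable_EFinP; apply: eq_measurable_fun (ccdf_measurable X) => y _.
exact: rccdf_fin.
Qed.

Lemma ae_gt0 : {ae P, forall om, 0 < X om}.
Proof.
exists (X @^-1` `]-oo, 0%R]); split => //.
  by rewrite -[X in measurable X]setTI; exact: measurable_funPT.
by move=> om/= /negP; rewrite in_itv/= -leNgt.
Qed.

(** Fubini, with W the primitive of w; [wW] is asked at positive points, where [X] lies almost
    surely. *)
Lemma integral_rccdf (w W : R -> R) : measurable_fun setT w -> (forall y, 0 <= w y) ->
  (forall x, 0 < x -> (\int[mu]_(y in `[0%R, +oo[) (w y * (y < x)%R%:R)%:E = (W x)%:E)%E) ->
  measurable_fun setT W ->
  (\int[mu]_(y in `[0%R, +oo[) (rccdf y * w y)%:E = \int[P]_om (W (X om))%:E)%E.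
Proof.
move=> mw w0 wW mW; transitivity (\int[mu]_(y in `[0%R, +oo[) ((w y)%:E * ccdf X y))%E.
  by apply: eq_integral => y _; rewrite rccdf_fin -EFinM mulrC.
pose W' x := W x * (0 < x)%R%:R.
have mW' : measurable_fun setT W'.
  by apply: measurable_funM => //; apply: measurable_bool_natr; exact: measurable_fun_ltr.
transitivity (\int[P]_om (W' (X om))%:E)%E.
  rewrite fubini_ccdf//; apply: eq_integral => om _.
  rewrite /W'; have [x0|x0] := ltP 0 (X om); first by rewrite mulr1 wW.
  rewrite mulr0; apply: integral0_eq => y; rewrite /= in_itv/= andbT => y0.
  by rewrite ltNge (le_trans x0 y0) mulr0.
apply: ae_eq_integral => //.
- by apply/measurable_EFinP; exact: measurableT_comp.
- by apply/measurable_EFinP; exact: measurableT_comp.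
- by apply: filterS ae_gt0 => om X0 _; rewrite /W' X0 mulr1.
Qed.

Let integral_lt (w : R -> R) x :
  (\int[mu]_(y in `[0%R, +oo[) (w y * (y < x)%R%:R)%:E = \int[mu]_(y in `[0%R, x[) (w y)%:E)%E.
Proof.
rewrite integral_mkcond [RHS]integral_mkcond; apply: eq_integral => y _.
rewrite !patchE !mem_setE !in_itv/= andbT.
by case: (0 <= y); case: (y < x); rewrite ?mulr1 ?mulr0.
Qed.

Lemma integral_rccdf1 :
  (\int[mu]_(y in `[0%R, +oo[) (rccdf y)%:E = 'E_P[X])%E.
Proof.
transitivity (\int[mu]_(y in `[0%R, +oo[) (rccdf y * 1)%:E)%E.
  by apply: eq_integral => y _; rewrite mulr1.
rewrite (@integral_rccdf (fun=> 1) id) ?unlock// => x x0.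
rewrite (@integral_lt (fun=> 1)) integral_cst//= mul1e lebesgue_measure_itv/= lte_fin x0.
by rewrite sube0.
Qed.

Lemma density_rccdf : density rccdf.
Proof.
split; [exact: measurable_rccdf|exact: rccdf_ge0|].
apply/integrableP; split; first apply/measurable_EFinP.
  by apply: measurable_funTS; exact: measurable_rccdf.
have -> : (\int[mu]_(y in `[0%R, +oo[) `|(EFin \o rccdf) y| =
    \int[mu]_(y in `[0%R, +oo[) (rccdf y)%:E)%E.
  by apply: eq_integral => y _; rewrite /= ger0_norm ?rccdf_ge0.
rewrite integral_rccdf1.
by rewrite ltey_eq expectation_fin_num//; exact/Lfun1_integrable.
Qed.

Lemma dens_rccdf1 : dens rccdf (fun=> 1) = fine 'E_P[X]%E.
Proof.
rewrite /dens /Rintegral -integral_rccdf1; congr fine.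
by apply: eq_integral => y _; rewrite mulr1.
Qed.

(** Integration by parts: 1 - s times the transform of the tail is the Laplace-Stieltjes transform
    of X. *)
Lemma expectation_affine_exp (a b s : R) : 0 < s ->
  fine 'E_P[fun om => (a + b * expR (- (s * X om)))%R]%E =
  a + b * (1 - s * lap (dens rccdf) 0 s).
Proof.
move=> s0; pose V x := expR (- (s * Num.max x 0)); pose W x := s^-1 * (1 - V x).
(* Truncation at 0 makes [V] bounded on the whole line, so that [V \o X] is integrable; it changes
   [X] on a null set only. *)
have mV : measurable_fun setT V.
  by apply: (measurableT_comp (measurable_expRM s)); exact: measurable_maxr.
have mW : measurable_fun setT W.
  by apply: measurable_funM => //; exact: measurable_funB.
have V1 x : `|V x| <= 1.
  by rewrite ger0_norm ?expR_ge0// -expR0 ler_expR oppr_le0 mulr_ge0 ?(ltW s0)// le_max lexx orbT.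
have i1 : P.-integrable setT (EFin \o (fun=> 1 : R)) by exact: finite_measure_integrable_cst.
have mVX : measurable_fun setT (V \o X) by exact: measurableT_comp.
have iV : P.-integrable setT (EFin \o (V \o X)).
  apply: le_integrable i1 => //; first exact/measurable_EFinP.
  by move=> om _; rewrite lee_fin normr1 V1.
have -> : lap (dens rccdf) 0 s = \int[P]_om W (X om).
  rewrite /lap /dens /Rintegral -(@integral_rccdf (fun y => expR (- (s * y))))//.
  - by congr fine; apply: eq_integral => y _; rewrite expr0 mul1r.
  - exact: measurable_expRM.
  - move=> x x0; rewrite (@integral_lt (fun y => expR (- (s * y)))).
    have /= := @exponential_prob_itv0c R s x x0; rewrite /exponential_prob.
    rewrite -integral_itv_bndo_bndc; last first.
      by apply/measurable_EFinP/measurable_funTS; exact: measurable_exponential_pdf.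
    have -> : (\int[mu]_(y in `[0%R, x[) (exponential_pdf s y)%:E =
        \int[mu]_(y in `[0%R, x[) (s%:E * (expR (- (s * y)))%:E))%E.
      apply: eq_integral => y; rewrite inE/= in_itv/= => /andP[y0 _].
      by rewrite exponential_pdfE// mulNr.
    rewrite ge0_integralZl ?lee_fin ?(ltW s0)//; last first.
      by apply/measurable_EFinP/measurable_funTS; exact: measurable_expRM.
    rewrite mulNr -EFinB => /(congr1 (fun u => (s^-1)%:E * u)%E).
    rewrite muleA -EFinM mulVf ?gt_eqF// mul1e => ->.
    by rewrite /W /V max_l ?(ltW x0).
have -> : fine 'E_P[fun om => (a + b * expR (- (s * X om)))%R]%E = \int[P]_om (a + b * V (X om)).
  rewrite unlock /Rintegral; congr fine; apply: ae_eq_integral => //.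
  - apply/measurable_EFinP; apply: measurable_funD => //; apply: measurable_funM => //.
    exact: (measurableT_comp (measurable_expRM s)).
  - by apply/measurable_EFinP; apply: measurable_funD => //; exact: measurable_funM.
  - by apply: filterS ae_gt0 => om X0 _; rewrite /V max_l ?(ltW X0).
have ia : P.-integrable setT (EFin \o (fun=> a)) by exact: finite_measure_integrable_cst.
have P1 : fine (P setT) = 1 by have /= := probability_setT P => ->.
rewrite RintegralZl//; last exact: (integrableB _ i1 iV).
rewrite RintegralB// RintegralD//; last exact: (integrableZl _ _ iV).
rewrite RintegralZl// !Rintegral_cst// P1 !mulr1; field.
by rewrite gt_eqF.
Qed.

End laplace_ccdf.

(** * Balance equations *)

Lemma real_derive_expM (R : realType) (c x : R) :
  is_derive x 1 (fun y => expR (c * y)) (c * expR (c * x)).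
Proof.
have := @is_derive1_comp _ expR (fun y => c * y) x (expR (c * x)) (c * 1).
move/(_ (is_derive_expR _) (real_deriveZ c (is_derive_id x (1 : R)))).
by rewrite mulr1 mulrC.
Qed.

Section balance.
Context d {Omega : measurableType d} {R : realType} (P : probability Omega R).
Variable Q : retrial_queue P.
Variables (Iser Rque Rorb : {RV P >-> nat}) (X : {RV P >-> R}).
Hypothesis hstat : stationary Q Iser Rque Rorb X.

(** (1 - beta_c(s)) / s, where beta_c is the Laplace-Stieltjes transform of the service time: 1 - s
    [phi c s] is beta_c(s), and [rate Q c * phi c s] tends to the load. *)
Definition phi (c : customer) s := lap (dens (rccdf (service Q c))) 0 s.

Definition on_server (i : nat) (h : Omega -> R) : R :=
  \int[P]_om ((Iser om == i)%:R * h om).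

Definition bounded_mfun (h : Omega -> R) :=
  measurable_fun setT h /\ exists C, forall om, `|h om| <= C.

Let measurable_nat_fun (V : {RV P >-> nat}) (g : nat -> R) :
  measurable_fun setT (g \o V).
Proof. by apply: measurableT_comp. Qed.

Lemma integrable_on_server i h : bounded_mfun h ->
  P.-integrable setT (EFin \o (fun om => (Iser om == i)%:R * h om)).
Proof.
move=> [mh [C hC]].
have i1 : P.-integrable setT (EFin \o (fun=> C : R)) by exact: finite_measure_integrable_cst.
apply: le_integrable i1 => //.
  apply/measurable_EFinP; apply: measurable_funM => //.
  exact: (measurable_nat_fun Iser (fun n => (n == i)%:R)).
move=> om _; rewrite lee_fin normrM [leRHS]ger0_norm; last exact: le_trans (hC om).
by case: (_ == _); rewrite ?normr1 ?mul1r ?normr0 ?mul0r//; exact: le_trans (hC om).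
Qed.

Lemma rate_gt0 c : 0 < rate Q c.
Proof.
case: c; rewrite /rate mulr_gt0 ?arrival_rate_gt0 ?type1_prob_gt0//.
by rewrite subr_gt0 type1_prob_lt1.
Qed.

Section test_function.
Variables (z t u : R) (A B : customer -> R).
Hypotheses (z01 : 0 <= z <= 1) (t0 : 0 < t).
Let l1 := rate Q Type1.
Let l2 := rate Q Type2.
Let s := l1 * (1 - z) + l2 * (1 - expR (- t)).
Hypothesis ABu : forall c, A c + B c = u.
Hypothesis zu : A Type1 + B Type1 * (1 - s * phi Type1 s) = z * u.
Let D2 := A Type2 + B Type2 * (1 - s * phi Type2 s).

(* [u] is the value in the idle states; the constraints on [A], [B] and [u] are
   the boundary conditions of [gen_domain]. *)
Definition test (q : qstate R) : R :=
  match q with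
  | idle n => u * expR (- t) ^+ n
  | busy c m n x => z ^+ m * expR (- t) ^+ n * (A c + B c * expR (- (s * x)))
  end.

Let w1 : 0 < 1 - expR (- t).
Proof. by rewrite subr_gt0 expR_lt1 oppr_lt0. Qed.

Let s0 : 0 < s.
Proof.
have /andP[_ z1] := z01.
have l10 : 0 < l1 by exact: rate_gt0.
have l20 : 0 < l2 by exact: rate_gt0.
have h1 : 0 <= l1 * (1 - z) by rewrite mulr_ge0 ?subr_ge0 ?(ltW l10).
have h2 : 0 < l2 * (1 - expR (- t)) by rewrite mulr_gt0.
by rewrite /s; lra.
Qed.

Let start_test c m n : start Q test c m n =
  z ^+ m * expR (- t) ^+ n * (A c + B c * (1 - s * phi c s)).
Proof.
rewrite /start /test /phi mulrDr mulrA.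
rewrite -(expectation_affine_exp (service_cdf0 Q c) _ _ s0).
by congr (fine 'E_P[_]); apply/funext => om; rewrite mulrDr mulrA.
Qed.

Let is_derive_test c m n (x : R) : is_derive x 1 (fun y => test (busy c m n y))
  (- (s * B c * (z ^+ m * expR (- t) ^+ n)) * expR (- (s * x))).
Proof.
have H := real_deriveZ (z ^+ m * expR (- t) ^+ n) (real_deriveD (is_derive_cst (A c) x 1)
  (real_deriveZ (B c) (real_derive_expM (- s) x))).
rewrite (_ : (fun y => test _) = (fun y => z ^+ m * expR (- t) ^+ n *
    (cst (A c) y + B c * expR (- s * y)))).
  apply: (is_derive_eq H); rewrite [- s * x]mulNr; ring.
by apply/funext => y; rewrite /test mulNr.
Qed.

Let expR_nat n : expR (- t) ^+ n = expR (- (t * n%:R)).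
Proof. by rewrite -expRM_natr mulNr. Qed.

Lemma generator_test_idle n : generator Q test (idle n) =
  (l1 * (z - 1) * u + l2 * (D2 - u)) * expR (- (t * n%:R)) +
  retrial_rate Q * (D2 / expR (- t) - u) * (n%:R * expR (- (t * n%:R))).
Proof.
have e0 : expR (- t) != 0 by rewrite gt_eqF ?expR_gt0.
rewrite /generator !start_test zu -/D2 -expR_nat /= -/l1 -/l2 !expr0 !mul1r.
case: n => [|n]; first by rewrite !expr0 !mul0r !mulr0; ring.
by rewrite exprS/=; field.
Qed.

(** [s] is chosen so that the drift cancels the arrivals on the exponential part: the residual time
    disappears and the constant [A c] alone remains. *)
Lemma generator_test_busy c m n x : generator Q test (busy c m n x) =
  - (s * A c) * (z ^+ m * expR (- (t * n%:R))).
Proof.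
rewrite /generator derive1E (@derive_val _ _ _ _ _ _ _ (is_derive_test c m n x)).
by rewrite /test -expR_nat /s -/l1 -/l2 !exprS; ring.
Qed.

Let expn_le1 m n : 0 <= z ^+ m * expR (- (t * n%:R)) <= 1.
Proof.
have /andP[z0 z1] := z01; rewrite mulr_ge0 ?exprn_ge0 ?expR_ge0//=.
by rewrite mulr_ile1 ?exprn_ge0 ?expR_ge0 ?exprn_ile1// -expR0 ler_expR oppr_le0 mulr_ge0 ?(ltW t0).
Qed.

Let exp_le1 n : 0 <= expR (- (t * n%:R)) <= 1.
Proof. by have := expn_le1 0 n; rewrite mul1r. Qed.

(** The total retrial rate grows linearly in n; damping by t > 0 keeps the generator bounded on idle
    states. The law of the queue is later reached by letting t tend to 0. *)
Let nexp_le n : `|n%:R * expR (- (t * n%:R))| <= t^-1.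
Proof.
rewrite ger0_norm ?mulr_ge0 ?expR_ge0//.
by have := @pow_exp_le _ 1 t n%:R t0 (ler0n _ _); rewrite !expr1 mul1r.
Qed.

Lemma gen_domain_test : gen_domain Q test.
Proof.
split.
- exists (`|u| + `|A Type1| + `|B Type1| + `|A Type2| + `|B Type2|); split.
    move=> n; rewrite /test expR_nat normrM (ger0_norm (expR_ge0 _)).
    have /andP[_ h] := exp_le1 n.
    apply: le_trans (_ : `|u| * 1 <= _); first by rewrite ler_wpM2l.
    by rewrite mulr1 -!addrA lerDl !addr_ge0.
  move=> c m n x x0; rewrite /test expR_nat normrM.
  have /andP[h0 h1] := expn_le1 m n; rewrite (ger0_norm h0).
  have h : `|A c + B c * expR (- (s * x))| <= `|A c| + `|B c|.
    apply: le_trans (ler_normD _ _) _; rewrite lerD2l normrM ler_piMr//.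
    by rewrite ger0_norm ?expR_ge0// -expR0 ler_expR oppr_le0 mulr_ge0 ?(ltW s0).
  apply: le_trans (_ : 1 * (`|A c| + `|B c|) <= _); first by rewrite ler_pM.
  have := normr_ge0 u; have := normr_ge0 (A Type1); have := normr_ge0 (B Type1).
  have := normr_ge0 (A Type2); have := normr_ge0 (B Type2).
  by case: c {h}; lra.
- pose a := l1 * (z - 1) * u + l2 * (D2 - u).
  pose b := retrial_rate Q * (D2 / expR (- t) - u).
  exists (`|a| + `|b| * t^-1 + `|s * A Type1| + `|s * A Type2|); split.
    move=> n; rewrite generator_test_idle -/a -/b.
    apply: le_trans (ler_normD _ _) _; rewrite -!addrA lerD//.
      have /andP[h0 h1] := exp_le1 n.
      by rewrite normrM (ger0_norm h0) ler_piMr.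
    by rewrite normrM ler_wpDr ?addr_ge0// ler_wpM2l.
  move=> c m n x x0; rewrite generator_test_busy normrM normrN.
  have /andP[h0 h1] := expn_le1 m n; rewrite (ger0_norm h0).
  apply: le_trans (_ : `|s * A c| * 1 <= _); first by rewrite ler_wpM2l.
  have h : 0 <= `|b| * t^-1 by rewrite mulr_ge0 ?invr_ge0 ?(ltW t0).
  have := normr_ge0 a; have := normr_ge0 (s * A Type1); have := normr_ge0 (s * A Type2).
  by case: c; lra.
- by move=> c m n x; have [] := is_derive_test c m n x.
- move=> c m n.
  have -> : derive1 (fun y => test (busy c m n y)) = (fun x =>
      - (s * B c * (z ^+ m * expR (- t) ^+ n)) * expR (- s * x)).
    by apply/funext => x; rewrite derive1E (@derive_val _ _ _ _ _ _ _ (is_derive_test c m n x)) [- s * x]mulNr.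
  move=> x; have [/derivable1_diffP/differentiable_continuous H _] :=
    real_deriveZ (- (s * B c * (z ^+ m * expR (- t) ^+ n))) (real_derive_expM (- s) x).
  exact: H.
- move=> c m n; rewrite /completion; case: m => [|m]; last first.
    by rewrite start_test zu /test mulr0 oppr0 expR0 mulr1 ABu exprS; ring.
  by rewrite /test mulr0 oppr0 expR0 mulr1 ABu mul1r mulrC.
Qed.

Lemma balance :
  (l1 * (z - 1) * u + l2 * (D2 - u)) * on_server 0 (fun om => expR (- (t * (Rorb om)%:R)))
  + retrial_rate Q * (D2 / expR (- t) - u) *
      on_server 0 (fun om => (Rorb om)%:R * expR (- (t * (Rorb om)%:R)))
  = s * A Type1 * on_server 1 (fun om => z ^+ Rque om * expR (- (t * (Rorb om)%:R)))
  + s * A Type2 * on_server 2 (fun om => z ^+ Rque om * expR (- (t * (Rorb om)%:R))).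
Proof.
have [I2 _ _ bal] := hstat; have := bal _ gen_domain_test; rewrite unlock.
pose a := l1 * (z - 1) * u + l2 * (D2 - u).
pose b := retrial_rate Q * (D2 / expR (- t) - u).
pose ex om := expR (- (t * (Rorb om)%:R)).
pose zx om := z ^+ Rque om * ex om.
pose h0 om := ex om.
pose h1 om := (Rorb om)%:R * ex om.
have mex : measurable_fun setT ex by exact: (measurable_nat_fun Rorb (fun n => expR (- (t * n%:R)))).
have be : bounded_mfun ex.
  by split => //; exists 1 => om; have /andP[p0 p1] := exp_le1 (Rorb om); rewrite ger0_norm.
have b1 : bounded_mfun h1.
  split; last by exists t^-1 => om; exact: nexp_le.
  exact: (measurable_nat_fun Rorb (fun n => n%:R * expR (- (t * n%:R)))).
have bz : bounded_mfun zx.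
  split; first by apply: measurable_funM => //; exact: (measurable_nat_fun Rque (fun n => z ^+ n)).
  by exists 1 => om; have /andP[p0 p1] := expn_le1 (Rque om) (Rorb om); rewrite ger0_norm.
have iZ i h c : bounded_mfun h -> P.-integrable setT (EFin \o (fun om => c * ((Iser om == i)%:R * h om))).
  by move=> bh; exact: (integrableZl _ _ (integrable_on_server i bh)).
have E om : generator Q test (state_at Iser Rque Rorb X om) =
   (a * ((Iser om == 0)%:R * h0 om) + b * ((Iser om == 0)%:R * h1 om)) +
   (- (s * A Type1) * ((Iser om == 1)%:R * zx om) + - (s * A Type2) * ((Iser om == 2)%:R * zx om)).
  rewrite /state_at; have := I2 om; case: (Iser om) => [|[|[|//]]] _ /=.
  - by rewrite -/(generator Q test (idle (Rorb om))) generator_test_idle /a /b /h0 /h1 /ex; ring.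
  - by rewrite -/(generator Q test (busy Type1 (Rque om) (Rorb om) (X om))) generator_test_busy /zx /ex; ring.
  - by rewrite -/(generator Q test (busy Type2 (Rque om) (Rorb om) (X om))) generator_test_busy /zx /ex; ring.
rewrite (_ : (fun om => _) = (fun om => ((a * ((Iser om == 0)%:R * h0 om) + b * ((Iser om == 0)%:R * h1 om)) +
   (- (s * A Type1) * ((Iser om == 1)%:R * zx om) + - (s * A Type2) * ((Iser om == 2)%:R * zx om)))%:E)); last first.
  by apply/funext => om; rewrite /= E.
move/(congr1 fine); rewrite -/(Rintegral _ _ _).
rewrite RintegralD//; last 2 first.
- exact: (integrableD _ (iZ _ _ _ be) (iZ _ _ _ b1)).
- exact: (integrableD _ (iZ _ _ _ bz) (iZ _ _ _ bz)).
rewrite RintegralD// ?RintegralZl//; try exact: iZ; try exact: integrable_on_server.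
rewrite -/(on_server _ _) RintegralD// ?RintegralZl//; try exact: iZ; try exact: integrable_on_server.
rewrite /= -!/(on_server _ _) -/a -/b -/h0 -/ex -/zx -/h1 => H.
lra.
Qed.

End test_function.
End balance.

(** * The root of the priority equation *)

Section root_equation.
Context {R : realType}.
Variables (J : (R -> R) -> R) (l : R).
Hypotheses (PJ : positive_functional J) (l0 : 0 < l) (rho1 : l * J (fun=> 1) < 1).
Implicit Types (s t c : R).
Let a := 1 - l * J (fun=> 1).

(** With beta the transform of the service time, s - l (1 - beta(s)): the Laplace exponent of a unit
    drift minus a compound Poisson process, whose inverse governs busy periods. *)
Definition psi s := s * (1 - l * lap J 0 s).
Definition dpsi s := 1 - l * (lap J 0 s - s * lap J 1 s).

Let a_gt0 : 0 < a. Proof. by rewrite subr_gt0. Qed.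

Lemma psi_ge s : 0 < s -> a * s <= psi s.
Proof.
move=> s0; rewrite /psi mulrC ler_wpM2l ?(ltW s0)// lerD2l lerN2 ler_wpM2l ?(ltW l0)//.
exact: lap0_le.
Qed.

Lemma psi_le s : 0 < s -> psi s <= s.
Proof.
move=> s0; rewrite /psi ler_piMr ?(ltW s0)// lerBlDr lerDl mulr_ge0 ?(ltW l0)//.
exact: lap_ge0.
Qed.

Lemma dpsi_ge s : 0 < s -> a <= dpsi s.
Proof.
move=> s0; rewrite lerD2l lerN2 ler_wpM2l ?(ltW l0)//.
apply: le_trans (lap0_le PJ s0); rewrite lerBlDr lerDl mulr_ge0 ?(ltW s0)//.
exact: lap_ge0.
Qed.

Lemma is_derive_psi s : 0 < s -> is_derive s 1 psi (dpsi s).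
Proof.
move=> s0.
have := real_deriveM (is_derive_id s (1 : R)) (real_deriveD (is_derive_cst (1 : R) s 1)
  (real_deriveZ (- l) (is_derive_lap PJ 0 s0))).
rewrite [X in is_derive _ _ X _](_ : _ = psi); last first.
  by apply/funext => x; rewrite /psi mulNr.
by move=> H; apply: (is_derive_eq H); rewrite /dpsi /cst; ring.
Qed.

Lemma psi_incr s t : 0 < s -> s <= t -> a * (t - s) <= psi t - psi s.
Proof.
move=> s0 st; have h := lap_le PJ 0 s0 st; have h2 := lap0_le PJ s0.
have t0 := lt_le_trans s0 st.
have h3 : l * (t * lap J 0 t) <= l * (t * lap J 0 s) by rewrite !ler_wpM2l ?(ltW l0) ?(ltW t0).
have h4 : l * (t - s) * lap J 0 s <= l * (t - s) * J (fun=> 1).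
  by rewrite ler_wpM2l// mulr_ge0 ?(ltW l0)// subr_ge0.
rewrite /a /psi; lra.
Qed.

Lemma psi_inj s t : 0 < s -> 0 < t -> psi s = psi t -> s = t.
Proof.
move=> s0 t0 st; have [h|h] := leP s t.
  have := psi_incr s0 h; rewrite st subrr pmulr_rle0// subr_le0 => h'.
  by apply/eqP; rewrite eq_le h h'.
have := psi_incr t0 (ltW h); rewrite st subrr pmulr_rle0// subr_le0.
by rewrite leNgt h.
Qed.

(** The bounds a s <= [psi s] <= s place a root in [c, c / a]. *)
Lemma psi_surj c : 0 < c -> exists s, 0 < s /\ psi s = c.
Proof.
move=> c0; have ca : c <= c / a.
  by rewrite ler_pdivlMr// ler_piMr ?(ltW c0)// lerBlDr lerDl mulr_ge0 ?(ltW l0)// (le_trans (lap_ge0 PJ 0 ltr01))// lap0_le.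
have cac : 0 < c / a by exact: lt_le_trans ca.
have cont : {within `[c, c / a], continuous psi}.
  apply: derivable_within_continuous => x; rewrite in_itv/= => /andP[cx _].
  by have [] := is_derive_psi (lt_le_trans c0 cx).
have [|x] := IVT ca cont (_ : Num.min (psi c) (psi (c / a)) <= c <= Num.max (psi c) (psi (c / a))).
  rewrite ge_min psi_le//= le_max; apply/orP; right.
  by apply: le_trans (psi_ge cac); rewrite mulrC divfK ?gt_eqF.
by rewrite in_itv/= => /andP[cx _] h; exists x; split => //; exact: lt_le_trans cx.
Qed.

Definition psi_inv c := get [set s | 0 < s /\ psi s = c].

Lemma psi_invP c : 0 < c -> 0 < psi_inv c /\ psi (psi_inv c) = c.
Proof. by move=> /psi_surj h; exact: (getPex h). Qed.

Lemma psiK s : 0 < s -> psi_inv (psi s) = s.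
Proof.
move=> s0; have [h1 h2] := psi_invP (lt_le_trans (mulr_gt0 a_gt0 s0) (psi_ge s0)).
exact: psi_inj.
Qed.

Lemma is_derive_psi_inv c : 0 < c -> is_derive c 1 psi_inv (dpsi (psi_inv c))^-1.
Proof.
move=> c0; have [r0 E] := psi_invP c0; move: (psi_inv c) r0 E => s s0 <- {c c0}.
have p0 : \forall x \near s, 0 < x by exact: lt_nbhsr.
apply: (@is_derive_inverse _ psi).
- by apply: filterS p0 => x; exact: psiK.
- apply: filterS p0 => x /is_derive_psi[/derivable1_diffP/differentiable_continuous + _].
  exact.
- exact: is_derive_psi.
- by rewrite gt_eqF// (lt_le_trans a_gt0 (dpsi_ge s0)).
Qed.

(** s y e^(-s y) <= 2 (e^(-s y / 2) - e^(-s y)), and the two transforms on the right have the same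
    limit at 0. *)
Lemma M_lap1_cvg0 : s * lap J 1 s @[s --> 0^'+] --> 0.
Proof.
have c2 : 2 * (lap J 0 (s / 2) - lap J 0 s) @[s --> 0^'+] --> 0.
  rewrite [X in _ --> X](_ : 0 = 2 * (J (fun=> 1) - J (fun=> 1))); last by rewrite subrr mulr0.
  apply: cvgM; first exact: cvg_cst.
  apply: cvgB; last exact: lap_cvg0.
  have h2 : asymp_linear (fun s : R => s / 2) 2^-1.
    split; first by move=> t t0; rewrite divr_gt0.
    by apply: eq_pos_cvg (cvg_cst _) => t t0; rewrite mulrAC divff ?gt_eqF// mul1r.
  exact: cvg_comp (asymp_linear_at_right h2) (lap_cvg0 PJ).
apply: (squeeze_cvgr _ (cvg_cst 0) c2); near=> s.
have s0 : 0 < s by [].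
have s20 : 0 < s / 2 by rewrite divr_gt0.
rewrite mulr_ge0 ?(ltW s0) ?lap_ge0//=.
have A1 := admissible_pow_exp 1 s0; have A0 := admissible_pow_exp 0 s0.
have A2 := admissible_pow_exp 0 s20; have AB := admissibleB A2 A0.
rewrite /lap -(pfB PJ A2 A0) -(pfZ PJ _ A1) -(pfZ PJ _ AB).
apply: (pf_le PJ) => [||y y0]; [exact: admissibleZ|exact: admissibleZ|].
rewrite expr1 !expr0 !mul1r mulrA.
have E : expR (- (s / 2 * y)) = expR (- (s * y)) * expR (s / 2 * y).
  by rewrite -expRD; congr expR; field.
rewrite E; have e0 := expR_gt0 (- (s * y)); have := expR_ge1Dx (s / 2 * y); nra.
Unshelve. all: end_near. Qed.

Variable l2 : R.
Hypothesis l20 : 0 < l2.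

(** In classical notation, lambda - lambda g(z) at z = e^(-t); the function h(z) is then 1 - s
    [lap J 0 s] at s = [sigma t]. *)
Definition sigma t := psi_inv (l2 * (1 - expR (- t))).
(** The vector field of the autonomous equation solved by [sigma]: the derivative of l2 (1 - e^(-t))
    is l2 minus itself, that is l2 - psi(sigma(t)). *)
Definition chi s := (l2 - psi s) / dpsi s.

Let exp_gt0 t : 0 < t -> 0 < l2 * (1 - expR (- t)).
Proof. by move=> t0; rewrite mulr_gt0// subr_gt0 expR_lt1 oppr_lt0. Qed.

Lemma sigma_gt0 t : 0 < t -> 0 < sigma t.
Proof. by move=> /exp_gt0 /psi_invP[]. Qed.

Lemma psi_sigma t : 0 < t -> psi (sigma t) = l2 * (1 - expR (- t)).
Proof. by move=> /exp_gt0 /psi_invP[]. Qed.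

End root_equation.

Section exponential_change.
Context {R : realType}.
Variable l : R.
Hypothesis l0 : 0 < l.
Implicit Types t : R.

Definition eps t := l * (1 - expR (- t)).

Lemma eps_gt0 t : 0 < t -> 0 < eps t.
Proof. by move=> t0; rewrite mulr_gt0// subr_gt0 expR_lt1 oppr_lt0. Qed.

Lemma is_derive_eps t : is_derive t 1 eps (l - eps t).
Proof.
have := real_deriveZ l (real_deriveD (is_derive_cst (1 : R) t 1)
  (real_deriveZ (-1) (real_derive_expM (-1) t))).
rewrite [X in is_derive _ _ X _](_ : _ = eps); last first.
  by apply/funext => x; rewrite /eps /cst !mulN1r.
by move=> H; apply: (is_derive_eq H); rewrite /eps !mulN1r; ring.
Qed.

Lemma asymp_linear_eps : asymp_linear eps l.
Proof.
split; first exact: eps_gt0.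
apply: (@squeeze_cvgr _ _ _ _ (fun t => l * (1 - t)) (fun=> l)); last 2 first.
- rewrite [X in _ --> X](_ : l = l * (1 - 0)); last by rewrite subr0 mulr1.
  apply: cvgM; first exact: cvg_cst.
  by apply: cvgB; [exact: cvg_cst|exact: cvg_at_right_filter].
- exact: cvg_cst.
near=> t; have t0 : 0 < t by [].
have h1 := expR_ge1Dx (- t); have h2 := expR_ge1Dx t.
have hm : expR t * expR (- t) = 1 by exact: expRxMexpNx_1.
have e0 := expR_gt0 (- t).
have h3 : expR (- t) * (1 + t) <= 1 by rewrite -[leRHS]hm mulrC ler_wpM2r// ltW.
rewrite ler_pdivlMr// ler_pdivrMr//; apply/andP; split.
  rewrite -mulrA ler_wpM2l ?(ltW l0)//.
  have h4 : t * expR (- t) <= 1 - expR (- t) by lra.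
  apply: le_trans h4; rewrite mulrC ler_wpM2l ?(ltW t0)//.
by rewrite ler_wpM2l ?(ltW l0)//; lra.
Unshelve. all: end_near. Qed.

End exponential_change.

Section sigma.
Context {R : realType}.
Variables (J : (R -> R) -> R) (l l2 : R).
Hypotheses (PJ : positive_functional J) (l0 : 0 < l) (rho1 : l * J (fun=> 1) < 1) (l20 : 0 < l2).
Let a := 1 - l * J (fun=> 1).
Let a_gt0 : 0 < a. Proof. by rewrite subr_gt0. Qed.
Notation sigma := (sigma J l l2).
Notation chi := (chi J l l2).

Lemma is_derive_sigma (t : R) : 0 < t -> is_derive t 1 sigma (chi (sigma t)).
Proof.
move=> t0; have := @is_derive1_comp _ (psi_inv J l) (eps l2) t _ _
  (is_derive_psi_inv PJ l0 rho1 (eps_gt0 l20 t0)) (is_derive_eps l2 t).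
rewrite [X in is_derive _ _ X _](_ : _ = sigma)//.
move=> H; apply: (is_derive_eq H).
by rewrite /chi (psi_sigma PJ l0 rho1 l20 t0) mulrC.
Qed.

Lemma asymp_linear_sigma : asymp_linear sigma (l2 / a).
Proof.
split; first exact: sigma_gt0.
have e0 := asymp_linear_cvg0 (asymp_linear_eps l20).
have s0 : sigma t @[t --> 0^'+] --> 0.
  apply: (@squeeze_cvgr _ _ _ _ (fun=> 0) (fun t => a^-1 * eps l2 t)); last 2 first.
  - exact: cvg_cst.
  - by rewrite -[X in _ --> X](mulr0 a^-1); apply: cvgM => //; exact: cvg_cst.
  near=> t; have t0 : 0 < t by [].
  have g0 := sigma_gt0 PJ l0 rho1 l20 t0.
  by rewrite (ltW g0)/= ler_pdivlMl// /eps -(psi_sigma PJ l0 rho1 l20 t0) psi_ge.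
have sr := cvg_pos_at_right (sigma_gt0 PJ l0 rho1 l20) s0.
have c1 : 1 - l * lap J 0 (sigma t) @[t --> 0^'+] --> a.
  apply: cvgB; first exact: cvg_cst.
  apply: cvgM; first exact: cvg_cst.
  exact: cvg_comp sr (lap_cvg0 PJ).
have c2 : (1 - l * lap J 0 (sigma t))^-1 @[t --> 0^'+] --> a^-1.
  by apply: cvgV c1; exact: lt0r_neq0.
apply: eq_pos_cvg (cvgM (asymp_linear_eps l20).2 c2) => t t0.
rewrite /= /eps -(psi_sigma PJ l0 rho1 l20 t0) /psi.
have g0 := sigma_gt0 PJ l0 rho1 l20 t0.
field; rewrite (gt_eqF t0) /= gt_eqF//.
apply: lt_le_trans a_gt0 _; rewrite lerD2l lerN2 ler_wpM2l ?(ltW l0)//.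
exact: lap0_le.
Unshelve. all: end_near. Qed.

Lemma chi_cvg : chi s @[s --> 0^'+] --> l2 / a.
Proof.
have id0 : s @[s --> 0^'+] --> (0 : R) by exact: cvg_at_right_filter.
have cl : l * lap J 0 s @[s --> 0^'+] --> l * J (fun=> 1).
  by apply: cvgM; [exact: cvg_cst|exact: lap_cvg0].
apply: cvgM.
  rewrite [X in _ --> X](_ : l2 = l2 - 0 * a); last by rewrite mul0r subr0.
  apply: cvgB; first exact: cvg_cst.
  apply: cvgM => //; apply: cvgB => //; exact: cvg_cst.
apply: cvgV; first exact: lt0r_neq0.
apply: cvgB; first exact: cvg_cst.
rewrite [X in _ --> X](_ : _ = l * J (fun=> 1) - l * 0); last by rewrite mulr0 subr0.
have -> : (fun s => l * (lap J 0 s - s * lap J 1 s)) = (fun s => l * lap J 0 s - l * (s * lap J 1 s)).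
  by apply/funext => s; rewrite mulrBr.
apply: cvgB => //; apply: cvgM; first exact: cvg_cst.
exact: M_lap1_cvg0 PJ.
Qed.

End sigma.

(** * Generating functions of the queue *)

Section queue.
Context d {Omega : measurableType d} {R : realType} (P : probability Omega R).
Variable Q : retrial_queue P.
Variables (Iser Rque Rorb : {RV P >-> nat}) (X : {RV P >-> R}).
Hypothesis hstat : stationary Q Iser Rque Rorb X.
Hypothesis hrho : total_load Q < 1.
Implicit Types (c : customer) (i k : nat) (s t : R).

Notation l1 := (rate Q Type1).
Notation l2 := (rate Q Type2).
Notation mu := (retrial_rate Q).
Notation phi := (phi Q).
Notation on_server := (on_server Iser).

Definition service_dens c := dens (rccdf (service Q c)).

Lemma density_service c : density (rccdf (service Q c)).
Proof. by apply: density_rccdf; [exact: service_cdf0|exact: service_integrable]. Qed.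

Lemma pos_service c : positive_functional (service_dens c).
Proof. exact/positive_dens/density_service. Qed.

Lemma mean_service_ge0 c : 0 <= service_dens c (fun=> 1).
Proof. by apply: (pf_ge0 (pos_service c)) => //; exact: admissible_cst. Qed.

Lemma loadE c : load Q c = rate Q c * service_dens c (fun=> 1).
Proof. by rewrite /load /service_dens (dens_rccdf1 (service_cdf0 Q c)). Qed.

Lemma load_ge0 c : 0 <= load Q c.
Proof. by rewrite loadE mulr_ge0 ?(ltW (rate_gt0 Q c)) ?mean_service_ge0. Qed.

Lemma load1_lt1 : load Q Type1 < 1.
Proof. by apply: le_lt_trans hrho; rewrite /total_load lerDl load_ge0. Qed.

Lemma phi_ge0 c s : 0 < s -> 0 <= phi c s.
Proof. by move=> s0; exact: (lap_ge0 (pos_service c) 0 s0). Qed.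

Lemma rate_phi_le c s : 0 < s -> rate Q c * phi c s <= load Q c.
Proof.
by move=> s0; rewrite loadE ler_wpM2l ?(ltW (rate_gt0 Q c))// (lap0_le (pos_service c)).
Qed.

Lemma M_phi_le1 c s : 0 < s -> s * phi c s <= 1.
Proof.
move=> s0; have := expectation_affine_exp (service_cdf0 Q c) 0 1 s0.
rewrite -/(phi c s) add0r mul1r => H; rewrite -subr_ge0 -H fine_ge0//.
by apply: expectation_ge0 => om; rewrite add0r mul1r expR_ge0.
Qed.

Lemma cvg_phi0 c : phi c s @[s --> 0^'+] --> service_dens c (fun=> 1).
Proof. exact: (lap_cvg0 (pos_service c)). Qed.

Lemma cvg_phi c s : 0 < s -> phi c x @[x --> s] --> phi c s.
Proof.
move=> s0; have [/derivable1_diffP/differentiable_continuous + _] :=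
  is_derive_lap (pos_service c) 0 s0; exact.
Qed.

Definition count_fun (V : {RV P >-> nat}) i (g : R -> R) := on_server i (fun om => g (V om)%:R).

Let meas_nat (V : {RV P >-> nat}) (g : nat -> R) : measurable_fun setT (g \o V).
Proof. by apply: measurableT_comp. Qed.

Lemma pos_count V i : positive_functional (count_fun V i).
Proof.
apply: (@integral_functional _ _ _ P setT (fun om => (Iser om == i)%:R) (fun om => (V om)%:R)) => //.
- exact: (meas_nat V (fun n => n%:R)).
- have b1 : @bounded_mfun _ Omega R (fun=> 1) by split => //; exists 1 => om; rewrite normr1.
  by have := integrable_on_server Iser i b1; under eq_fun do rewrite mulr1.
Qed.

Lemma on_server_ind i (A : set Omega) : measurable A ->
  on_server i \1_A = fine (P (A `&` [set om | Iser om = i])).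
Proof.
move=> mA; rewrite /on_server /Rintegral.
have mi : measurable [set om | Iser om = i].
  rewrite (_ : mkset _ = setT `&` Iser @^-1` [set i]); last by rewrite setTI.
  exact: measurable_funPT.
have mAi : measurable (A `&` [set om | Iser om = i]) by exact: measurableI.
rewrite -[A `&` _]setIT -integral_indic//.
congr fine; apply: eq_integral => om _; congr EFin; rewrite !indicE in_setI mulrC.
rewrite -natrM mulnb; congr ((nat_of_bool (_ && _))%:R).
by apply/eqP/idP => [|/set_mem//]; exact: mem_set.
Qed.

Lemma count_fun1 V i : count_fun V i (fun=> 1) = fine (P [set om | Iser om = i]).
Proof.
rewrite -[X in P X]setTI -on_server_ind//; congr on_server.
by apply/funext => om; rewrite indicT.
Qed.

Lemma ftail_count V i (j : nat) : ftail (count_fun V i) j%:R =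
  fine (P ([set om | (j < V om)%N] `&` [set om | Iser om = i])).
Proof.
rewrite -on_server_ind; last first.
  rewrite (_ : mkset _ = setT `&` V @^-1` [set n | (j < n)%N]); last by rewrite setTI.
  exact: measurable_funPT.
rewrite /ftail /count_fun; congr on_server; apply/funext => om.
rewrite indicE ltr_nat; congr ((nat_of_bool _)%:R).
by apply/idP/idP => [|/set_mem//]; exact: mem_set.
Qed.

Lemma balance_at (z t s u : R) (A B : customer -> R) : 0 <= z <= 1 -> 0 < t ->
  s = l1 * (1 - z) + l2 * (1 - expR (- t)) -> (forall c, A c + B c = u) ->
  A Type1 + B Type1 * (1 - s * phi Type1 s) = z * u ->
  (l1 * (z - 1) * u + l2 * (A Type2 + B Type2 * (1 - s * phi Type2 s) - u)) *
    lap (count_fun Rorb 0) 0 t +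
  mu * ((A Type2 + B Type2 * (1 - s * phi Type2 s)) / expR (- t) - u) *
    lap (count_fun Rorb 0) 1 t =
  s * A Type1 * on_server 1 (fun om => z ^+ Rque om * expR (- (t * (Rorb om)%:R))) +
  s * A Type2 * on_server 2 (fun om => z ^+ Rque om * expR (- (t * (Rorb om)%:R))).
Proof.
move=> z01 t0 -> ABu zu; have := balance hstat z01 t0 ABu zu.
have -> : on_server 0 (fun om => expR (- (t * (Rorb om)%:R))) = lap (count_fun Rorb 0) 0 t.
  by congr on_server; apply/funext => om; rewrite expr0 mul1r.
by have -> : on_server 0 (fun om => (Rorb om)%:R * expR (- (t * (Rorb om)%:R))) =
  lap (count_fun Rorb 0) 1 t by [].
Qed.

Definition sig := sigma (service_dens Type1) l1 l2.
(** At s = [sig t], s [Kf t] = l2 (beta_2(s) - e^(-t)): the classical denominator beta_2(lambda -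
    lambda g(z)) - z freed from its zero at z = 1. *)
Definition Kf t := 1 - l1 * phi Type1 (sig t) - l2 * phi Type2 (sig t).
Definition p0 := lap (count_fun Rorb 0) 0.
Definition p1 := lap (count_fun Rorb 0) 1.
Definition theta t := l2 * (1 - expR (- t)).

Let rho1_lt1 : l1 * service_dens Type1 (fun=> 1) < 1.
Proof. by rewrite -loadE load1_lt1. Qed.

Lemma sig_gt0 t : 0 < t -> 0 < sig t.
Proof. exact: (sigma_gt0 (pos_service Type1) (rate_gt0 Q _) rho1_lt1 (rate_gt0 Q _)). Qed.

Lemma sig_eq t : 0 < t -> sig t * (1 - l1 * phi Type1 (sig t)) = theta t.
Proof. exact: (psi_sigma (pos_service Type1) (rate_gt0 Q _) rho1_lt1 (rate_gt0 Q _)). Qed.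

Lemma Kf_ge t : 0 < t -> 1 - total_load Q <= Kf t.
Proof.
move=> t0; have s0 := sig_gt0 t0; have h1 := rate_phi_le Type1 s0; have h2 := rate_phi_le Type2 s0.
by rewrite /Kf /total_load; lra.
Qed.

Lemma Kf_gt0 t : 0 < t -> 0 < Kf t.
Proof. by move=> /Kf_ge; apply: lt_le_trans; rewrite subr_gt0. Qed.

(** A = 0 erases the busy states, and the boundary condition then forces z = beta_1(s), that is s =
    [sig t]. Since the derivative of [p0] is - [p1], this is the differential equation behind the
    exponential formula for R_0; it is used in this form, not integrated. *)
Lemma p1E t : 0 < t -> mu * p1 t = l2 * expR (- t) * (1 - Kf t) / Kf t * p0 t.
Proof.
move=> t0; have s0 := sig_gt0 t0; have K0 := Kf_gt0 t0; have e := sig_eq t0.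
have e0 := expR_gt0 (- t); set s := sig t in s0 e.
have z01 : 0 <= 1 - s * phi Type1 s <= 1.
  by rewrite subr_ge0 M_phi_le1//= lerBlDr lerDl mulr_ge0 ?(ltW s0) ?phi_ge0.
have := @balance_at (1 - s * phi Type1 s) t s 1 (fun=> 0) (fun=> 1) z01 t0.
rewrite !add0r !mul1r !mulr1 !mulr0 !mul0r addr0 -/(p0 t) -/(p1 t) => H.
have {H} := H _ (fun=> erefl) erefl; move=> H.
have {}H : (l1 * (1 - s * phi Type1 s - 1) + l2 * (1 - s * phi Type2 s - 1)) * p0 t +
    mu * ((1 - s * phi Type2 s) / expR (- t) - 1) * p1 t = 0.
  by apply: H; rewrite -/(theta t) -e; ring.
have E : l2 * (1 - s * phi Type2 s - expR (- t)) = s * Kf t.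
  rewrite /Kf -/s; transitivity (theta t - l2 * s * phi Type2 s); first by rewrite /theta; ring.
  by rewrite -e; ring.
have E2 : l2 * expR (- t) * (mu * ((1 - s * phi Type2 s) / expR (- t) - 1) * p1 t) =
    mu * p1 t * (s * Kf t).
  by rewrite -E; field; rewrite gt_eqF.
have E3 : (l1 * (1 - s * phi Type1 s - 1) + l2 * (1 - s * phi Type2 s - 1)) = - s * (1 - Kf t).
  by rewrite /Kf -/s; ring.
rewrite E3 in H.
have H4 : mu * p1 t * (s * Kf t) = l2 * expR (- t) * (s * (1 - Kf t)) * p0 t.
  by rewrite -E2; move/(congr1 (fun v => l2 * expR (- t) * v)): H; rewrite mulr0; lra.
apply: (@mulIf _ (s * Kf t)); first by rewrite mulf_neq0// gt_eqF.
by rewrite H4; field; rewrite gt_eqF.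
Qed.

Definition by_type (x y : R) c := if c is Type1 then x else y.

(** The left side is the rate at which Type-2 services begin, by an arrival or by a retrial,
    weighted by e^(-t k) for k customers left in the orbit. *)
Lemma total_p1E (t : R) (t0 : 0 < t) : l2 * p0 t + mu * p1 t / expR (- t) = l2 * (p0 t / Kf t).
Proof.
have K0 := Kf_gt0 t0; have e0 := expR_gt0 (- t).
by rewrite (p1E t0); field; rewrite !gt_eqF.
Qed.

Lemma theta_gt0 t : 0 < t -> 0 < theta t.
Proof. exact/eps_gt0/rate_gt0. Qed.

(** u = 0 and vanishing Type-1 coefficients isolate the Type-2 states; 1 / s normalizes. *)
Lemma gf_busy2 (z t s : R) : 0 <= z <= 1 -> 0 < t ->
  s = l1 * (1 - z) + l2 * (1 - expR (- t)) -> 0 < s ->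
  on_server 2 (fun om => z ^+ Rque om * expR (- (t * (Rorb om)%:R))) =
  l2 * phi Type2 s * (p0 t / Kf t).
Proof.
move=> z01 t0 sE s0; have sn := gt_eqF s0.
have /= := @balance_at z t s 0 (by_type 0 (- s^-1)) (by_type 0 s^-1) z01 t0 sE.
rewrite /by_type => H; have {}H := H _ _.
have {}H : (l1 * (z - 1) * 0 + l2 * (- s^-1 + s^-1 * (1 - s * phi Type2 s) - 0)) * p0 t +
  mu * ((- s^-1 + s^-1 * (1 - s * phi Type2 s)) / expR (- t) - 0) * p1 t =
  s * 0 * on_server 1 (fun om => z ^+ Rque om * expR (- (t * (Rorb om)%:R))) +
  s * (- s^-1) * on_server 2 (fun om => z ^+ Rque om * expR (- (t * (Rorb om)%:R))).
  by apply: H; [case; rewrite ?addr0 ?addNr|rewrite !mul0r !mulr0 addr0].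
rewrite mulrAC -(total_p1E t0).
have E : - s^-1 + s^-1 * (1 - s * phi Type2 s) = - phi Type2 s by field; rewrite sn.
rewrite E mulrN divff ?sn// in H.
have e0 := expR_gt0 (- t); lra.
Qed.

(** With z = 1 the queue is not counted and a constant meets the Type-1 boundary condition;
    [A Type2] = 0 erases the other busy states. *)
Lemma gf_orbit_busy1 (t : R) : 0 < t ->
  lap (count_fun Rorb 1) 0 t = (1 - Kf t - l2 * phi Type2 (theta t)) * (p0 t / Kf t).
Proof.
move=> t0; have s0 := theta_gt0 t0; have sn := gt_eqF s0.
have K0 := Kf_gt0 t0; have e0 := expR_gt0 (- t); have L0 := rate_gt0 Q Type2.
have z01 : 0 <= (1 : R) <= 1 by rewrite ler01 lexx.
have /= := @balance_at 1 t (theta t) (- (theta t)^-1)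
  (by_type (- (theta t)^-1) 0) (by_type 0 (- (theta t)^-1)) z01 t0.
rewrite /by_type subrr mulr0 add0r => H; have {}H := H erefl _ _.
have {}H : (0 * - (theta t)^-1 + l2 * (0 + - (theta t)^-1 * (1 - theta t * phi Type2 (theta t))
    - - (theta t)^-1)) * p0 t + mu * ((0 + - (theta t)^-1 * (1 - theta t * phi Type2 (theta t))) /
    expR (- t) - - (theta t)^-1) * p1 t = theta t * (- (theta t)^-1) * on_server 1
      (fun om => 1 ^+ Rque om * expR (- (t * (Rorb om)%:R))) + theta t * 0 * on_server 2
      (fun om => 1 ^+ Rque om * expR (- (t * (Rorb om)%:R))).
  by apply: H; [case; rewrite ?addr0 ?add0r|rewrite mul0r mul1r addr0].
have -> : lap (count_fun Rorb 1) 0 t =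
    on_server 1 (fun om => 1 ^+ Rque om * expR (- (t * (Rorb om)%:R))).
  by congr on_server; apply/funext => om; rewrite expr0 expr1n.
have E0 (E1 E2 : R) : theta t * - (theta t)^-1 * E1 + theta t * 0 * E2 = - E1 by field; rewrite sn.
rewrite E0 in H.
have E1 : 0 + - (theta t)^-1 * (1 - theta t * phi Type2 (theta t)) =
    phi Type2 (theta t) - (theta t)^-1 by field; rewrite sn.
rewrite E1 in H.
have E2 : mu * ((phi Type2 (theta t) - (theta t)^-1) / expR (- t) - - (theta t)^-1) * p1 t =
    (phi Type2 (theta t) - l2^-1) * (mu * p1 t / expR (- t)).
  rewrite [in X in X * _ = _]/theta; rewrite /theta in sn *.
  field.
  by rewrite !gt_eqF//= subr_gt0 expR_lt1 oppr_lt0.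
rewrite E2 (p1E t0) in H.
rewrite -[LHS]opprK -H; field; rewrite !gt_eqF//.
Qed.

Lemma gf_orbit_busy2 (t : R) : 0 < t ->
  lap (count_fun Rorb 2) 0 t = l2 * phi Type2 (theta t) * (p0 t / Kf t).
Proof.
move=> t0; rewrite -(@gf_busy2 1 t (theta t))//; last 3 first.
- by rewrite ler01 lexx.
- by rewrite subrr mulr0 add0r.
- exact: theta_gt0.
by congr on_server; apply/funext => om; rewrite expr0 expr1n.
Qed.

(** Identifies [p0 t / Kf t] as the generating function of the orbit whatever the server does. Its
    limit 1 at t = 0 fixes the probability that the server is idle. *)
Lemma gf_orbit_idle (t : R) : 0 < t ->
  p0 t + lap (count_fun Rorb 1) 0 t + lap (count_fun Rorb 2) 0 t = p0 t / Kf t.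
Proof.
move=> t0; rewrite gf_orbit_busy1// gf_orbit_busy2//.
by have K0 := Kf_gt0 t0; field; rewrite gt_eqF.
Qed.

(** The Type-1 coefficients solve A + B = phi_1(s) and A + B beta_1(s) = z phi_1(s), and [A Type2] =
    0 removes the Type-2 states. *)
Lemma gf_busy1 (z t s : R) : 0 <= z <= 1 -> 0 < t ->
  s = l1 * (1 - z) + l2 * (1 - expR (- t)) -> 0 < s ->
  (1 - s * phi Type1 s - z) *
    on_server 1 (fun om => z ^+ Rque om * expR (- (t * (Rorb om)%:R))) =
  phi Type1 s * ((l1 * (1 - z) + l2 * (s * phi Type2 s)) * p0 t +
    mu * p1 t * (1 - (1 - s * phi Type2 s) / expR (- t))).
Proof.
move=> z01 t0 sE s0; have sn := gt_eqF s0; have e0 := expR_gt0 (- t).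
have /= := @balance_at z t s (phi Type1 s) (by_type (- (1 - s * phi Type1 s - z) / s) 0)
   (by_type ((1 - z) / s) (phi Type1 s)) z01 t0 sE.
rewrite /by_type mulr0 mul0r addr0 => H; have {}H := H _ _.
set E1 := on_server 1 _ in H *.
have {}H : (l1 * (z - 1) * phi Type1 s + l2 * (0 + phi Type1 s * (1 - s * phi Type2 s) - phi Type1 s)) * p0 t +
    mu * ((0 + phi Type1 s * (1 - s * phi Type2 s)) / expR (- t) - phi Type1 s) * p1 t =
    s * (- (1 - s * phi Type1 s - z) / s) * E1.
  by apply: H; [case; [field; rewrite sn|rewrite add0r]|field; rewrite sn].
have E : s * (- (1 - s * phi Type1 s - z) / s) * E1 = - ((1 - s * phi Type1 s - z) * E1).
  by field; rewrite sn.
rewrite E in H; rewrite -[LHS]opprK -H; field; rewrite gt_eqF//.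
Qed.

End queue.

Lemma cvg0r_unique (R : realType) (f : R -> R) (a b : R) :
  f s @[s --> 0^'+] --> a -> f s @[s --> 0^'+] --> b -> a = b.
Proof. by move=> fa fb; rewrite -(cvg_lim _ fa)// (cvg_lim _ fb). Qed.

(** * Server probabilities and the law of the queue, as the orbit variable tends to 0 *)

Section queue_limits.
Context d {Omega : measurableType d} {R : realType} (P : probability Omega R).
Variable Q : retrial_queue P.
Variables (Iser Rque Rorb : {RV P >-> nat}) (X : {RV P >-> R}).
Hypothesis hstat : stationary Q Iser Rque Rorb X.
Hypothesis hrho : total_load Q < 1.
Implicit Types (c : customer) (i k : nat) (s t : R).

Notation l1 := (rate Q Type1).
Notation l2 := (rate Q Type2).
Notation mu := (retrial_rate Q).
Notation phi := (phi Q).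
Notation on_server := (on_server Iser).
Notation count_fun := (count_fun Iser).
Notation p0 := (p0 Iser Rorb).
Notation p1 := (p1 Iser Rorb).
Notation Kf := (Kf Q).
Notation theta := (theta Q).
Notation sig := (sig Q).
Notation rho := (total_load Q).

Let rho1_lt1 : l1 * service_dens Q Type1 (fun=> 1) < 1.
Proof. by rewrite -loadE load1_lt1. Qed.

Lemma asymp_linear_sig : asymp_linear sig (l2 / (1 - load Q Type1)).
Proof.
rewrite loadE; exact: (asymp_linear_sigma (pos_service Q Type1) (rate_gt0 Q _) rho1_lt1 (rate_gt0 Q _)).
Qed.

Lemma cvg_rate_phi c (u : R -> R) b : asymp_linear u b ->
  rate Q c * phi c (u t) @[t --> 0^'+] --> load Q c.
Proof.
move=> ub; rewrite loadE; apply: cvgM; first exact: cvg_cst.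
apply: (@cvg_comp _ _ _ u (phi c) _ (0 : R)^'+); first exact: asymp_linear_at_right ub.
exact: cvg_phi0.
Qed.

Lemma cvg_Kf : Kf t @[t --> 0^'+] --> 1 - rho.
Proof.
rewrite /total_load opprD addrA; apply: cvgB; last exact: cvg_rate_phi asymp_linear_sig.
by apply: cvgB; [exact: cvg_cst|exact: cvg_rate_phi asymp_linear_sig].
Qed.

Lemma prob_server : count_fun Rorb 0 (fun=> 1) + count_fun Rorb 1 (fun=> 1) +
  count_fun Rorb 2 (fun=> 1) = 1 :> R.
Proof.
have b1 : @bounded_mfun _ Omega R (fun=> 1) by split => //; exists 1 => om; rewrite normr1.
have i1 i := integrable_on_server Iser i b1.
rewrite /count_fun /on_server -!RintegralD//; last exact: (integrableD _ (i1 0) (i1 1)).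
transitivity (\int[P]_om (1 : R)); last by rewrite Rintegral_cst// mul1r; have /= := probability_setT P => ->.
apply: eq_Rintegral => om _; rewrite !mulr1.
have [I2 _ _ _] := hstat; have := I2 om; case: (Iser om) => [|[|[|//]]] _ /=; ring.
Qed.

Let tot t := p0 t / Kf t.

Lemma cvg_tot : tot t @[t --> 0^'+] --> (1 : R).
Proof.
have C i := lap_cvg0 (pos_count Iser Rorb i).
rewrite -prob_server; apply: eq_pos_cvg (cvgD (cvgD (C 0) (C 1)) (C 2)) => t t0.
exact: (gf_orbit_idle hstat hrho t0).
Qed.

Lemma cvg_p0 : p0 t @[t --> 0^'+] --> 1 - rho.
Proof.
rewrite -[X in _ --> X]mul1r; apply: eq_pos_cvg (cvgM cvg_tot cvg_Kf) => t t0.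
by rewrite /= /tot divfK// gt_eqF// Kf_gt0.
Qed.

Lemma cvg_expN : expR (- t) @[t --> 0^'+] --> (1 : R).
Proof.
rewrite -expR0; apply: (@cvg_comp _ _ _ -%R expR _ (nbhs (0 : R))); last exact: continuous_expR.
have : - t @[t --> (0 : R)^'+] --> - (0 : R) by apply: cvgN; exact: cvg_at_right_filter.
by rewrite oppr0.
Qed.

Lemma cvg_p1 : mu * p1 t @[t --> 0^'+] --> l2 * rho.
Proof.
have c1 : l2 * expR (- t) * (1 - Kf t) @[t --> 0^'+] --> l2 * 1 * (1 - (1 - rho)).
  apply: cvgM; first by apply: cvgM; [exact: cvg_cst|exact: cvg_expN].
  by apply: cvgB; [exact: cvg_cst|exact: cvg_Kf].
rewrite [X in _ --> X](_ : _ = l2 * 1 * (1 - (1 - rho)) * 1); last by ring.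
apply: eq_pos_cvg (cvgM c1 cvg_tot) => t t0.
by rewrite (p1E hstat hrho t0) /tot /=; ring.
Qed.

Lemma prob_busy2 V : count_fun V 2 (fun=> 1) = load Q Type2.
Proof.
have -> : count_fun V 2 (fun=> 1) = count_fun Rorb 2 (fun=> 1) by [].
apply: cvg0r_unique (lap_cvg0 (pos_count Iser Rorb 2)) _.
rewrite -[X in _ --> X]mulr1.
have c1 : l2 * phi Type2 (theta t) @[t --> 0^'+] --> load Q Type2.
  exact: cvg_rate_phi (asymp_linear_eps (rate_gt0 Q Type2)).
apply: eq_pos_cvg (cvgM c1 cvg_tot) => t t0.
by rewrite (gf_orbit_busy2 hstat hrho t0).
Qed.

Lemma prob_busy1 V : count_fun V 1 (fun=> 1) = load Q Type1.
Proof.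
have -> : count_fun V 1 (fun=> 1) = count_fun Rorb 1 (fun=> 1) by [].
apply: cvg0r_unique (lap_cvg0 (pos_count Iser Rorb 1)) _.
have cl : l2 * phi Type2 (theta t) @[t --> 0^'+] --> load Q Type2.
  exact: cvg_rate_phi (asymp_linear_eps (rate_gt0 Q Type2)).
rewrite [X in _ --> X](_ : _ = (1 - (1 - rho) - load Q Type2) * 1); last by rewrite /total_load; ring.
have c1 : 1 - Kf t - l2 * phi Type2 (theta t) @[t --> 0^'+] --> 1 - (1 - rho) - load Q Type2.
  by apply: cvgB => //; apply: cvgB; [exact: cvg_cst|exact: cvg_Kf].
apply: eq_pos_cvg (cvgM c1 cvg_tot) => t t0.
by rewrite (gf_orbit_busy1 hstat hrho t0).
Qed.


Lemma on_server_le i (f g : Omega -> R) : bounded_mfun f -> bounded_mfun g ->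
  (forall om, f om <= g om) -> on_server i f <= on_server i g.
Proof.
move=> bf bg fg; apply: le_Rintegral => //; try exact: integrable_on_server.
by move=> om _; rewrite ler_wpM2l.
Qed.

Lemma on_serverB i (f g : Omega -> R) : bounded_mfun f -> bounded_mfun g ->
  on_server i (fun om => f om - g om) = on_server i f - on_server i g.
Proof.
move=> bf bg; rewrite -RintegralB//; try exact: integrable_on_server.
by apply: eq_Rintegral => om _; rewrite mulrBr.
Qed.

Lemma bounded_mfun_nat (V : {RV P >-> nat}) (g : nat -> R) :
  (forall n, 0 <= g n <= 1) -> bounded_mfun (g \o V).
Proof.
move=> g01; split; first by apply: measurableT_comp.
by exists 1 => om; have /andP[h0 h1] := g01 (V om); rewrite /= ger0_norm.
Qed.

Lemma bounded_mfunM (f g : Omega -> R) : bounded_mfun f -> bounded_mfun g ->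
  bounded_mfun (fun om => f om * g om).
Proof.
move=> [mf [C fC]] [mg [D gD]]; split; first exact: measurable_funM.
by exists (C * D) => om; rewrite normrM ler_pM.
Qed.

Lemma bounded_mfunB (f g : Omega -> R) : bounded_mfun f -> bounded_mfun g ->
  bounded_mfun (fun om => f om - g om).
Proof.
move=> [mf [C fC]] [mg [D gD]]; split; first exact: measurable_funB.
by exists (C + D) => om; apply: le_trans (ler_normB _ _) _; rewrite lerD.
Qed.

(** The error z^m (1 - e^(-t n)) is at most 1 - e^(-t n), whose mean tends to 0 by [lap_cvg0] for
    the orbit. *)
Lemma cvg_joint i (z : R) : 0 <= z <= 1 ->
  on_server i (fun om => z ^+ Rque om * expR (- (t * (Rorb om)%:R))) @[t --> 0^'+] -->
  on_server i (fun om => z ^+ Rque om).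
Proof.
move=> /andP[z0 z1].
have zn01 n : 0 <= z ^+ n <= 1 by rewrite exprn_ge0//= exprn_ile1.
have bz : bounded_mfun (fun om => z ^+ Rque om) := bounded_mfun_nat Rque zn01.
have b1 : bounded_mfun (fun om : Omega => 1 : R) by split => //; exists 1 => om; rewrite normr1.
have e01 t (t0 : 0 < t) n : 0 <= expR (- (t * n%:R)) <= 1.
  by rewrite expR_ge0 -expR0 ler_expR oppr_le0 mulr_ge0 ?(ltW t0).
have be t (t0 : 0 < t) : bounded_mfun (fun om => expR (- (t * (Rorb om)%:R))) :=
  bounded_mfun_nat Rorb (e01 t t0).
have lo : on_server i (fun om => z ^+ Rque om) -
    (on_server i (fun=> 1) - lap (count_fun Rorb i) 0 t) @[t --> 0^'+] -->
    on_server i (fun om => z ^+ Rque om).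
  rewrite [X in _ --> X](_ : _ = on_server i (fun om => z ^+ Rque om) -
    (on_server i (fun=> 1) - on_server i (fun=> 1))); last by rewrite subrr subr0.
  apply: cvgB; first exact: cvg_cst.
  by apply: cvgB; [exact: cvg_cst|exact: lap_cvg0 (pos_count Iser Rorb i)].
apply: (squeeze_cvgr _ lo (cvg_cst _)); near=> t; have t0 : 0 < t by [].
have -> : lap (count_fun Rorb i) 0 t = on_server i (fun om => expR (- (t * (Rorb om)%:R))).
  by congr on_server; apply/funext => om; rewrite expr0 mul1r.
have bzt := bounded_mfunM bz (be t t0).
apply/andP; split; last first.
  apply: on_server_le => // om; have /andP[_ h] := e01 t t0 (Rorb om).
  by rewrite ler_piMr// exprn_ge0.
rewrite lerBlDr -lerBlDl -!on_serverB//; last exact: be.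
apply: on_server_le => [||om]; [exact: bounded_mfunB|exact: bounded_mfunB (be t t0)|].
have /andP[h0 h1] := e01 t t0 (Rorb om); have /andP[h2 h3] := zn01 (Rque om); nra.
Unshelve. all: end_near. Qed.

Let exp01 (t : R) : 0 < t -> 0 <= expR (- t) <= 1.
Proof. by move=> t0; rewrite expR_ge0/= -expR0 ler_expR oppr_le0 ltW. Qed.

Let lapE i (t : R) : lap (count_fun Rque i) 0 t = on_server i (fun om => expR (- t) ^+ Rque om).
Proof.
by congr on_server; apply/funext => om; rewrite expr0 mul1r -expRM_natr mulNr.
Qed.

Let arg (t tau : R) := l1 * (1 - expR (- t)) + l2 * (1 - expR (- tau)).

Let arg_gt0 t tau : 0 < t -> 0 < tau -> 0 < arg t tau.
Proof.
move=> t0 tau0; have := eps_gt0 (rate_gt0 Q Type1) t0; have := theta_gt0 Q tau0.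
rewrite /theta /eps /arg; lra.
Qed.

Let cvg_arg t : arg t tau @[tau --> 0^'+] --> eps l1 t.
Proof.
rewrite [X in _ --> X](_ : _ = l1 * (1 - expR (- t)) + l2 * (1 - 1)); last by rewrite subrr mulr0 addr0.
apply: cvgD; first exact: cvg_cst; apply: cvgM; first exact: cvg_cst.
by apply: cvgB; [exact: cvg_cst|exact: cvg_expN].
Qed.

Let cvg_phi_arg c t : 0 < t -> phi c (arg t tau) @[tau --> 0^'+] --> phi c (eps l1 t).
Proof.
move=> t0; apply: (@cvg_comp _ _ _ (arg t) (phi c) _ (nbhs (eps l1 t))); first exact: cvg_arg.
exact: cvg_phi (eps_gt0 (rate_gt0 Q Type1) t0).
Qed.

Lemma gf_queue_busy2 (t : R) : 0 < t ->
  lap (count_fun Rque 2) 0 t = l2 * phi Type2 (eps l1 t).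
Proof.
move=> t0; rewrite lapE; have cj := @cvg_joint 2 _ (exp01 t0).
apply: cvg0r_unique cj _.
rewrite -[X in _ --> X]mulr1.
have c1 : l2 * phi Type2 (arg t tau) @[tau --> 0^'+] --> l2 * phi Type2 (eps l1 t).
  by apply: cvgM; [exact: cvg_cst|exact: cvg_phi_arg].
apply: eq_pos_cvg (cvgM c1 cvg_tot) => tau tau0.
by rewrite (gf_busy2 hstat hrho (exp01 t0) tau0 erefl (arg_gt0 t0 tau0)).
Qed.

Lemma gf_queue_busy1 (t : R) : 0 < t ->
  (1 - l1 * phi Type1 (eps l1 t)) * lap (count_fun Rque 1) 0 t =
  l1 * phi Type1 (eps l1 t) * (1 - rho + l2 * phi Type2 (eps l1 t)).
Proof.
move=> t0; rewrite lapE; have z01 := exp01 t0.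
have s0 := eps_gt0 (rate_gt0 Q Type1) t0; set s := eps l1 t in s0 *; set z := expR (- t) in z01 *.
have E : (1 - s * phi Type1 s - z) * on_server 1 (fun om => z ^+ Rque om) =
    phi Type1 s * ((l1 * (1 - z) + l2 * (s * phi Type2 s)) * (1 - rho) +
      l2 * rho * (1 - (1 - s * phi Type2 s) / 1)).
  have ca : arg t tau @[tau --> 0^'+] --> s := @cvg_arg t.
  have cp c : phi c (arg t tau) @[tau --> 0^'+] --> phi c s := @cvg_phi_arg c t t0.
  have cap c : arg t tau * phi c (arg t tau) @[tau --> 0^'+] --> s * phi c s by exact: cvgM.
  have cj := @cvg_joint 1 _ z01.
  have L : (1 - arg t tau * phi Type1 (arg t tau) - z) *
      on_server 1 (fun om => z ^+ Rque om * expR (- (tau * (Rorb om)%:R))) @[tau --> 0^'+] -->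
      (1 - s * phi Type1 s - z) * on_server 1 (fun om => z ^+ Rque om).
    apply: cvgM => //; apply: cvgB; last exact: cvg_cst.
    by apply: cvgB; [exact: cvg_cst|exact: cap].
  apply: cvg0r_unique L _.
  have L2 : phi Type1 (arg t tau) * ((l1 * (1 - z) + l2 * (arg t tau * phi Type2 (arg t tau))) * p0 tau +
      mu * p1 tau * (1 - (1 - arg t tau * phi Type2 (arg t tau)) / expR (- tau))) @[tau --> 0^'+] -->
      phi Type1 s * ((l1 * (1 - z) + l2 * (s * phi Type2 s)) * (1 - rho) +
      l2 * rho * (1 - (1 - s * phi Type2 s) / 1)).
    apply: cvgM; first exact: cp.
    apply: cvgD.
      apply: cvgM; last exact: cvg_p0.
      apply: cvgD; first exact: cvg_cst.
      by apply: cvgM; [exact: cvg_cst|exact: cap].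
    apply: cvgM; first exact: cvg_p1.
    apply: cvgB; first exact: cvg_cst.
    apply: cvgM; last by apply: cvgV; [exact: oner_neq0|exact: cvg_expN].
    by apply: cvgB; [exact: cvg_cst|exact: cap].
  apply: eq_pos_cvg L2 => tau tau0.
  by rewrite (gf_busy1 hstat z01 tau0 erefl (arg_gt0 t0 tau0)).
have L0 := rate_gt0 Q Type1.
have zE : 1 - z = s / l1 by rewrite /s /eps -/z; field; rewrite gt_eqF.
have zE' : 1 - s * phi Type1 s - z = s / l1 * (1 - l1 * phi Type1 s).
  by rewrite addrAC zE; field; rewrite gt_eqF.
rewrite zE' zE in E.
apply: (@mulfI _ (s / l1)); first by rewrite mulf_neq0 ?invr_eq0 ?gt_eqF.
by rewrite mulrA E; field; rewrite gt_eqF.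
Qed.

End queue_limits.

(** * Heavy-tailed asymptotics *)

Section asymptotic_class.
Context {R : realType}.
Variables (F : R -> R) (a : R) (n : nat).
Hypotheses (dF : density F) (Fdec : forall x y, x <= y -> F y <= F x).
(** The order floor(a) is written as a successor, which a > 1 permits, to meet the form of
    [top_derivM]. *)
Hypotheses (rvF : regularly_varying (- a) F) (a1 : 1 < a) (na : n.+1%:R <= a < n.+2%:R).
Let J := dens F.
Let PJ := positive_dens dF.
Notation Phi := (lap (dens F) n.+1).
Notation S := ((-1) ^+ n.+1).
Let PL := Phi_large dF Fdec rvF na.
Let P0 s (s0 : 0 < s) := lap_gt0 dF Fdec rvF n.+1 s0.

Lemma top_deriv_lap0 : top_deriv Phi n.+1 S (lap J 0).
Proof.
apply: (@eq_top_deriv _ _ _ _ (fun s => 1 * lap J 0 s)); first by move=> s _; rewrite mul1r.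
rewrite -[S]mulr1 -[S * 1]mulr1; apply: (lap_top_deriv PJ).
  by move=> i; rewrite addn0 => /andP[_ h]; exact: (subpoly_lap dF rvF na).
rewrite addn0; apply: eq_pos_cvg (cvg_cst _) => s s0.
by rewrite divff// gt_eqF// P0.
Qed.

Lemma ftail_of_top_deriv (Jn : (R -> R) -> R) c : positive_functional Jn -> 0 < c ->
  top_deriv Phi n.+1 (S * c) (lap Jn 0) ->
  ftail Jn x / (x * F x) @[x --> pinfty_nbhs R] --> c / (a - 1).
Proof.
move=> PJn c0 top; have [C C0 PhiC] := lap_le_ftail dF Fdec rvF na.
have am : 0 < a - 1 by rewrite subr_gt0.
have rvT : regularly_varying (- (a - 1)) (ftail (dens F)).
  by rewrite opprB; exact: regularly_varying_ftail.
have H := tail_of_top_deriv PJ PJn am c0 C0 rvT P0 PL PhiC top_deriv_lap0 top.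
have K := karamata_tail dF Fdec rvF.
have K' : (x * F x / ftail (dens F) x)^-1 @[x --> pinfty_nbhs R] --> (a - 1)^-1.
  by apply: cvgV => //; rewrite gt_eqF.
have HK : ftail Jn x / ftail (dens F) x * (x * F x / ftail (dens F) x)^-1 @[x --> pinfty_nbhs R] -->
    c * (a - 1)^-1 by exact: cvgM.
apply: cvg_trans HK; apply: near_eq_cvg.
near=> x; have x0 : 0 < x by near: x; exact: nbhs_pinfty_gt.
have T0 := ftail_dens_gt0 dF Fdec rvF x0.
have F0 := rvF.1 x x0; field; rewrite !gt_eqF//.
Unshelve. all: end_near. Qed.

Section negligible.
Variable G : R -> R.
Hypothesis dG : density G.
Hypothesis G_small : forall d, 0 < d -> exists2 x0, 0 <= x0 & forall y, x0 < y -> G y <= d * F y.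

(** By [dens_lap_cmp], the transforms of G are dominated by those of F up to constants, with an
    arbitrarily small factor at the order where [Phi] diverges. *)
Lemma top_deriv_negligible : top_deriv Phi n.+1 0 (lap (dens G) 0).
Proof.
have PG := positive_dens dG.
apply: (@eq_top_deriv _ _ _ _ (fun s => 1 * lap (dens G) 0 s)); first by move=> s _; rewrite mul1r.
rewrite -[0](mulr0 (S * 1)); apply: (lap_top_deriv PG).
  move=> i; rewrite addn0 => /andP[_ h].
  have [x0 x00 Gx] := G_small ltr01.
  have ub : subpoly (fun s => x0 ^+ i * dens G (fun=> 1) + 1 * lap (dens F) i s).
    apply: subpolyD; first exact: (cvg_subpoly (cvg_cst _)).
    apply: subpolyM; first exact: (cvg_subpoly (cvg_cst _)).
    exact: (subpoly_lap dF rvF na).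
  move=> e e0; apply: (squeeze_cvgr _ (cvg_cst 0) (ub e e0)); near=> s.
  have s0 : 0 < s by [].
  rewrite mulr_ge0 ?powR_ge0 ?(lap_ge0 PG)//= ler_wpM2l ?powR_ge0//.
  exact: (dens_lap_cmp i dG dF ler01 x00 s0 Gx).
rewrite addn0; apply/cvgrPdist_le => e e0.
have e2 : 0 < e / 2 by rewrite divr_gt0.
have [x0 x00 Gx] := G_small e2.
pose D := x0 ^+ n.+1 * dens G (fun=> 1) + 1.
have G1 : 0 <= dens G (fun=> 1) by apply: (pf_ge0 PG) => //; exact: admissible_cst.
have D0 : 0 < D by rewrite ltr_wpDl// mulr_ge0 ?exprn_ge0.
have De : 0 < D / (e / 2) by rewrite divr_gt0.
have B := Phi_near_ge dF Fdec rvF na De.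
have nz : \forall s \near (0 : R)^'+, 0 < s by exact: nbhs_right_gt.
apply: filterS (filterI B nz) => s [Bs s0].
rewrite sub0r normrN ger0_norm ?divr_ge0 ?(lap_ge0 PG) ?(ltW (P0 s0))//.
rewrite ler_pdivrMr ?P0//.
apply: le_trans (dens_lap_cmp n.+1 dG dF (ltW e2) x00 s0 Gx) _.
rewrite ler_pdivrMr// in Bs; move: Bs; rewrite /D; set p := lap (dens F) n.+1 s; lra.
Unshelve. all: end_near. Qed.

End negligible.

(** [top_deriv_comp] at order n + 1 with b = n + 2 - a, whence the exponent a - 1; [eps] solves u' =
    l - u. *)
Lemma top_deriv_eps (l c : R) f : 0 < l -> top_deriv Phi n.+1 c f ->
  top_deriv Phi n.+1 (c * l `^ (a - 1)) (fun t => f (eps l t)).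
Proof.
move=> l0 fc.
rewrite (_ : a - 1 = n.+1%:R - (n.+2%:R - a)); last by rewrite -[n.+2%:R]natr1; ring.
apply: (@top_deriv_comp _ _ P0 PL _ f (eps l) (fun s => l - s)) => //.
- exact: asymp_linear_eps.
- exact: (Phi_asymp dF Fdec rvF na l0 (asymp_linear_eps l0)).
- by move=> t _; exact: is_derive_eps.
- rewrite -[X in _ --> X]subr0; apply: cvgB; first exact: cvg_cst.
  exact: cvg_at_right_filter.
- apply: subpoly_derivsD; first exact: subpoly_derivs_cst.
  exact/subpoly_derivsN/subpoly_derivs_id.
Qed.

Lemma subpoly_derivs_lap k j : (j + k < n.+1)%N -> subpoly_derivs k (lap J j).
Proof.
elim: k j => [|k IH] j h; first by split => //; apply: (subpoly_lap dF rvF na); rewrite addn0 in h.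
split; first by apply: (subpoly_lap dF rvF na); apply: leq_ltn_trans h; rewrite leq_addr.
exists (fun s => - lap J j.+1 s); first by move=> s s0; exact: (is_derive_lap PJ).
by apply: subpoly_derivsN; apply: IH; rewrite addSnnS.
Qed.

(** The factor s survives in one term of each derivative and buys one more order than
    [subpoly_derivs_lap] allows. The derivative of [psi] contains s [lap J 1 s], so this is what
    makes [chi] smooth enough. *)
Lemma subpoly_derivs_M_lap k j : (0 < j)%N -> (j + k <= n.+1)%N ->
  subpoly_derivs k (fun s => s * lap J j s).
Proof.
elim: k j => [|k IH] j j0 h.
  by split => //; apply: (subpoly_M_lap dF rvF na) => //; rewrite addn0 in h.
split.
  by apply: (subpoly_M_lap dF rvF na) => //; apply: leq_trans h; rewrite leq_addr.
exists (fun s => lap J j s - s * lap J j.+1 s).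
  move=> s s0; apply: (is_derive_eq (real_deriveM (is_derive_id s (1 : R)) (is_derive_lap PJ j s0))).
  by rewrite mul1r mulrN.
apply: subpoly_derivsD; first by apply: subpoly_derivs_lap; rewrite -addnS.
by apply: subpoly_derivsN; apply: IH => //; rewrite addSnnS.
Qed.

Section sigma_composition.
Variables (l l2 : R).
Hypotheses (l0 : 0 < l) (rho1 : l * J (fun=> 1) < 1) (l20 : 0 < l2).
Let k0 : 0 < l2 / (1 - l * J (fun=> 1)). Proof. by rewrite divr_gt0// subr_gt0. Qed.

Lemma subpoly_derivs_chi : subpoly_derivs n (chi J l l2).
Proof.
have L0 : subpoly_derivs n (lap J 0) by apply: subpoly_derivs_lap.
have L1 : subpoly_derivs n (fun s => s * lap J 1 s) by apply: subpoly_derivs_M_lap.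
apply: subpoly_derivsM.
  apply: subpoly_derivsD; first exact: subpoly_derivs_cst.
  apply: subpoly_derivsN; apply: subpoly_derivsM; first exact: subpoly_derivs_id.
  apply: subpoly_derivsD; first exact: subpoly_derivs_cst.
  exact/subpoly_derivsN/subpoly_derivsZ.
apply: (@subpoly_derivsV _ _ _ (1 - l * J (fun=> 1))); first by rewrite subr_gt0.
  by move=> s s0; exact: (dpsi_ge PJ).
apply: subpoly_derivsD; first exact: subpoly_derivs_cst.
apply/subpoly_derivsN/subpoly_derivsZ; apply: subpoly_derivsD => //.
exact: subpoly_derivsN.
Qed.

Lemma top_deriv_sigma c f : top_deriv Phi n.+1 c f ->
  top_deriv Phi n.+1 (c * (l2 / (1 - l * J (fun=> 1))) `^ (a - 1)) (fun t => f (sigma J l l2 t)).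
Proof.
move=> fc; have al := asymp_linear_sigma PJ l0 rho1 l20.
rewrite (_ : a - 1 = n.+1%:R - (n.+2%:R - a)); last by rewrite -[n.+2%:R]natr1; ring.
apply: (@top_deriv_comp _ _ P0 PL _ f (sigma J l l2) (chi J l l2)) => //.
- exact: (Phi_asymp dF Fdec rvF na k0 al).
- by move=> t t0; exact: (is_derive_sigma PJ l0 rho1 l20 t0).
- exact: (chi_cvg PJ).
- exact: subpoly_derivs_chi.
Qed.

End sigma_composition.
End asymptotic_class.

(** * From equivalents with a slowly varying factor to regular variation, and back *)

Section heavy_tail.
Context {R : realType}.
Variables (F L : R -> R) (a : R).
Hypotheses (F0 : forall x, 0 <= F x) (Fdec : forall x y, x <= y -> F y <= F x).
Hypotheses (hL : slowly_varying L)
  (hF : equivalent_at (pinfty_nbhs R) F (fun t => t `^ (- a) * L t)).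

Lemma cvg_scaley (h : R -> R) (q l : R) : 0 < q -> h x @[x --> pinfty_nbhs R] --> l ->
  h (q * x) @[x --> pinfty_nbhs R] --> l.
Proof.
move=> q0 hl A /hl [M [Mr MA]]; exists (q^-1 * M); split; first exact: num_real.
by move=> x; rewrite ltr_pdivrMl// => /MA.
Qed.

Let Lgt0 t : 0 < t -> 0 < L t. Proof. by have [_ + _] := hL; exact. Qed.

Lemma regularly_varying_of_equiv : regularly_varying (- a) F.
Proof.
have hn : \forall x \near pinfty_nbhs R, 2^-1 <= F x / (x `^ (- a) * L x).
  by apply: (cvgr_ge _ hF); lra.
(* F is nonincreasing and nonzero arbitrarily far, a zero value making the quotient in [hn]
   vanish. *)
have Fpos x : 0 < F x.
  near (pinfty_nbhs R) => y; have y0 : 0 < y by near: y; exact: nbhs_pinfty_gt.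
  have xy : x <= y by near: y; exact: nbhs_pinfty_ge (num_real _).
  apply: lt_le_trans (Fdec xy).
  have : 2^-1 <= F y / (y `^ (- a) * L y) by near: y.
  rewrite lt0r F0 andbT; apply: contraTneq => ->; rewrite mul0r -ltNge; lra.
split=> [x _|q q0]; first exact: Fpos.
have [_ _ Lq] := hL; have {}Lq := Lq q q0.
have h1 := cvg_scaley q0 hF.
have h2 : (F x / (x `^ (- a) * L x))^-1 @[x --> pinfty_nbhs R] --> (1 : R).
  by rewrite -[X in _ --> X]invr1; apply: cvgV => //; exact: oner_neq0.
have h3 : F (q * x) / ((q * x) `^ (- a) * L (q * x)) * (F x / (x `^ (- a) * L x))^-1 *
    (L (q * x) / L x) * q `^ (- a) @[x --> pinfty_nbhs R] --> 1 * 1 * 1 * q `^ (- a).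
  apply: cvgM; last exact: cvg_cst.
  by apply: cvgM => //; exact: cvgM.
rewrite !mul1r in h3; apply: cvg_trans h3; apply: near_eq_cvg.
near=> x; have x0 : 0 < x by near: x; exact: nbhs_pinfty_gt.
have qx0 : 0 < q * x by rewrite mulr_gt0.
rewrite powRM ?(ltW q0) ?(ltW x0)//.
have := Lgt0 x0; have := Lgt0 qx0; have := Fpos x; have := powR_gt0 (- a) x0; have := powR_gt0 (- a) q0.
move=> e1 e2 e3 e4 e5; field; rewrite !gt_eqF//.
Unshelve. all: end_near. Qed.

Lemma equiv_of_ftail (T : R -> R) c b : 1 < a -> 0 < b ->
  T x / (x * F x) @[x --> pinfty_nbhs R] --> c -> 0 < c ->
  T j%:R / b / (c / b * (j%:R `^ (- a + 1)) * L j%:R) @[j --> \oo] --> (1 : R).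
Proof.
move=> a1 b0 Tc c0; have rv := regularly_varying_of_equiv.
have H : T x / (x * F x) * (F x / (x `^ (- a) * L x)) * c^-1 @[x --> pinfty_nbhs R] --> c * 1 * c^-1.
  by apply: cvgM; [exact: cvgM|exact: cvg_cst].
rewrite mulr1 divff ?gt_eqF// in H.
have HN : T j%:R / (j%:R * F j%:R) * (F j%:R / (j%:R `^ (- a) * L j%:R)) * c^-1 @[j --> \oo] --> (1 : R).
  by apply: (@cvg_comp _ _ _ (fun j : nat => j%:R : R) _ _ (pinfty_nbhs R)) H; exact: cvgr_idn.
apply: cvg_trans HN; apply: near_eq_cvg; near=> j.
have j0 : 0 < j%:R :> R by rewrite ltr0n; near: j; exact: nbhs_infty_gt.
rewrite [- a + 1]addrC powRD ?(gt_eqF j0) ?implybT// powRr1 ?(ltW j0)//.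
have := Lgt0 j0; have := rv.1 _ j0; have := powR_gt0 (- a) j0 => e1 e2 e3.
by field; rewrite !gt_eqF.
Unshelve. all: end_near. Qed.

End heavy_tail.

Lemma mean_gt0 (R : realType) (F : R -> R) : density F ->
  (forall x y, x <= y -> F y <= F x) -> (forall x, 0 < F x) -> 0 < dens F (fun=> 1).
Proof.
move=> dF Fdec F0; have PJ := positive_dens dF.
have h01 : 0 <= (0 : R) <= 1 by rewrite lexx ler01.
have /andP[h _] := ftail_dens_diff dF Fdec h01.
apply: lt_le_trans (F0 1) _; rewrite subr0 mulr1 in h; apply: le_trans h _.
rewrite lerBlDr ler_wpDr ?ftail_ge0//.
apply: (pf_le PJ); [exact: admissible_gt|exact: admissible_cst|].
by move=> y _; rewrite lern1 leq_b1.
Qed.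

(** * Leading coefficients for the queue and the orbit *)

Section queue_tails.
Context d {Omega : measurableType d} {R : realType} (P : probability Omega R).
Variable Q : retrial_queue P.
Variables (Iser Rque Rorb : {RV P >-> nat}) (X : {RV P >-> R}).
Hypothesis hstat : stationary Q Iser Rque Rorb X.
Hypothesis hrho : total_load Q < 1.
Implicit Types (i k : nat) (s t : R).

Notation l1 := (rate Q Type1).
Notation l2 := (rate Q Type2).
Notation mu := (retrial_rate Q).
Notation phi := (phi Q).
Notation count_fun := (count_fun Iser).
Notation p0 := (p0 Iser Rorb).
Notation p1 := (p1 Iser Rorb).
Notation Kf := (Kf Q).
Notation theta := (theta Q).
Notation sig := (sig Q).
Notation rho := (total_load Q).
Notation Fs c := (rccdf (service Q c)).

Lemma equivalent_tail (F L : R -> R) (a : R) n (V : {RV P >-> nat}) i (c b C : R) :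
  density F -> (forall x y, x <= y -> F y <= F x) -> slowly_varying L ->
  equivalent_at (pinfty_nbhs R) F (fun t => t `^ (- a) * L t) ->
  1 < a -> n.+1%:R <= a < n.+2%:R -> 0 < c -> 0 < b ->
  count_fun V i (fun=> 1) = b ->
  top_deriv (lap (dens F) n.+1) n.+1 ((-1) ^+ n.+1 * c) (lap (count_fun V i) 0) ->
  C = c / (a - 1) / b ->
  equivalent_at \oo (fun j => cond_prob P [set w | (j < V w)%N] [set w | Iser w = i])
    (fun j => C * j%:R `^ (- a + 1) * L j%:R).
Proof.
move=> dF Fdec hL hF a1 na c0 b0 bE top ->.
have [_ F0 _] := dF; have rvF := regularly_varying_of_equiv F0 Fdec hL hF.
have PJ := pos_count Iser V i.
have h := ftail_of_top_deriv dF Fdec rvF a1 na PJ c0 top.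
have ca : 0 < c / (a - 1) by rewrite divr_gt0// subr_gt0.
have := equiv_of_ftail F0 Fdec hL hF a1 b0 h ca; apply: cvg_trans.
by apply: near_eq_cvg; near=> j; rewrite ftail_count -bE count_fun1.
Unshelve. all: end_near. Qed.

Section heavy.
Variables (a : R) (n : nat).
Hypotheses (rvF : regularly_varying (- a) (Fs Type1)) (a1 : 1 < a) (na : n.+1%:R <= a < n.+2%:R).
Hypothesis small : forall d, 0 < d ->
  exists2 x0, 0 <= x0 & forall y, x0 < y -> Fs Type2 y <= d * Fs Type1 y.

Let dF1 := density_service Q Type1.
Let dF2 := density_service Q Type2.
Let Fdec : forall x y, x <= y -> Fs Type1 y <= Fs Type1 x. Proof. exact: rccdf_le. Qed.
Notation Phi := (lap (dens (Fs Type1)) n.+1).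
Notation S := ((-1) ^+ n.+1).
Let PL := Phi_large dF1 Fdec rvF na.
Let P0 s (s0 : 0 < s) := lap_gt0 dF1 Fdec rvF n.+1 s0.
Let rho1_lt1 : l1 * dens (Fs Type1) (fun=> 1) < 1.
Proof. by have := load1_lt1 hrho; rewrite loadE. Qed.
Let kappa := l2 / (1 - load Q Type1).
Let rho_lt1 : 0 < 1 - rho. Proof. by rewrite subr_gt0. Qed.

Let top_phi1 : top_deriv Phi n.+1 S (phi Type1) := top_deriv_lap0 dF1 Fdec rvF na.
Let top_phi2 : top_deriv Phi n.+1 0 (phi Type2) := top_deriv_negligible dF1 Fdec rvF na dF2 small.

Let top_sig (c : R) f : top_deriv Phi n.+1 c f ->
  top_deriv Phi n.+1 (c * kappa `^ (a - 1)) (fun t => f (sig t)).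
Proof.
rewrite /kappa loadE.
exact: (top_deriv_sigma dF1 Fdec rvF na (rate_gt0 Q _) rho1_lt1 (rate_gt0 Q _)).
Qed.

Let top_eps (c : R) f (l : R) : 0 < l -> top_deriv Phi n.+1 c f ->
  top_deriv Phi n.+1 (c * l `^ (a - 1)) (fun t => f (eps l t)).
Proof. exact: (top_deriv_eps dF1 Fdec rvF na). Qed.

Let recoef (c c' : R) f : top_deriv Phi n.+1 c f -> c = c' -> top_deriv Phi n.+1 c' f.
Proof. by move=> + <-. Qed.

Let top_cst (b : R) : top_deriv Phi n.+1 0 (fun=> b).
Proof. by apply: (subpoly_top_deriv PL); exact: subpoly_derivs_cst. Qed.

(** The coefficient of 1 - [Kf] up to the sign [S]: all of it comes from Type 1, since the
    coefficient of [phi Type2] is 0. *)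
Let m := l1 * kappa `^ (a - 1).

Let top_K : top_deriv Phi n.+1 (- (S * m)) Kf.
Proof.
have h1 := top_derivZ PL (- l1) (top_sig top_phi1).
have h2 := top_derivZ PL (- l2) (top_sig top_phi2).
have H := top_derivD (top_derivD (top_cst 1) h1) h2.
apply: (@eq_top_deriv _ _ _ _ _ _ _ (recoef H _)); last by rewrite /m; ring.
by move=> s _; rewrite /Kf !mulNr.
Qed.

Let top_KV : top_deriv Phi n.+1 (S * m / (1 - rho) ^+ 2) (fun t => (Kf t)^-1).
Proof.
have := top_derivV PL rho_lt1 (Kf_ge hrho) (cvg_Kf hrho) top_K.
by rewrite opprK.
Qed.

Let subpoly_expN k : subpoly_derivs k (fun t : R => expR (- t)).
Proof.
have s0 : subpoly (fun t : R => expR (- t)) := cvg_subpoly (@cvg_expN R).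
elim: k => [|k IH]; first by split.
split => //; exists (fun t => - expR (- t)); last exact: subpoly_derivsN.
move=> s _; have := real_derive_expM (-1) s.
by under [X in is_derive _ _ X _]funext => y do rewrite mulN1r; rewrite !mulN1r.
Qed.

(** Bootstrap through p0' = - p1 and [p1E]: k subpolynomial derivatives of [Kf] and [p0] give k + 1
    of [p0]. The order n + 1 is reached, one beyond [Kf], so that [p0] has leading coefficient 0. *)
Let subpoly_p0 k : (k <= n.+1)%N -> subpoly_derivs k p0.
Proof.
have s0 : subpoly p0 := cvg_subpoly (cvg_p0 hstat hrho).
elim: k => [|k IH] kn; first by split.
split => //; exists (fun t => - p1 t).
  by move=> s s0'; exact: (is_derive_lap (pos_count Iser Rorb 0) 0).
have sub_le j f : (j <= n)%N -> subpoly_derivs n f -> subpoly_derivs j f.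
  move=> jn; rewrite -(subnKC jn); elim: (n - j)%N => [|i IHi]; first by rewrite addn0.
  by rewrite addnS => /subpoly_derivsW.
have sK := sub_le _ k _ kn (top_deriv_subpoly top_K).
have sKV := sub_le _ k _ kn (top_deriv_subpoly top_KV).
have h := subpoly_derivsM (subpoly_derivsM (subpoly_derivsM (subpoly_derivsZ l2 (subpoly_expN k))
  (subpoly_derivsD (subpoly_derivs_cst k 1) (subpoly_derivsN sK))) sKV) (IH (ltnW kn)).
apply: eq_subpoly_derivs (subpoly_derivsZ (- mu^-1) h) => t t0 /=.
have mu0 := retrial_rate_gt0 Q; have K0 := Kf_gt0 hrho t0.
by apply: (@mulfI _ mu); rewrite ?gt_eqF// mulrN (p1E hstat hrho t0); field; rewrite !gt_eqF.
Qed.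

Let tot t := p0 t / Kf t.

Let top_tot : top_deriv Phi n.+1 (S * m / (1 - rho)) tot.
Proof.
have cV : (Kf t)^-1 @[t --> 0^'+] --> (1 - rho)^-1.
  by apply: cvgV; [rewrite gt_eqF|exact: cvg_Kf].
have H := top_derivM PL (subpoly_top_deriv PL (subpoly_p0 (leqnn _))) top_KV (cvg_p0 hstat hrho) cV.
by apply: (recoef H); field; rewrite gt_eqF.
Qed.

Let top_theta : top_deriv Phi n.+1 0 (fun t => l2 * phi Type2 (theta t)).
Proof. by have := top_derivZ PL l2 (top_eps (rate_gt0 Q Type2) top_phi2); rewrite mul0r mulr0. Qed.

Let cvg_theta : l2 * phi Type2 (theta t) @[t --> 0^'+] --> load Q Type2.
Proof. exact: cvg_rate_phi (asymp_linear_eps (rate_gt0 Q Type2)). Qed.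

Lemma top_deriv_orbit2 :
  top_deriv Phi n.+1 (S * (load Q Type2 * (l1 * kappa `^ (a - 1)) / (1 - rho))) (lap (count_fun Rorb 2) 0).
Proof.
have H := top_derivM PL top_theta top_tot cvg_theta (cvg_tot hstat hrho).
apply: (@eq_top_deriv _ _ _ _ _ _ _ (recoef H _)); last by rewrite /m; ring.
by move=> t t0; rewrite (gf_orbit_busy2 hstat hrho t0).
Qed.

Lemma top_deriv_orbit1 :
  top_deriv Phi n.+1 (S * ((1 - load Q Type2) * (l1 * kappa `^ (a - 1)) / (1 - rho)))
    (lap (count_fun Rorb 1) 0).
Proof.
have h1 := top_derivM PL top_theta top_tot cvg_theta (cvg_tot hstat hrho).
have h2 := top_derivZ PL (-1) (subpoly_top_deriv PL (subpoly_p0 (leqnn _))).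
have H := top_derivD (top_derivD top_tot h2) (top_derivZ PL (-1) h1).
apply: (@eq_top_deriv _ _ _ _ _ _ _ (recoef H _)); last by rewrite /m; ring.
move=> t t0; rewrite (gf_orbit_busy1 hstat hrho t0).
by have K0 := Kf_gt0 hrho t0; rewrite /tot; field; rewrite gt_eqF.
Qed.

(** Leibniz rule for b / (1 - b) times 1 - rho + b2, where b and b2 tend to the two loads. The first
    factor brings (1 - rho1)^(-2), and the limit 1 - rho1 of the second cancels one power. *)
Lemma top_deriv_queue1 :
  top_deriv Phi n.+1 (S * (l1 * l1 `^ (a - 1) / (1 - load Q Type1))) (lap (count_fun Rque 1) 0).
Proof.
have L1 := rate_gt0 Q Type1; have rho1' : 0 < 1 - load Q Type1 by rewrite subr_gt0 load1_lt1.
have tb := top_derivZ PL l1 (top_eps L1 top_phi1).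
have tb2 := top_derivZ PL l2 (top_eps L1 top_phi2).
have cb : l1 * phi Type1 (eps l1 t) @[t --> 0^'+] --> load Q Type1.
  exact: cvg_rate_phi (asymp_linear_eps L1).
have cb2 : l2 * phi Type2 (eps l1 t) @[t --> 0^'+] --> load Q Type2.
  exact: cvg_rate_phi (asymp_linear_eps L1).
have lb t : 0 < t -> 1 - load Q Type1 <= 1 + - 1 * (l1 * phi Type1 (eps l1 t)).
  by move=> t0; rewrite mulN1r lerD2l lerN2 rate_phi_le// eps_gt0.
have c1 : 1 + - 1 * (l1 * phi Type1 (eps l1 t)) @[t --> 0^'+] --> 1 - load Q Type1.
  apply: cvgD; first exact: cvg_cst.
  by rewrite -[- load Q Type1]mulN1r; apply: cvgM => //; exact: cvg_cst.
have tV := top_derivV PL rho1' lb c1 (top_derivD (top_cst 1) (top_derivZ PL (-1) tb)).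
have cV : (1 + - 1 * (l1 * phi Type1 (eps l1 t)))^-1 @[t --> 0^'+] --> (1 - load Q Type1)^-1.
  by apply: cvgV c1; rewrite gt_eqF.
have tg := top_derivD (top_cst (1 - rho)) tb2.
have cg : 1 - rho + l2 * phi Type2 (eps l1 t) @[t --> 0^'+] --> 1 - rho + load Q Type2.
  by apply: cvgD => //; exact: cvg_cst.
have tbV := top_derivM PL tb tV cb cV.
have cbV : l1 * phi Type1 (eps l1 t) * (1 + - 1 * (l1 * phi Type1 (eps l1 t)))^-1 @[t --> 0^'+] -->
    load Q Type1 * (1 - load Q Type1)^-1 by exact: cvgM.
have H := top_derivM PL tbV tg cbV cg.
apply: (@eq_top_deriv _ _ _ _ _ _ _ (recoef H _)); last first.
  by rewrite /total_load; field; rewrite gt_eqF.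
move=> t t0; have E := gf_queue_busy1 hstat hrho t0.
have D : 0 < 1 - l1 * phi Type1 (eps l1 t) by have := lb t t0; lra.
rewrite mulN1r; apply: (@mulfI _ (1 - l1 * phi Type1 (eps l1 t))); first by rewrite gt_eqF.
by rewrite E; field; rewrite gt_eqF.
Qed.

End heavy.
End queue_tails.

Section comparison.
Context {R : realType}.

Lemma exp_powR_small (r b : R) : 0 < r \/ r = 0 /\ b < 0 -> forall e, 0 < e ->
  \forall y \near pinfty_nbhs R, expR (- (r * y)) * y `^ b <= e.
Proof.
move=> [r0|[-> b0]] e e0.
  have [k bk] : exists k : nat, b + 1 <= k%:R.
    by exists (Num.truncn (Num.max (b + 1) 0)).+1; apply: le_trans (ltW (truncnS_gt _)); rewrite le_max lexx.
  pose C := (k%:R / r) ^+ k.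
  have C0 : 0 <= C by rewrite exprn_ge0// divr_ge0// ltW.
  near=> y; have y1 : 1 <= y by near: y; exact: nbhs_pinfty_ge (num_real _).
  have y0 : 0 < y by exact: lt_le_trans y1.
  have yC : C / e <= y by near: y; exact: nbhs_pinfty_ge (num_real _).
  have h := pow_exp_le k r0 (ltW y0).
  have hb : y `^ b * y <= y ^+ k.
    by rewrite -{2}[y]powRr1 ?(ltW y0)// -powRD ?(gt_eqF y0) ?implybT// -powR_mulrn ?(ltW y0)// ler_powR.
  rewrite -(ler_pM2r y0); apply: le_trans (_ : C <= _).
    by apply: le_trans h; rewrite -mulrA mulrC ler_wpM2r// expR_ge0.
  by rewrite ler_pdivrMr// in yC; rewrite mulrC.
have nb : 0 < - b by rewrite oppr_gt0.
have /cvgr_le/(_ e e0)/near_inv H := @powR_cvg0 R _ nb.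
near=> y; have y0 : 0 < y by near: y; exact: nbhs_pinfty_gt.
rewrite mul0r oppr0 expR0 mul1r.
suff : y^-1 `^ (- b) <= e by rewrite -powR_inv1 ?(ltW y0)// -powRrM mulN1r opprK.
by near: y.
Unshelve. all: end_near. Qed.

Lemma negligible_of_equiv (F1 F2 L : R -> R) (a1 a2 r : R) :
  (forall x, 0 <= F1 x) -> slowly_varying L ->
  0 < r \/ r = 0 /\ a1 < a2 ->
  equivalent_at (pinfty_nbhs R) F1 (fun t => t `^ (- a1) * L t) ->
  equivalent_at (pinfty_nbhs R) F2 (fun t => expR (- (r * t)) * t `^ (- a2) * L t) ->
  forall d, 0 < d -> exists2 x0, 0 <= x0 & forall y, x0 < y -> F2 y <= d * F1 y.
Proof.
move=> F10 [_ L0 _] hr h1 h2 d d0.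
(* Each of the two equivalences costs a factor 2. *)
have d4 : 0 < d / 4 by rewrite divr_gt0.
have hr' : 0 < r \/ r = 0 /\ a1 - a2 < 0.
  by case: hr => [?|[? ?]]; [left|right; split => //; rewrite subr_lt0].
have W := exp_powR_small hr' d4.
have N1 : \forall x \near pinfty_nbhs R, 2^-1 <= F1 x / (x `^ (- a1) * L x).
  by apply: (cvgr_ge _ h1); lra.
have N2 : \forall x \near pinfty_nbhs R, F2 x / (expR (- (r * x)) * x `^ (- a2) * L x) <= 2.
  by apply: (cvgr_le _ h2); lra.
have [x1 x10 H] := (nearyP _).1 (filterI W (filterI N1 N2)).
exists x1; first exact: ltW.
move=> y /ltW x1y; have [hw [hn1 hn2]] := H y x1y.
have y0 : 0 < y by exact: lt_le_trans x1y.
have Ly := L0 y y0; have pa1 := powR_gt0 (- a1) y0; have pa2 := powR_gt0 (- a2) y0.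
have e0 := expR_gt0 (- (r * y)).
rewrite ler_pdivlMr ?mulr_gt0// in hn1; rewrite ler_pdivrMr ?mulr_gt0// in hn2.
have E : y `^ (- a2) = y `^ (a1 - a2) * y `^ (- a1).
  by rewrite -powRD ?(gt_eqF y0) ?implybT//; congr (_ `^ _); ring.
rewrite E in hn2; apply: le_trans hn2 _.
set w := expR _ in hw hn1 e0 *; set q := y `^ (a1 - a2) in hw *.
have := ler_wpM2r (ltW (mulr_gt0 pa1 Ly)) hw.
set p := y `^ (- a1) in pa1 hn1 *; set f := F1 y in hn1 *; nra.
Qed.

End comparison.

(** * Light-tailed service times of Type 2 *)

Section power_series.
Context {R : realType}.

(** Once the previous coefficients vanish, the bound divided by z^n gives |c n| <= C z for
    arbitrarily small z. *)
Lemma coef_eq0 (c : nat -> R) (C : R) :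
  (forall n z, 0 < z < 1 -> `|\sum_(k < n.+1) c k * z ^+ k| <= C * z ^+ n.+1) ->
  forall k, c k = 0.
Proof.
move=> H; elim/ltn_ind => n IH.
have C0 : 0 <= C.
  have h : 0 < (2^-1 : R) < 1 by apply/andP; split; lra.
  by have := le_trans (normr_ge0 _) (H 0 _ h); rewrite pmulr_lge0.
have h z : 0 < z < 1 -> `|c n| <= C * z.
  move=> z01; have := H n z z01; rewrite big_ord_recr/= big1 ?add0r; last first.
    by move=> i _; rewrite IH ?mul0r.
  have /andP[z0 _] := z01; have zn := exprn_gt0 n z0.
  by rewrite normrM (ger0_norm (ltW zn)) exprS mulrA ler_pM2r.
apply/eqP; rewrite -normr_eq0 eq_le normr_ge0 andbT; apply/ler_addgt0Pr => e e0.
rewrite add0r; pose z := Num.min 2^-1 (e / (C + 1)).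
have C1 : 0 < C + 1 by rewrite ltr_wpDl.
have z0 : 0 < z by rewrite lt_min divr_gt0// andbT; lra.
have z1 : z < 1 by rewrite gt_min; apply/orP; left; lra.
apply: le_trans (h z _) _; first by rewrite z0 z1.
have ze : z <= e / (C + 1) by rewrite ge_min lexx orbT.
rewrite ler_pdivlMr// in ze; nra.
Qed.

(** From rank n on, z^k x^k / k! is at most z^n x^k / k!. *)
Lemma expR_partial_sum (x z : R) n : 0 <= x -> 0 <= z <= 1 ->
  0 <= expR (z * x) - \sum_(k < n) (z * x) ^+ k / k`!%:R <= z ^+ n * expR x.
Proof.
move=> x0 /andP[z0 z1].
have cv (y : R) : series (exp_coeff y) m @[m --> \oo] --> expR y by exact: is_cvg_series_exp_coeff.
have S y m : series (exp_coeff y) m = \sum_(k < m) y ^+ k / k`!%:R by rewrite /series/= big_mkord.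
have mono (y : R) : 0 <= y -> forall m, \sum_(k < m) y ^+ k / k`!%:R <= expR y.
  move=> y0 m; rewrite -S; apply: (nondecreasing_cvgn_le _ (cv y)).
  by apply/nondecreasing_seqP => k; rewrite !seriesEnat/= big_nat_recr//= lerDl exp_coeff_ge0.
rewrite subr_ge0 mono ?mulr_ge0//= lerBlDr.
rewrite -(cvg_lim _ (cv (z * x)))//; apply: limr_le; first exact: cvgP (cv _).
near=> m; have nm : (n <= m)%N by near: m; exact: nbhs_infty_ge.
rewrite [X in X <= _](big_cat_nat (n := n))//= big_mkord addrC lerD2r.
apply: le_trans (_ : z ^+ n * \sum_(n <= k < m) x ^+ k / k`!%:R <= _).
  rewrite mulr_sumr; apply: ler_sum_nat => k /andP[nk _].
  rewrite /exp_coeff/= exprMn mulrA ler_wpM2r ?invr_ge0// ler_wpM2r ?exprn_ge0//.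
  exact: ler_wiXn2l.
rewrite ler_wpM2l ?exprn_ge0//; apply: le_trans (mono x x0 m).
rewrite -(big_mkord xpredT (fun k => x ^+ k / k`!%:R)) [leRHS](big_cat_nat (n := n))//= lerDr.
by apply: sumr_ge0 => k _; rewrite divr_ge0 ?exprn_ge0.
Unshelve. all: end_near. Qed.

End power_series.

Section queue_pmf.
Context d {Omega : measurableType d} {R : realType} (P : probability Omega R).
Variable Q : retrial_queue P.
Variables (Iser Rque Rorb : {RV P >-> nat}) (X : {RV P >-> R}).
Hypothesis hstat : stationary Q Iser Rque Rorb X.
Hypothesis hrho : total_load Q < 1.
Notation l1 := (rate Q Type1).
Notation l2 := (rate Q Type2).
Notation on_server := (on_server Iser).
Notation J2 := (service_dens Q Type2).

Lemma bounded_mfun_eq (V : {RV P >-> nat}) (k : nat) :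
  bounded_mfun (fun om => (V om == k)%:R : R).
Proof. by apply: (@bounded_mfun_nat _ _ _ P V (fun n => (n == k)%:R)) => n; rewrite ler0n lern1 leq_b1. Qed.

Lemma bounded_mfunZ (c : R) (f : Omega -> R) : bounded_mfun f -> bounded_mfun (fun om => c * f om).
Proof. by apply: bounded_mfunM; split => //; exists `|c|. Qed.

Lemma on_serverZ i (c : R) (f : Omega -> R) : bounded_mfun f ->
  on_server i (fun om => c * f om) = c * on_server i f.
Proof.
move=> bf; rewrite -RintegralZl//; last exact: integrable_on_server.
by apply: eq_Rintegral => om _; rewrite mulrCA.
Qed.

Lemma on_server_sum i (f : nat -> Omega -> R) n : (forall k, bounded_mfun (f k)) ->
  bounded_mfun (fun om => \sum_(k < n) f k om) /\
  on_server i (fun om => \sum_(k < n) f k om) = \sum_(k < n) on_server i (f k).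
Proof.
move=> bf; elim: n => [|n [IHb IH]].
  have b0 : bounded_mfun (fun om => \sum_(k < 0) f k om).
    by split; [under eq_fun do rewrite big_ord0; exact: measurable_cst|
      exists 0 => om; rewrite big_ord0 normr0].
  split => //; rewrite big_ord0 -[RHS](mul0r (on_server i (f 0))) -on_serverZ//.
  by congr on_server; apply/funext => om; rewrite big_ord0 mul0r.
have bN := bounded_mfunZ (-1) (bf n).
have E : (fun om => \sum_(k < n.+1) f k om) = (fun om => \sum_(k < n) f k om - -1 * f n om).
  by apply/funext => om; rewrite big_ord_recr/= mulN1r opprK.
by rewrite E; split; [exact: bounded_mfunB|rewrite on_serverB// IH on_serverZ// big_ord_recr/= mulN1r opprK].
Qed.

Lemma pf_sum (J : (R -> R) -> R) (f : nat -> R -> R) n : positive_functional J ->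
  (forall k, admissible (f k)) -> admissible (fun y => \sum_(k < n) f k y) /\
  J (fun y => \sum_(k < n) f k y) = \sum_(k < n) J (f k).
Proof.
move=> PJ af; elim: n => [|n [IHa IH]].
  have a0 : admissible (fun y => \sum_(k < 0) f k y).
    by under eq_fun do rewrite big_ord0; exact: admissible_cst.
  split => //; rewrite big_ord0 -[RHS](mul0r (J (f 0))) -(pfZ PJ)//.
  by congr J; apply/funext => y; rewrite big_ord0 mul0r.
have E : (fun y => \sum_(k < n.+1) f k y) = (fun y => \sum_(k < n) f k y + f n y).
  by apply/funext => y; rewrite big_ord_recr.
by rewrite E; split; [exact: admissibleD|rewrite (pfD PJ)// IH big_ord_recr].
Qed.

Definition pmf2 k := on_server 2 (fun om => (Rque om == k)%:R).

Lemma pmf2_partial_sum (z : R) n : 0 < z < 1 ->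
  `|on_server 2 (fun om => z ^+ Rque om) - \sum_(k < n) pmf2 k * z ^+ k| <= z ^+ n.
Proof.
move=> /andP[z0 z1]; have z01 m : 0 <= z ^+ m <= 1.
  by rewrite exprn_ge0 ?(ltW z0)//= exprn_ile1 ?(ltW z0) ?(ltW z1).
have bz : bounded_mfun (fun om => z ^+ Rque om) := bounded_mfun_nat Rque z01.
pose f k om := z ^+ k * (Rque om == k)%:R : R.
have bf k : bounded_mfun (f k) by apply: bounded_mfunZ; exact: bounded_mfun_eq.
have [bs sE] := on_server_sum 2 n bf.
have -> : \sum_(k < n) pmf2 k * z ^+ k = on_server 2 (fun om => \sum_(k < n) f k om).
  rewrite sE; apply: eq_bigr => k _; rewrite /f on_serverZ; last exact: bounded_mfun_eq.
  by rewrite mulrC.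
rewrite -on_serverB//.
have b1 : bounded_mfun (fun om : Omega => 1 : R) by split => //; exists 1 => om; rewrite normr1.
have bd := bounded_mfunB bz bs.
have fE om : \sum_(k < n) f k om = if (Rque om < n)%N then z ^+ Rque om else 0.
  case: ltnP => h; last first.
    by apply: big1 => k _; rewrite /f gtn_eqF ?mulr0// (leq_trans (ltn_ord k)).
  rewrite (bigD1 (Ordinal h))//= /f eqxx mulr1 big1 ?addr0// => k /eqP kh.
  by case: eqP => e; rewrite ?mulr0//; case: kh; apply/val_inj.
have p1 : on_server 2 (fun=> 1) <= 1.
  have -> : on_server 2 (fun=> 1) = count_fun Iser Rque 2 (fun=> 1) by [].
  rewrite (prob_busy2 hstat hrho).
  by apply: ltW; apply: le_lt_trans hrho; rewrite /total_load lerDr load_ge0.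
rewrite ger0_norm; last first.
  have b0 := bounded_mfunZ 0 b1.
  rewrite -[leLHS](mul0r (on_server 2 (fun=> 1))) -on_serverZ//; apply: on_server_le => // om.
  rewrite mul0r fE subr_ge0; case: ifP => // _; exact: exprn_ge0 (ltW z0).
have bc := bounded_mfunZ (z ^+ n) b1.
apply: (@le_trans _ _ (on_server 2 (fun om => z ^+ n * 1))).
  apply: on_server_le => // om; rewrite fE mulr1; case: ltnP => h; rewrite ?subrr ?subr0.
    by have /andP[] := z01 n.
  by apply: ler_wiXn2l => //; exact: ltW.
by rewrite on_serverZ// ler_piMr//; have /andP[] := z01 n.
Qed.

(** Mixed Poisson weight: the probability of k arrivals at rate l1 within a time y, integrated
    against l2 P(T_2 > y) dy. *)
Definition mix2 k := l2 * (l1 ^+ k / k`!%:R) * lap J2 k l1.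

Lemma mix2_partial_sum (z : R) n : 0 < z < 1 ->
  `|l2 * lap J2 0 (l1 * (1 - z)) - \sum_(k < n) mix2 k * z ^+ k| <= load Q Type2 * z ^+ n.
Proof.
move=> z01; have /andP[z0 z1] := z01; have L1 := rate_gt0 Q Type1; have L2 := rate_gt0 Q Type2.
have PJ := pos_service Q Type2.
pose f k y := (z ^+ k * (l1 ^+ k / k`!%:R)) * (y ^+ k * expR (- (l1 * y))).
have ae k := @admissible_pow_exp _ k _ L1.
have af k : admissible (f k) by apply: admissibleZ.
have [asum sE] := pf_sum n PJ af.
have s0 : 0 < l1 * (1 - z) by rewrite mulr_gt0// subr_gt0.
have a0 := admissible_pow_exp 0 s0.
have -> : \sum_(k < n) mix2 k * z ^+ k = l2 * J2 (fun y => \sum_(k < n) f k y).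
  rewrite sE mulr_sumr; apply: eq_bigr => k _; rewrite /f /mix2 (pfZ PJ)//.
  by rewrite -[J2 _]/(lap J2 k l1); ring.
rewrite -mulrBr normrM (ger0_norm (ltW L2)) loadE -mulrA ler_pM2l// -(pfB PJ)// [leRHS]mulrC.
have a1 := admissible_cst (1 : R).
rewrite -(pfZ PJ)//; apply: (pf_norm PJ) => //; first exact: admissibleB.
  exact: admissibleZ.
move=> y y0.
have E : y ^+ 0 * expR (- (l1 * (1 - z) * y)) - \sum_(k < n) f k y =
    expR (- (l1 * y)) * (expR (z * (l1 * y)) - \sum_(k < n) (z * (l1 * y)) ^+ k / k`!%:R).
  rewrite [RHS]mulrBr -expRD expr0 mul1r; congr (expR _ - _); first by ring.
  by rewrite mulr_sumr; apply: eq_bigr => k _; rewrite /f !exprMn; ring.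
have z01' : 0 <= z <= 1 by rewrite !ltW.
have ly : 0 <= l1 * y by rewrite mulr_ge0 ?(ltW L1).
have /andP[h0 h1] := expR_partial_sum n ly z01'.
rewrite E ger0_norm ?mulr_ge0 ?expR_ge0//; apply: le_trans (ler_wpM2l (expR_ge0 _) h1) _.
by rewrite mulrCA -expRD addNr expR0.
Qed.

(** Both families have the same generating function by [gf_queue_busy2], with remainders of order
    z^n, so [coef_eq0] applies to their difference. *)
Lemma pmf2E k : pmf2 k = mix2 k.
Proof.
apply/eqP; rewrite -subr_eq0; apply/eqP; move: k.
apply: (@coef_eq0 _ _ (1 + load Q Type2)) => n z z01; have /andP[z0 z1] := z01.
have lz : 0 < - ln z by rewrite oppr_gt0 ln_lt0.
have h1 := pmf2_partial_sum n.+1 z01; have h2 := mix2_partial_sum n.+1 z01.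
have E : on_server 2 (fun om => z ^+ Rque om) = l2 * lap J2 0 (l1 * (1 - z)).
  have := gf_queue_busy2 hstat hrho lz; rewrite /eps opprK lnK ?posrE// => <-.
  congr on_server; apply/funext => om; rewrite expr0 mul1r mulNr opprK mulrC.
  by rewrite expRM_natl lnK// posrE.
rewrite E in h1.
have -> : \sum_(k < n.+1) (pmf2 k - mix2 k) * z ^+ k =
    (l2 * lap J2 0 (l1 * (1 - z)) - \sum_(k < n.+1) mix2 k * z ^+ k) -
    (l2 * lap J2 0 (l1 * (1 - z)) - \sum_(k < n.+1) pmf2 k * z ^+ k).
  under eq_bigr do rewrite mulrBl.
  by rewrite sumrB; ring.
apply: le_trans (ler_normB _ _) _; rewrite mulrDl mul1r addrC lerD//.
Qed.

End queue_pmf.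

Section powers.
Context {R : realType}.

Lemma powR_between (q w b : R) : 0 < q -> q <= w <= q^-1 ->
  q `^ `|b| <= w `^ b <= q `^ (- `|b|).
Proof.
move=> q0 /andP[qw wq]; have w0 := lt_le_trans q0 qw.
have key (v c : R) : 0 <= c -> q <= v <= q^-1 -> q `^ c <= v `^ c <= q `^ (- c).
  move=> c0 /andP[qv vq]; have v0 := lt_le_trans q0 qv.
  rewrite -[- c]mulN1r powRrM powR_inv1 ?(ltW q0)//.
  by rewrite !ge0_ler_powR ?nnegrE ?(ltW q0) ?(ltW v0) ?invr_ge0 ?(ltW q0).
have [b0|b0] := leP 0 b; first by rewrite ger0_norm//; apply: key => //; rewrite qw.
rewrite ltr0_norm// (_ : w `^ b = w^-1 `^ (- b)); last first.
  by rewrite -powR_inv1 ?(ltW w0)// -powRrM mulN1r opprK.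
apply: key; first by rewrite oppr_ge0 ltW.
apply/andP; split; last by rewrite lef_pV2.
by rewrite -[q]invrK lef_pV2// posrE invr_gt0.
Qed.

Lemma powR_le_sum (w b : R) (N : nat) : 0 < w -> `|b| <= N%:R ->
  w `^ b <= w ^+ N + w^-1 ^+ N.
Proof.
move=> w0; rewrite ler_norml => /andP[b1 b2].
have wi : 0 < w^-1 by rewrite invr_gt0.
have [w1|w1] := leP 1 w.
  by rewrite ler_wpDr ?exprn_ge0 ?(ltW wi)// -powR_mulrn ?(ltW w0)// ler_powR.
rewrite ler_wpDl ?exprn_ge0 ?(ltW w0)// (_ : w `^ b = w^-1 `^ (- b)); last first.
  by rewrite -powR_inv1 ?(ltW w0)// -powRrM mulN1r opprK.
rewrite -powR_mulrn ?(ltW wi)// ler_powR//; first by rewrite invf_ge1// ltW.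
by rewrite lerNl.
Qed.

End powers.

(** * Windows and Potter bounds from a monotone regularly varying function *)

Section light_tail.
Context {R : realType}.
Variables (F G : R -> R) (a b : R).
Hypotheses (Fdec : forall x y, x <= y -> F y <= F x) (rvF : regularly_varying (- a) F).
Hypothesis (hG : G y / (y `^ b * F y) @[y --> pinfty_nbhs R] --> (1 : R)).
Let F0 x : 0 < x -> 0 < F x. Proof. exact: rvF.1. Qed.

(** Over the window, F is squeezed between its values at the ends (1 - e) x and (1 + e) x, both
    controlled by pointwise regular variation; the power y^b is handled by [powR_between]. *)
Lemma window eta : 0 < eta -> exists2 e, 0 < e & exists2 x0, 0 < x0 &
  forall x y, x0 <= x -> `|y - x| <= e * x -> `|G y - G x| <= eta * G x.
Proof.
move=> eta0; pose B := `|b|.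
have id0 : e @[e --> (0 : R)^'+] --> (0 : R) by exact: cvg_at_right_filter.
have cp (c : R) : 1 + c * e @[e --> (0 : R)^'+] --> (1 : R).
  rewrite [X in _ --> X](_ : 1 = 1 + c * 0); last by rewrite mulr0 addr0.
  by apply: cvgD; [exact: cvg_cst|apply: cvgM => //; exact: cvg_cst].
have cpow (c q : R) : (1 + c * e) `^ q @[e --> (0 : R)^'+] --> (1 : R).
  by rewrite [X in _ --> X](_ : 1 = 1 `^ q :> R); [exact: cvg_powR|rewrite powR1].
have up : (1 + 1 * e) * (1 + -1 * e) `^ (- B) * ((1 + -1 * e) `^ (- a) + e) / (1 + -1 * e)
    @[e --> (0 : R)^'+] --> (1 : R).
  rewrite [X in _ --> X](_ : 1 = 1 * 1 * (1 + 0) / 1 :> R); last by rewrite addr0 divr1 !mulr1.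
  apply: cvgM; last by apply: cvgV => //; exact: oner_neq0.
  by apply: cvgM; [exact: cvgM|exact: cvgD].
have lo : (1 + -1 * e) * (1 + -1 * e) `^ B * ((1 + 1 * e) `^ (- a) - e) / (1 + 1 * e)
    @[e --> (0 : R)^'+] --> (1 : R).
  rewrite [X in _ --> X](_ : 1 = 1 * 1 * (1 - 0) / 1 :> R); last by rewrite subr0 divr1 !mulr1.
  apply: cvgM; last by apply: cvgV => //; exact: oner_neq0.
  by apply: cvgM; [exact: cvgM|exact: cvgB].
have [e [e0 e1 hu hl hp]] : exists e, [/\ 0 < e, e < 2^-1,
   (1 + 1 * e) * (1 + -1 * e) `^ (- B) * ((1 + -1 * e) `^ (- a) + e) / (1 + -1 * e) <= 1 + eta,
   1 - eta <= (1 + -1 * e) * (1 + -1 * e) `^ B * ((1 + 1 * e) `^ (- a) - e) / (1 + 1 * e) &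
   0 <= (1 + 1 * e) `^ (- a) - e].
  near (0 : R)^'+ => e; exists e; split.
  - by near: e; exact: nbhs_right_gt.
  - by near: e; apply: nbhs_right_lt; lra.
  - by near: e; apply: (cvgr_le _ up); lra.
  - by near: e; apply: (cvgr_ge _ lo); lra.
  - near: e; have : (1 + 1 * e) `^ (- a) - e @[e --> (0 : R)^'+] --> (1 - 0 : R) by exact: cvgB.
    by move=> h; apply: (cvgr_ge _ h); lra.
exists e => //; rewrite !mul1r mulN1r in hu hl hp.
have q0 : 0 < 1 - e by lra.
have p0 : 0 < 1 + e by lra.
have N1 : \forall y \near pinfty_nbhs R, 1 - e <= G y / (y `^ b * F y).
  by apply: (cvgr_ge _ hG); lra.
have N2 : \forall y \near pinfty_nbhs R, G y / (y `^ b * F y) <= 1 + e.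
  by apply: (cvgr_le _ hG); lra.
have [x1 x10 H] := (nearyP _).1 (filterI N1 N2).
have [x2 x20 H2] := rv_cmp rvF q0 e0.
have [x3 x30 H3] := rv_cmp rvF p0 e0.
exists (2 * x1 + x2 + x3); first lra.
move=> x y hx hy.
have x0 : 0 < x by lra.
have /andP[y1 y2] : (1 - e) * x <= y <= (1 + e) * x.
  by move: hy; rewrite ler_norml => /andP[? ?]; apply/andP; split; lra.
have y0 : 0 < y by apply: lt_le_trans y1; rewrite mulr_gt0.
have yx1 : x1 <= y by apply: le_trans y1; nra.
have [hx1 hx2] := H x (ltac:(lra)); have [hy1 hy2] := H y yx1.
have xb := powR_gt0 b x0; have yb := powR_gt0 b y0; have Fx := F0 x0; have Fy := F0 y0.
rewrite ler_pdivlMr ?mulr_gt0// in hx1; rewrite ler_pdivrMr ?mulr_gt0// in hx2.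
rewrite ler_pdivlMr ?mulr_gt0// in hy1; rewrite ler_pdivrMr ?mulr_gt0// in hy2.
have f1 : F y <= ((1 - e) `^ (- a) + e) * F x.
  apply: le_trans (Fdec y1) _; have /andP[_] := H2 x (ltac:(lra)); exact.
have f2 : ((1 + e) `^ (- a) - e) * F x <= F y.
  apply: le_trans (Fdec y2); have /andP[+ _] := H3 x (ltac:(lra)); exact.
have wE : y `^ b = (y / x) `^ b * x `^ b.
  by rewrite -powRM ?divr_ge0 ?(ltW x0) ?(ltW y0)// divfK// gt_eqF.
have wb : 1 - e <= y / x <= (1 - e)^-1.
  rewrite ler_pdivlMr// y1/= ler_pdivrMr//; apply: le_trans y2 _.
  have ei : 1 + e <= (1 - e)^-1 by rewrite -[leRHS]mul1r ler_pdivlMr//; nra.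
  by apply: ler_wpM2r => //; exact: ltW.
have /andP[w1 w2] := powR_between b q0 wb; rewrite -/B in w1 w2.
set c1 := (1 - e) `^ (- B) in hu w2; set c2 := (1 - e) `^ (- a) + e in hu f1.
set c3 := (1 - e) `^ B in hl w1; set c4 := (1 + e) `^ (- a) - e in hl hp f2.
have c20 : 0 < c2 by rewrite addr_gt0 ?powR_gt0.
have c30 : 0 < c3 by rewrite powR_gt0.
have c10 : 0 < c1 by rewrite powR_gt0.
have Gx : 0 < G x by apply: lt_le_trans hx1; rewrite !mulr_gt0.
rewrite ler_distl.
have U : y `^ b * F y <= c1 * c2 * (x `^ b * F x).
  rewrite wE [leRHS](_ : _ = c1 * x `^ b * (c2 * F x)); last by ring.
  by apply: ler_pM => //; rewrite ?mulr_ge0 ?powR_ge0 ?(ltW Fy)// ler_wpM2r ?powR_ge0.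
have V : c3 * c4 * (x `^ b * F x) <= y `^ b * F y.
  rewrite wE [leLHS](_ : _ = c3 * x `^ b * (c4 * F x)); last by ring.
  by apply: ler_pM => //; rewrite ?mulr_ge0 ?powR_ge0 ?(ltW c30) ?(ltW Fx)// ler_wpM2r ?powR_ge0.
set wx := x `^ b * F x in hx1 hx2 U V *; set wy := y `^ b * F y in hy1 hy2 U V *.
have wx0 : 0 < wx by rewrite mulr_gt0.
apply/andP; split.
  apply: le_trans hy1; apply: le_trans (_ : (1 - e) * (c3 * c4 * wx) <= _); last by rewrite ler_pM2l.
  apply: le_trans (_ : (1 - e) * c3 * c4 / (1 + e) * G x <= _).
    by rewrite -[leLHS]/(_ - _) -{1}[G x]mul1r -mulrBl ler_pM2r.
  rewrite -!mulrA ler_pM2l// ler_pM2l// ler_wpM2l// mulrC ler_pdivrMr// mulrC; lra.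
apply: le_trans hy2 _; apply: le_trans (_ : (1 + e) * (c1 * c2 * wx) <= _); first by rewrite ler_pM2l.
apply: le_trans (_ : (1 + e) * c1 * c2 / (1 - e) * G x <= _); last first.
  by rewrite -{2}[G x]mul1r -mulrDl ler_pM2r.
rewrite -!mulrA ler_pM2l// ler_pM2l// ler_pM2l// mulrC ler_pdivlMr//; lra.
Unshelve. all: end_near. Qed.

(** M >= a + 1 makes F(y) at most 2^M F(2 y) for large y, and this is iterated from y up to x. *)
Lemma regularly_varying_doubling : exists M C x1, [/\ 0 < C, 0 < x1 &
  forall x y, x1 <= y -> y <= x -> F y <= C * F x * (x / y) ^+ M].
Proof.
have h0 : 0 < (2 : R) `^ (- a) by rewrite powR_gt0.
have d0 : 0 < (2 : R) `^ (- a) / 2 by rewrite divr_gt0.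
have [x1 x10 H] := rv_cmp rvF (ltr0n R 2) d0.
have [M aM] : exists M : nat, a + 1 <= M%:R.
  by exists (Num.truncn (Num.max (a + 1) 0)).+1; apply: le_trans (ltW (truncnS_gt _)); rewrite le_max lexx.
have two0 : (0 : R) < 2 by lra.
have hM : (2 ^+ M)^-1 <= (2 : R) `^ (- a) - 2 `^ (- a) / 2.
  rewrite [leRHS](_ : _ = 2 `^ (- (a + 1))); last first.
    by rewrite opprD powRD ?(gt_eqF two0) ?implybT// powR_inv1//; field.
  by rewrite -powR_invn// ler_powR//; lra.
have M0 : (0 : R) < 2 ^+ M by exact: exprn_gt0.
have F2 y : x1 < y -> F y <= 2 ^+ M * F (2 * y).
  move=> hy; have y0 : 0 < y by exact: lt_trans hy.
  have /andP[h _] := H y hy; rewrite -ler_pdivrMl//; apply: le_trans h.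
  by rewrite ler_wpM2r// ltW// F0.
exists M, (2 ^+ M), (2 * x1); split => //; first by rewrite mulr_gt0.
move=> x y hy hx; have y0 : 0 < y by lra.
apply: (@dyadic_ind _ (fun x => F y <= 2 ^+ M * F x * (x / y) ^+ M) y) hx => //.
  move=> {}x /andP[yx x2]; have x0 : 0 < x by lra.
  apply: le_trans (F2 y _) _; first lra.
  rewrite -mulrA ler_pM2l//; apply: le_trans (Fdec x2) _.
  by rewrite ler_peMr ?(ltW (F0 x0))// exprn_ege1// ler_pdivlMr// mul1r.
move=> {}x hx IH; have x0 : 0 < x by lra.
apply: le_trans IH _.
have K : F x <= 2 ^+ M * F (2 * x) by apply: F2; lra.
rewrite -(mulrA 2 x) [(2 * (x / y)) ^+ M]exprMn; set q := 2 ^+ M in M0 K *; set f := F (2 * x) in K *.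
set v := (x / y) ^+ M; rewrite [leRHS](_ : _ = q * (q * f) * v); last by ring.
by rewrite ler_wpM2r ?exprn_ge0 ?divr_ge0 ?(ltW x0) ?(ltW y0)// ler_pM2l.
Qed.

Hypotheses (G0 : forall y, 0 <= G y)
  (Gbounded : forall x, exists C, forall y, 0 <= y <= x -> G y <= C).

(** Integer powers, the same in both directions, suit the Gamma estimate: multiplied by a higher
    power of y they remain monomials, whose Gamma moments are explicit. *)
Lemma potter_bound : exists N C x0, [/\ 0 < C, 0 < x0 &
  forall x y, x0 <= x -> 0 < y -> G y <= C * G x * ((y / x) ^+ N + (x / y) ^+ N)].
Proof.
have [M [C [x1 [C0 x10 H]]]] := regularly_varying_doubling.
have [N0 bN] : exists N : nat, `|b| <= N%:R.
  by exists (Num.truncn `|b|).+1; exact: ltW (truncnS_gt _).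
have N1 : \forall y \near pinfty_nbhs R, 2^-1 <= G y / (y `^ b * F y).
  by apply: (cvgr_ge _ hG); lra.
have N2 : \forall y \near pinfty_nbhs R, G y / (y `^ b * F y) <= 2.
  by apply: (cvgr_le _ hG); lra.
have [x2 x20 H2] := (nearyP _).1 (filterI N1 N2).
pose x0 := x1 + x2; have x00 : 0 < x0 by rewrite /x0; lra.
have Gy y : x0 <= y -> 2^-1 * (y `^ b * F y) <= G y <= 2 * (y `^ b * F y).
  move=> hy; have y0 : 0 < y by exact: lt_le_trans hy.
  have [] := H2 y (ltac:(rewrite /x0 in hy; lra)).
  by rewrite ler_pdivlMr ?ler_pdivrMr ?mulr_gt0 ?powR_gt0 ?F0// => -> ->.
have Gpos y : x0 <= y -> 0 < G y.
  move=> hy; have y0 : 0 < y by exact: lt_le_trans hy.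
  have /andP[h _] := Gy y hy; apply: lt_le_trans h; rewrite !mulr_gt0 ?powR_gt0 ?F0//; lra.
have A x y : x0 <= x -> x0 <= y ->
    G y <= 16 * (1 + C) * G x * ((y / x) ^+ (N0 + M) + (x / y) ^+ (N0 + M)).
  move=> hx hy; have xp : 0 < x by exact: lt_le_trans hx.
  have yp : 0 < y by exact: lt_le_trans hy.
  have /andP[_ g2] := Gy y hy; have /andP[g1 _] := Gy x hx.
  have w0 : 0 < y / x by rewrite divr_gt0.
  have v0 : 0 < x / y by rewrite divr_gt0.
  have wE : y `^ b = (y / x) `^ b * x `^ b.
    by rewrite -powRM ?divr_ge0 ?(ltW xp) ?(ltW yp)// divfK// gt_eqF.
  have wb : (y / x) `^ b <= (y / x) ^+ N0 + (x / y) ^+ N0.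
    by have := powR_le_sum w0 bN; rewrite invf_div.
  have vM : 0 < (x / y) ^+ M by rewrite exprn_gt0.
  have FM : F y <= (1 + C) * F x * (1 + (x / y) ^+ M).
    have Fx := F0 xp.
    have [yx|xy] := leP y x.
      apply: le_trans (H x y _ yx) _; first by rewrite /x0 in hy; lra.
      by apply: ler_pM; rewrite ?mulr_ge0 ?(ltW C0) ?(ltW Fx) ?(ltW vM)//; nra.
    apply: le_trans (Fdec (ltW xy)) _.
    have k1 := mulr_gt0 C0 Fx; have k2 := mulr_gt0 k1 vM; have k3 := mulr_gt0 Fx vM.
    by rewrite [leRHS](_ : _ = F x + C * F x + F x * (x / y) ^+ M + C * F x * (x / y) ^+ M); [lra|ring].
  have sum : ((y / x) ^+ N0 + (x / y) ^+ N0) * (1 + (x / y) ^+ M) <=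
      4 * ((y / x) ^+ (N0 + M) + (x / y) ^+ (N0 + M)).
    have vw : (x / y) = (y / x)^-1 by rewrite invf_div.
    have [w1|w1] := leP 1 (y / x).
      have i1 : (x / y) <= 1 by rewrite vw invf_le1.
      have i2 : (x / y) ^+ N0 <= 1 by rewrite exprn_ile1 ?(ltW v0).
      have i3 : (x / y) ^+ M <= 1 by rewrite exprn_ile1 ?(ltW v0).
      have i4 : 1 <= (y / x) ^+ N0 by rewrite exprn_ege1.
      have i5 : (y / x) ^+ N0 <= (y / x) ^+ (N0 + M) by rewrite ler_weXn2l// leq_addr.
      have i6 : 0 <= (x / y) ^+ (N0 + M) by rewrite exprn_ge0 ?(ltW v0).
      have i7 : 0 <= (x / y) ^+ N0 by rewrite exprn_ge0 ?(ltW v0).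
      nra.
    have i1 : 1 <= x / y by rewrite vw invf_ge1// ltW.
    have i2 : (y / x) ^+ N0 <= 1 by rewrite exprn_ile1 ?(ltW w0) ?(ltW w1).
    have i3 : 1 <= (x / y) ^+ M by rewrite exprn_ege1.
    have i4 : 1 <= (x / y) ^+ N0 by rewrite exprn_ege1.
    have i6 : 0 <= (y / x) ^+ (N0 + M) by rewrite exprn_ge0 ?(ltW w0).
    have i7 : 0 <= (y / x) ^+ N0 by rewrite exprn_ge0 ?(ltW w0).
    rewrite [(x / y) ^+ (N0 + M)]exprD; nra.
  have xb := powR_gt0 b xp; have Fx := F0 xp.
  apply: le_trans g2 _.
  have U : y `^ b * F y <= (((y / x) ^+ N0 + (x / y) ^+ N0) * x `^ b) * ((1 + C) * F x * (1 + (x / y) ^+ M)).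
    rewrite wE; apply: ler_pM => //; rewrite ?mulr_ge0 ?powR_ge0 ?(ltW (F0 yp))//.
    by rewrite ler_wpM2r ?powR_ge0.
  apply: le_trans (_ : 2 * ((1 + C) * (x `^ b * F x) *
      (4 * ((y / x) ^+ (N0 + M) + (x / y) ^+ (N0 + M)))) <= _).
    rewrite ler_pM2l//; apply: le_trans U _.
    rewrite [leLHS](_ : _ = (1 + C) * (x `^ b * F x) *
      (((y / x) ^+ N0 + (x / y) ^+ N0) * (1 + (x / y) ^+ M))); last by ring.
    by rewrite ler_wpM2l// !mulr_ge0 ?(ltW xb) ?(ltW Fx)//; lra.
  set K := (y / x) ^+ (N0 + M) + (x / y) ^+ (N0 + M).
  have K0 : 0 <= K by rewrite addr_ge0 ?exprn_ge0 ?(ltW w0) ?(ltW v0).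
  rewrite [leLHS](_ : _ = 8 * (1 + C) * (x `^ b * F x) * K); last by ring.
  rewrite ler_wpM2r//; set wx := x `^ b * F x in g1 *; nra.
(* For y below x0 the bound of G on [0, x0] is traded for a multiple of [G x0], and x / x0 <= x / y
   carries the estimate at x0 over to y. *)
have [C1 HC1] := Gbounded x0.
have C10 : 0 <= C1 by apply: le_trans (HC1 0 _); rewrite ?lexx ?(ltW x00).
have Gx0 := Gpos x0 (lexx _).
exists (N0 + M)%N, (16 * (1 + C) * (1 + 2 * (C1 / G x0))), x0; split => //.
  rewrite !mulr_gt0//; first lra.
  have : 0 <= C1 / G x0 by rewrite divr_ge0 ?(ltW Gx0).
  lra.
move=> x y hx y0; have xp : 0 < x by exact: lt_le_trans hx.
have Gx := Gpos x hx; set N := (N0 + M)%N.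
have D0 : 0 <= C1 / G x0 by rewrite divr_ge0 ?(ltW Gx0).
have S0 : 0 <= (y / x) ^+ N + (x / y) ^+ N.
  by rewrite addr_ge0// exprn_ge0// divr_ge0 ?(ltW y0) ?(ltW xp).
have [x0y|yx0] := leP x0 y.
  apply: le_trans (A x y hx x0y) _; rewrite ler_wpM2r// ler_wpM2r ?(ltW Gx)//.
  by rewrite ler_peMr//; [lra|nra].
have h1 : G y <= C1 / G x0 * G x0.
  by rewrite divfK ?gt_eqF//; apply: HC1; rewrite (ltW y0) ltW.
have h2 := A x x0 hx (lexx _); rewrite -/N in h2.
have v1 : 1 <= x / x0 by rewrite ler_pdivlMr// mul1r.
have u1 : (x0 / x) ^+ N <= 1.
  by rewrite exprn_ile1 ?divr_ge0 ?(ltW x00) ?(ltW xp)// ler_pdivrMr// mul1r.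
have v2 : (x / x0) ^+ N <= (x / y) ^+ N.
  rewrite lerXn2r ?nnegrE ?divr_ge0 ?(ltW x00) ?(ltW xp) ?(ltW y0)//.
  by rewrite ler_wpM2l ?(ltW xp)// lef_pV2// ltW.
have v3 : 1 <= (x / x0) ^+ N by rewrite exprn_ege1.
have yx : 0 <= (y / x) ^+ N by rewrite exprn_ge0// divr_ge0 ?(ltW y0) ?(ltW xp).
apply: le_trans h1 _.
set D := C1 / G x0 in D0 *; set U := (x / y) ^+ N in S0 v2 *; set W := (y / x) ^+ N in S0 yx *.
have h3 : G x0 <= 16 * (1 + C) * G x * (2 * U).
  apply: le_trans h2 _; rewrite ler_wpM2l ?mulr_ge0 ?(ltW Gx)//; [lra|lra].
apply: le_trans (ler_wpM2l D0 h3) _.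
rewrite [leLHS](_ : _ = 16 * (1 + C) * G x * (2 * D * U)); last by ring.
rewrite [leRHS](_ : _ = 16 * (1 + C) * G x * ((1 + 2 * D) * (W + U))); last by ring.
have A0 : 0 <= 16 * (1 + C) * G x by rewrite !mulr_ge0 ?(ltW Gx)//; lra.
rewrite ler_wpM2l//; have DW := mulr_ge0 D0 yx; lra.
Qed.

End light_tail.

(** * Concentration of Gamma mixtures *)

Section gamma_mixture.
Context {R : realType}.
Variables (H : R -> R) (l r : R).
Hypotheses (dH : density H) (l0 : 0 < l) (r0 : 0 < r).
Let gam := l + r.
Let gam0 : 0 < gam. Proof. by rewrite addr_gt0. Qed.
Let G y := expR (r * y) * H y.
Let Er := (fun y : R => expR (- (r * y))).

Lemma density_exp : density Er.
Proof.
have := density_scale r0 (@density_exp1 R); congr density.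
Qed.

Let J := dens Er.
Let PJ := positive_dens density_exp.
Let M k := lap J k l.

Lemma lap_exp k : M k = k`!%:R / gam ^+ k.+1.
Proof.
have lr : 0 < l / r by rewrite divr_gt0.
have ri : 0 < r^-1 by rewrite invr_gt0.
have := dens_lap_scale k ri l0 (@density_exp1 R).
rewrite invrK -/Er -/J -/(M k) mulrC lap_exp1// => h.
have rk : r ^+ k.+1 != 0 by rewrite expf_neq0// gt_eqF.
have qk : (1 + l / r) ^+ k.+1 != 0 by rewrite expf_neq0// gt_eqF// ltr_wpDl.
have -> : gam ^+ k.+1 = r ^+ k.+1 * (1 + l / r) ^+ k.+1.
  by rewrite -exprMn; congr (_ ^+ _); rewrite /gam; field; rewrite gt_eqF.
by apply: (mulfI rk); rewrite -h; field; rewrite rk qk.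
Qed.

Let M0 k : 0 < M k. Proof. by rewrite lap_exp divr_gt0 ?exprn_gt0// ltr0n fact_gt0. Qed.

Lemma cvg_nat_ratio (p q : nat) : (n + p)%:R / (n + q)%:R @[n --> \oo] --> (1 : R).
Proof.
apply/cvgrPdist_le => e e0; near=> n.
have n0 : (0 < n)%N by near: n; exact: nbhs_infty_gt.
have s0 : 0 < (n + q)%:R :> R by rewrite ltr0n addn_gt0 n0.
have ne : (p + q)%:R / e <= n%:R by near: n; exact: nbhs_infty_ger.
rewrite -(ler_pM2r s0) -{2}(ger0_norm (ltW s0)) -normrM mulrBl mul1r divfK ?gt_eqF//.
rewrite ler_pdivrMr// mulrC in ne.
rewrite !natrD opprD addrACA subrr add0r.
apply: (@le_trans _ _ (p + q)%:R).
  by apply: le_trans (ler_normB _ _) _; rewrite natrD !ger0_norm ?ler0n// addrC.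
by apply: le_trans ne _; rewrite ler_wpM2l ?(ltW e0)// lerDl.
Unshelve. all: end_near. Qed.

Section shift.
Variable N : nat.
(** The moment order is n + N so that multiplying by (x / y)^N leaves the nonnegative power y^n. *)
Let x n : R := (n + N)%:R / gam.

(** For fixed j, (n + j)! is equivalent to n! (n + N)^j. *)
Lemma moment_ratio i : M (n + i) * (x n ^+ N / x n ^+ i) / M (n + N) @[n --> \oo] --> (1 : R).
Proof.
have B j : M (n + j) / (M n * x n ^+ j) @[n --> \oo] --> (1 : R).
  elim: j => [|j IH].
    rewrite (_ : (fun n => _) = (fun=> 1)); first exact: cvg_cst.
    by apply/funext => n; rewrite addn0 expr0 mulr1 divff// gt_eqF// M0.
  rewrite -[X in _ --> X]mul1r.
  apply: cvg_trans (cvgM IH (cvg_nat_ratio j.+1 N)); apply: near_eq_cvg; near=> n.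
  have n0 : (0 < n)%N by near: n; exact: nbhs_infty_gt.
  have s0 : 0 < (n + N)%:R :> R by rewrite ltr0n addn_gt0 n0.
  rewrite /= addnS !lap_exp factS natrM /x !expr_div_n [gam ^+ (n + j).+2]exprS.
  rewrite [(n + N)%:R ^+ j.+1]exprS [gam ^+ j.+1]exprS -addnS.
  have f0 : (n`!%:R : R) != 0 by rewrite pnatr_eq0 -lt0n fact_gt0.
  have gA k : gam ^+ k != 0 by rewrite expf_neq0// gt_eqF.
  have sj : (n + N)%:R ^+ j != 0 :> R by rewrite expf_neq0// gt_eqF.
  have sn : (n + N)%:R != 0 :> R by rewrite gt_eqF.
  have g0 : gam != 0 by rewrite gt_eqF.
  move: (gA (n + j.+1)%N) (gA n.+1) (gA j) sj sn f0 g0.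
  move: ((n + N)%:R : R) (n`!%:R : R) ((n + j)`!%:R : R) ((n + j.+1)%:R : R)
    ((n + N)%:R ^+ j) (gam ^+ j) (gam ^+ n.+1) (gam ^+ (n + j.+1)) => c5 c6 c8 c9 c4 c3 c2 c1.
  by move=> e1 e2 e3 e4 e5 e6 e7; field; rewrite e1 e2 e3 e4 e5 e6 e7.
have BN : (M (n + N) / (M n * x n ^+ N))^-1 @[n --> \oo] --> (1 : R).
  by rewrite -[X in _ --> X]invr1; apply: cvgV => //; exact: oner_neq0.
rewrite -[X in _ --> X]mul1r; apply: cvg_trans (cvgM (B i) BN); apply: near_eq_cvg; near=> n.
have n0 : (0 < n)%N by near: n; exact: nbhs_infty_gt.
have x0 : 0 < x n by rewrite divr_gt0// ltr0n addn_gt0 n0.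
have m1 := M0 (n + N); have m2 := M0 n.
have xk k : x n ^+ k != 0 by rewrite expf_neq0// gt_eqF.
have := gt_eqF m1; have := gt_eqF m2; have := xk i; have := xk N; rewrite /=.
move: (x n ^+ i) (x n ^+ N) (M n) (M (n + N)) (M (n + i)) => c1 c2 c3 c4 c5 e1 e2 e3 e4.
by field; rewrite e1 e2 e3 e4.
Unshelve. all: end_near. Qed.

Variables (C : R) (x0 : R).
Hypotheses (C0 : 0 < C) (x00 : 0 < x0).
Hypothesis (H0 : forall y, 0 <= H y).
Hypothesis potter : forall u y, x0 <= u -> 0 < y -> G y <= C * G u * ((y / u) ^+ N + (u / y) ^+ N).
Hypothesis win : forall eta, 0 < eta -> exists2 e, 0 < e & exists2 x0, 0 < x0 &
  forall x y, x0 <= x -> `|y - x| <= e * x -> `|G y - G x| <= eta * G x.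

Hypothesis Gpos : forall y, x0 <= y -> 0 < G y.

Let G0 y : 0 <= G y. Proof. by rewrite mulr_ge0 ?expR_ge0. Qed.

Let T n i y := (x n ^+ N / x n ^+ i) * (y ^+ (n + i) * expR (- (l * y))).
Let Ta n i : admissible (T n i).
Proof. by apply: admissibleZ; exact: admissible_pow_exp. Qed.

(* [y ^ (n + N) (y / x - 1)^2 ((y / x)^N + (x / y)^N) exp (- l y)], expanded:
   it dominates the contribution of the [y] outside of the window around [x]. *)
Let W n y := T n (2 + (N + N)) y + -2 * T n (1 + (N + N)) y + T n (0 + (N + N)) y +
  T n 2%N y + -2 * T n 1%N y + T n 0%N y.

Let JW n : admissible (W n) /\ J (W n) = J (T n (2 + (N + N))) + -2 * J (T n (1 + (N + N))) +
  J (T n (0 + (N + N))) + J (T n 2%N) + -2 * J (T n 1%N) + J (T n 0%N).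
Proof.
have Z i := admissibleZ (-2) (Ta n i).
have a2 := admissibleD (Ta n (2 + (N + N))) (Z (1 + (N + N))%N).
have a3 := admissibleD a2 (Ta n (0 + (N + N))).
have a4 := admissibleD a3 (Ta n 2%N).
have a5 := admissibleD a4 (Z 1%N).
split; first exact: admissibleD a5 (Ta n 0%N).
have D5 := pfD PJ a5 (Ta n 0%N); have D4 := pfD PJ a4 (Z 1%N).
have D3 := pfD PJ a3 (Ta n 2%N); have D2 := pfD PJ a2 (Ta n (0 + (N + N))).
have D1 := pfD PJ (Ta n (2 + (N + N))) (Z (1 + (N + N))%N).
have Z1 i := pfZ PJ (-2) (Ta n i).
by rewrite /J -!Z1 -D1 -D2 -D3 -D4 -D5.
Qed.

Let JT n i : J (T n i) = M (n + i) * (x n ^+ N / x n ^+ i).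
Proof.
have := pfZ PJ (x n ^+ N / x n ^+ i) (admissible_pow_exp (n + i) l0).
by rewrite [RHS]mulrC.
Qed.

(** All six normalized moments tend to 1, and their coefficients 1 - 2 + 1 + 1 - 2 + 1 add up to
    0. *)
Let JW_cvg : J (W n) / M (n + N) @[n --> \oo] --> (0 : R).
Proof.
have m := moment_ratio.
have Z i : -2 * (M (n + i) * (x n ^+ N / x n ^+ i) / M (n + N)) @[n --> \oo] --> (-2 * 1 : R).
  by apply: cvgM => //; exact: cvg_cst.
rewrite [X in _ --> X](_ : 0 = 1 + -2 * 1 + 1 + 1 + -2 * 1 + 1 :> R); last by ring.
pose q i n := M (n + i) * (x n ^+ N / x n ^+ i) / M (n + N).
rewrite [X in X @ _](_ : _ = (fun n => q (2 + (N + N))%N n + -2 * q (1 + (N + N))%N n +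
    q (0 + (N + N))%N n + q 2%N n + -2 * q 1%N n + q 0%N n)).
  by do 5![apply: cvgD; last by [exact: m|exact: Z]]; exact: m.
apply/funext => n; have JTq i : J (T n i) / M (n + N) = q i n by rewrite JT.
by rewrite (proj2 (JW n)) 5!mulrDl -2![_ * J _ / _]mulrA !JTq.
Qed.

Let WE n y : 0 < y -> 0 < x n -> W n y =
  y ^+ (n + N) * expR (- (l * y)) * ((y / x n - 1) ^+ 2 * ((y / x n) ^+ N + (x n / y) ^+ N)).
Proof.
move=> y0 xn0; rewrite /W /T; move: (x n) xn0 => u u0; rewrite !exprD !expr_div_n.
have b0 : y ^+ N != 0 by rewrite expf_neq0// gt_eqF.
have c0 : u ^+ N != 0 by rewrite expf_neq0// gt_eqF.
move: (y ^+ N) (u ^+ N) (y ^+ n) (expR _) b0 c0 => b c a e b0 c0.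
by field; rewrite c0 b0 !gt_eqF.
Qed.

Lemma mixture_cvg : lap (dens H) (n + N) l / (M (n + N) * G (x n)) @[n --> \oo] --> (1 : R).
Proof.
apply/cvgrPdist_le => eta eta0.
have eta2 : 0 < eta / 2 by rewrite divr_gt0.
have [e e0 [x1 x10 hw]] := win eta2.
(* Off the window, Potter gives |G(y) - G(x)| <= (1 + C) G(x) times the sum of powers, and (y / x -
   1)^2 >= e^2 as in Chebyshev's inequality. *)
pose D := (1 + C) / e ^+ 2.
have D0 : 0 < D by rewrite /D divr_gt0 ?exprn_gt0 ?addr_gt0.
have cW : \forall n \near \oo, J (W n) / M (n + N) <= eta / 2 / D.
  by apply: (cvgr_le _ JW_cvg); rewrite divr_gt0.
near=> n.
have n0 : (0 < n)%N by near: n; exact: nbhs_infty_gt.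
have xn0 : 0 < x n by rewrite divr_gt0// ltr0n addn_gt0 n0.
have xn1 : x0 + x1 <= x n.
  rewrite ler_pdivlMr// natrD ler_wpDr//.
  by near: n; exact: nbhs_infty_ger.
have hW : J (W n) / M (n + N) <= eta / 2 / D by near: n.
have Gx : 0 < G (x n) by apply: Gpos; lra.
pose E y := y ^+ (n + N) * expR (- (l * y)).
have Ea : admissible E by exact: admissible_pow_exp.
have pt y : 0 <= y -> `|H y * E y - Er y * (G (x n) * E y)| <=
    Er y * (G (x n) * (eta / 2 * E y + D * W n y)).
  rewrite le0r => /orP[/eqP->|y0].
    (* The Potter bound holds for y > 0; at y = 0 all powers vanish because n > 0. *)
    have z k : (0 < k)%N -> (0 : R) ^+ k = 0 by move=> h; rewrite expr0n gtn_eqF.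
    rewrite /E /W /T !z ?addn_gt0 ?n0//.
    by rewrite !(mul0r, mulr0, addr0, subr0) normr0.
  have HE : H y = Er y * G y.
    by rewrite /Er /G mulrA -expRD addNr expR0 mul1r.
  have Ey : 0 <= E y by rewrite mulr_ge0 ?expR_ge0// exprn_ge0// ltW.
  rewrite HE -mulrA -mulrBr -mulrBl normrM (ger0_norm (expR_ge0 _)) ler_wpM2l ?expR_ge0//.
  rewrite normrM (ger0_norm Ey) WE// -/(E y).
  set S := (y / x n) ^+ N + (x n / y) ^+ N.
  have w0 : 0 < y / x n by rewrite divr_gt0.
  have v0 : 0 < x n / y by rewrite divr_gt0.
  have S1 : 1 <= S.
    have [w1|w1] := leP 1 (y / x n).
      by rewrite /S ler_wpDr ?exprn_ge0 ?(ltW v0)// exprn_ege1.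
    by rewrite /S ler_wpDl ?exprn_ge0 ?(ltW w0)// exprn_ege1// -invf_div invf_ge1// ltW.
  rewrite [leRHS](_ : _ = G (x n) * (eta / 2 + D * ((y / x n - 1) ^+ 2 * S)) * E y); last by ring.
  rewrite ler_wpM2r//.
  have [yin|yout] := leP `|y - x n| (e * x n).
    have x1n : x1 <= x n by apply: le_trans xn1; rewrite lerDr ltW.
    apply: le_trans (hw _ _ x1n yin) _.
    rewrite mulrC ler_pM2l// lerDl; apply: mulr_ge0; first exact: ltW.
    by apply: mulr_ge0; [exact: sqr_ge0|exact: le_trans ler01 S1].
  have yx : e ^+ 2 <= (y / x n - 1) ^+ 2.
    have -> : (y / x n - 1) ^+ 2 = (`|y - x n| / x n) ^+ 2.
      have -> : y / x n - 1 = (y - x n) / x n by field; rewrite gt_eqF.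
      by rewrite !exprMn -normrX (ger0_norm (sqr_ge0 _)).
    have h : e <= `|y - x n| / x n by rewrite ler_pdivlMr// ltW.
    rewrite lerXn2r ?nnegrE ?(ltW e0)//; exact: le_trans (ltW e0) h.
  apply: le_trans (_ : G y + G (x n) <= _).
    by apply: le_trans (ler_normB _ _) _; rewrite !ger0_norm ?G0.
  apply: le_trans (_ : G (x n) * ((1 + C) * S) <= _).
    have x0n : x0 <= x n by apply: le_trans xn1; rewrite lerDl ltW.
    have hp := potter x0n y0; rewrite -/S in hp.
    have : G (x n) * 1 <= G (x n) * S by rewrite ler_pM2l.
    by rewrite mulr1; lra.
  rewrite ler_pM2l//; apply: le_trans (_ : D * ((y / x n - 1) ^+ 2 * S) <= _); last first.
    by rewrite lerDr ltW.
  rewrite mulrA ler_wpM2r//; first lra.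
  by rewrite /D mulrAC ler_pdivlMr ?exprn_gt0// ler_pM2l// addr_gt0.
have PH := positive_dens dH.
have [Wa JWn] := JW n.
pose U y := G (x n) * (eta / 2 * E y + D * W n y).
have Ua : admissible U by apply: admissibleZ; apply: admissibleD; exact: admissibleZ.
have GE := admissibleZ (G (x n)) Ea.
have JU : J U = G (x n) * (eta / 2 * M (n + N) + D * J (W n)).
  have Z1 := admissibleZ (eta / 2) Ea; have Z2 := admissibleZ D Wa.
  have D1 := pfZ PJ (eta / 2) Ea; have D2 := pfZ PJ D Wa.
  have D3 := pfD PJ Z1 Z2; have D4 := pfZ PJ (G (x n)) (admissibleD Z1 Z2).
  by apply: etrans D4 _; congr (_ * _); apply: etrans D3 _; rewrite D1 D2.
have MN := M0 (n + N).
have JW0 : D * J (W n) <= eta / 2 * M (n + N).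
  by move: hW; rewrite ler_pdivrMr// mulrAC ler_pdivlMr// mulrC.
have JUle : J U <= eta * (M (n + N) * G (x n)).
  rewrite JU [leRHS](_ : _ = G (x n) * (eta * M (n + N))); last by ring.
  by rewrite ler_pM2l//; lra.
have up : lap (dens H) (n + N) l <= J (fun y => G (x n) * E y + U y).
  apply: dens_le => //; [exact: density_exp|exact: admissibleD|] => y y0.
  have := pt y y0; rewrite ler_distl => /andP[_]; rewrite -/(U y) -mulrDr; exact.
have lo : J (fun y => G (x n) * E y - U y) <= lap (dens H) (n + N) l.
  apply: dens_le => //; [exact: density_exp|exact: admissibleB|] => y y0.
  have := pt y y0; rewrite ler_distl => /andP[+ _]; rewrite -/(U y) -mulrBr; exact.
have GJ : J (fun y => G (x n) * E y) = G (x n) * M (n + N) := pfZ PJ (G (x n)) Ea.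
have upE : J (fun y => G (x n) * E y + U y) = G (x n) * M (n + N) + J U.
  by rewrite -GJ; exact: (pfD PJ GE Ua).
have loE : J (fun y => G (x n) * E y - U y) = G (x n) * M (n + N) - J U.
  by rewrite -GJ; exact: (pfB PJ GE Ua).
rewrite upE in up; rewrite loE in lo.
have MG : 0 < M (n + N) * G (x n) by rewrite mulr_gt0.
rewrite distrC ler_distl ler_pdivlMr// ler_pdivrMr//; apply/andP; split.
  by apply: le_trans lo; rewrite mulrBl mul1r [G (x n) * _]mulrC lerD2l lerN2.
by apply: le_trans up _; rewrite mulrDl mul1r [G (x n) * _]mulrC lerD2l.
Unshelve. all: end_near. Qed.

End shift.
End gamma_mixture.

(** * Tails of nearly geometric sequences *)

Section geometric_tail.
Context {R : realType}.
Implicit Types (s p T : R^nat).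

Lemma nonincreasing_cvg0_ge0 s k : (forall j, (k <= j)%N -> s j.+1 <= s j) ->
  s j @[j --> \oo] --> 0 -> forall j, (k <= j)%N -> 0 <= s j.
Proof.
move=> dec s0 j kj; apply/ler_addgt0Pr => e e0.
have mono m : s (j + m)%N <= s j.
  elim: m => [|m IH]; first by rewrite addn0.
  by rewrite addnS; apply: le_trans IH; apply: dec; rewrite (leq_trans kj)// leq_addr.
have /cvgrPdist_le/(_ e e0) H := s0.
near \oo => m; have jm : (j <= m)%N by near: m; exact: nbhs_infty_ge.
have : `|0 - s m| <= e by near: m.
rewrite sub0r normrN ler_norml => /andP[h _].
have := mono (m - j)%N; rewrite subnKC//; lra.
Unshelve. all: end_near. Qed.

(* For [c] above (resp. below) [th], the sequence [c (p j + T j) - T j] is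
   eventually monotone with limit 0, hence of constant sign. *)
Lemma geometric_tail p T (th : R) : 0 < th < 1 -> (\forall k \near \oo, 0 < p k) ->
  (forall j, T j = T j.+1 + p j.+1) -> T j @[j --> \oo] --> 0 ->
  p k.+1 / p k @[k --> \oo] --> th -> T j / p j @[j --> \oo] --> th / (1 - th).
Proof.
move=> /andP[th0 th1] p0 TE T0 pth.
have TS : T j.+1 @[j --> \oo] --> 0 by rewrite (cvg_shiftS T).
have pS : p j.+1 @[j --> \oo] --> 0.
  rewrite (_ : (fun j => p j.+1) = (fun j => T j - T j.+1)).
    by rewrite -[X in _ --> X](subrr 0); exact: cvgB.
  by apply/funext => j; rewrite [T j]TE; ring.
have p0' : p j @[j --> \oo] --> 0 by rewrite -(cvg_shiftS p).
have lin (c : R) : c * (p j + T j) - T j @[j --> \oo] --> 0.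
  rewrite [X in _ --> X](_ : 0 = c * (0 + 0) - 0 :> R); last by rewrite addr0 mulr0 subr0.
  by apply: cvgB => //; apply: cvgM; [exact: cvg_cst|exact: cvgD].
have id0 : e @[e --> (0 : R)^'+] --> (0 : R) by exact: cvg_at_right_filter.
have up : (th + d) / (1 - th - d) @[d --> (0 : R)^'+] --> th / (1 - th).
  rewrite [X in _ --> X](_ : _ = (th + 0) / (1 - th - 0)); last by rewrite addr0 subr0.
  apply: cvgM; first by apply: cvgD => //; exact: cvg_cst.
  apply: cvgV; first by rewrite subr0 gt_eqF// subr_gt0.
  by apply: cvgB => //; exact: cvg_cst.
have lo : (th - d) / (1 - th + d) @[d --> (0 : R)^'+] --> th / (1 - th).
  rewrite [X in _ --> X](_ : _ = (th - 0) / (1 - th + 0)); last by rewrite addr0 subr0.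
  apply: cvgM; first by apply: cvgB => //; exact: cvg_cst.
  apply: cvgV; first by rewrite addr0 gt_eqF// subr_gt0.
  by apply: cvgD => //; exact: cvg_cst.
apply/cvgrPdist_le => e e0.
have [d [d0 d1 hu hl]] : exists d, [/\ 0 < d, d < 1 - th,
    (th + d) / (1 - th - d) <= th / (1 - th) + e &
    th / (1 - th) - e <= (th - d) / (1 - th + d)].
  near (0 : R)^'+ => d; exists d; split.
  - by near: d; exact: nbhs_right_gt.
  - by near: d; apply: nbhs_right_lt; lra.
  - by near: d; apply: (cvgr_le _ up); lra.
  - by near: d; apply: (cvgr_ge _ lo); lra.
have /cvgrPdist_le/(_ d d0) pthd := pth.
have [k _ hk] := filterI p0 pthd.
have hp j : (k <= j)%N -> (th - d) * p j <= p j.+1 <= (th + d) * p j.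
  by move=> /hk [/= pj]; rewrite ler_distlC ler_pdivlMr ?ler_pdivrMr.
(* The increment of such a sequence is [p i.+1 - c * p i], since [T i = T i.+1 + p i.+1]. *)
have A j : (k <= j)%N -> 0 <= (th + d) * (p j + T j) - T j.
  apply: (@nonincreasing_cvg0_ge0 (fun j => (th + d) * (p j + T j) - T j)) => // i ki.
  by have /andP[_ h] := hp i ki; rewrite [T i]TE; lra.
have B j : (k <= j)%N -> 0 <= - ((th - d) * (p j + T j) - T j).
  apply: (@nonincreasing_cvg0_ge0 (fun j => - ((th - d) * (p j + T j) - T j))) => // [i ki|].
    by have /andP[h _] := hp i ki; rewrite [T i]TE; lra.
  by rewrite -[X in _ --> X]oppr0; exact: cvgN.
near=> j; have kj : (k <= j)%N by near: j; exact: nbhs_infty_ge.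
have [pj _] := hk j kj; have Aj := A j kj; have Bj := B j kj.
rewrite distrC ler_distl; apply/andP; split.
  apply: le_trans hl _; rewrite ler_pdivlMr// mulrAC ler_pdivrMr; last lra.
  lra.
apply: le_trans hu; rewrite ler_pdivrMr// mulrAC ler_pdivlMr; last lra.
lra.
Unshelve. all: end_near. Qed.

End geometric_tail.

(** * The queue during an exponentially tailed Type-2 service *)

Section light.
Context d {Omega : measurableType d} {R : realType} (P : probability Omega R).
Variable Q : retrial_queue P.
Variables (Iser Rque Rorb : {RV P >-> nat}) (X : {RV P >-> R}).
Hypothesis hstat : stationary Q Iser Rque Rorb X.
Hypothesis hrho : total_load Q < 1.
Variables (L : R -> R) (a1 a2 r : R).
Notation l1 := (rate Q Type1).
Notation l2 := (rate Q Type2).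
Notation F c := (rccdf (service Q c)).
Hypotheses (hL : slowly_varying L) (r0 : 0 < r).
Hypothesis hT1 : equivalent_at (pinfty_nbhs R) (F Type1) (fun t => t `^ (- a1) * L t).
Hypothesis hT2 : equivalent_at (pinfty_nbhs R) (F Type2)
  (fun t => expR (- (r * t)) * t `^ (- a2) * L t).
Hypothesis F2_gt0 : forall y, 0 < F Type2 y.

Let gam := l1 + r.
Let L1 : 0 < l1 := rate_gt0 Q Type1.
Let L2 : 0 < l2 := rate_gt0 Q Type2.
Let gam0 : 0 < gam. Proof. by rewrite addr_gt0. Qed.
Let G y := expR (r * y) * F Type2 y.
Let Gpos y : 0 < G y. Proof. by rewrite mulr_gt0 ?expR_gt0. Qed.
Let Lgt0 t : 0 < t -> 0 < L t. Proof. by have [_ + _] := hL; exact. Qed.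

Let Fdec c x y : x <= y -> F c y <= F c x. Proof. exact: rccdf_le. Qed.
Let rvF1 := regularly_varying_of_equiv (rccdf_ge0 (service Q Type1)) (@Fdec Type1) hL hT1.

Let hGL : G y / (y `^ (- a2) * L y) @[y --> pinfty_nbhs R] --> (1 : R).
Proof.
apply: cvg_trans hT2; apply: near_eq_cvg; near=> y.
have y0 : 0 < y by near: y; exact: nbhs_pinfty_gt.
have := Lgt0 y0; have := powR_gt0 (- a2) y0 => e1 e2.
rewrite /G expRN; have e3 := expR_gt0 (r * y).
by field; rewrite !gt_eqF.
Unshelve. all: end_near. Qed.

(** Eliminates L: the Type-1 tail, which is monotone, takes its place. *)
Let hG : G y / (y `^ (a1 - a2) * F Type1 y) @[y --> pinfty_nbhs R] --> (1 : R).
Proof.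
have hi : (F Type1 y / (y `^ (- a1) * L y))^-1 @[y --> pinfty_nbhs R] --> (1 : R).
  by rewrite -[X in _ --> X]invr1; apply: cvgV => //; exact: oner_neq0.
rewrite -[X in _ --> X]mulr1; apply: cvg_trans (cvgM hGL hi); apply: near_eq_cvg; near=> y.
have y0 : 0 < y by near: y; exact: nbhs_pinfty_gt.
have E : y `^ (a1 - a2) = y `^ (- a2) * (y `^ (- a1))^-1.
  by rewrite -powRN opprK -powRD ?(gt_eqF y0) ?implybT// addrC.
have := Lgt0 y0; have := powR_gt0 (- a2) y0; have := powR_gt0 (- a1) y0; have := rvF1.1 _ y0.
by move=> e1 e2 e3 e4; rewrite /= E; field; rewrite !gt_eqF.
Unshelve. all: end_near. Qed.

Let win := window (@Fdec Type1) rvF1 hG.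

Let a k := lap (dens (F Type2)) k l1 / (k`!%:R / gam ^+ k.+1 * G (k%:R / gam)).

Let a_cvg : a k @[k --> \oo] --> (1 : R).
Proof.
have Gb x : exists C, forall y, 0 <= y <= x -> G y <= C.
  exists (expR (r * x)) => y /andP[y0 yx]; rewrite -[leRHS]mulr1.
  by apply: ler_pM; rewrite ?expR_ge0 ?rccdf_ge0 ?rccdf_le1// ler_expR ler_wpM2l// ltW.
have [N [C [x0 [C0 x00 pot]]]] := potter_bound (@Fdec Type1) rvF1 hG
  (fun y => ltW (Gpos y)) Gb.
have := mixture_cvg (density_service Q Type2) L1 r0 C0 x00 (rccdf_ge0 _) pot win (fun y _ => Gpos y).
rewrite -(cvg_shiftn N a); apply: cvg_trans; apply: near_eq_cvg.
by near=> n; rewrite /a /= lap_exp.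
Unshelve. all: end_near. Qed.

Let th := l1 / gam.
Let p := pmf2 Iser Rque.
Let pE k : p k = l2 / gam * th ^+ k * G (k%:R / gam) * a k.
Proof.
rewrite /p (pmf2E hstat hrho) /mix2 /a /th expr_div_n exprS.
have gk : gam ^+ k != 0 by rewrite expf_neq0// gt_eqF.
have kf : (k`!%:R : R) != 0 by rewrite pnatr_eq0 -lt0n fact_gt0.
have Gk := Gpos (k%:R / gam); rewrite -/(service_dens Q Type2).
by field; rewrite kf gk !gt_eqF.
Qed.

Let p_gt0 : \forall k \near \oo, 0 < p k.
Proof.
have ha : \forall k \near \oo, 2^-1 <= a k by apply: (cvgr_ge _ a_cvg); lra.
apply: filterS ha => k ak; have ak0 : 0 < a k by apply: lt_le_trans ak; lra.
have th0 : 0 < th by exact: divr_gt0.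
rewrite pE; apply: mulr_gt0 => //; apply: mulr_gt0 => //.
by apply: mulr_gt0; [exact: divr_gt0|exact: exprn_gt0].
Qed.

(** k / gam and (k + 1) / gam eventually share any relative window, so [G] contributes a ratio
    tending to 1. *)
Let p_ratio : p k.+1 / p k @[k --> \oo] --> th.
Proof.
have Gr : G (k.+1%:R / gam) / G (k%:R / gam) @[k --> \oo] --> (1 : R).
  apply/cvgrPdist_le => eta eta0; have [e e0 [x0 x00 hw]] := win eta0.
  near=> k; have Gk := Gpos (k%:R / gam).
  rewrite -(ler_pM2r Gk) -{2}(ger0_norm (ltW Gk)) -normrM mulrBl mul1r divfK ?gt_eqF// distrC.
  apply: hw.
    by rewrite ler_pdivlMr//; near: k; exact: nbhs_infty_ger.
  rewrite -mulrBl -natr1 addrAC subrr add0r ger0_norm ?divr_ge0 ?(ltW gam0)//.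
  rewrite mulrA ler_wpM2r ?invr_ge0 ?(ltW gam0)// -ler_pdivrMl// mulr1.
  by near: k; exact: nbhs_infty_ger.
have aS : a k.+1 @[k --> \oo] --> (1 : R) by rewrite (cvg_shiftS a).
have ai : (a k)^-1 @[k --> \oo] --> (1 : R).
  by rewrite -[X in _ --> X]invr1; apply: cvgV => //; exact: oner_neq0.
have H : th * (G (k.+1%:R / gam) / G (k%:R / gam)) * (a k.+1 * (a k)^-1) @[k --> \oo] --> th * 1 * (1 * 1).
  by apply: cvgM; [apply: cvgM => //; exact: cvg_cst|exact: cvgM].
rewrite !mulr1 in H; apply: cvg_trans H; apply: near_eq_cvg.
have ha : \forall k \near \oo, 2^-1 <= a k by apply: (cvgr_ge _ a_cvg); lra.
apply: filterS ha => k ak; have ak0 : 0 < a k by apply: lt_le_trans ak; lra.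
have th0 : 0 < th by exact: divr_gt0.
rewrite !pE exprS; have tk : th ^+ k != 0 by rewrite expf_neq0// gt_eqF.
have := Gpos (k%:R / gam); move: (G _) => g g0.
by field; rewrite tk !gt_eqF.
Unshelve. all: end_near. Qed.

Let T (j : nat) := ftail (count_fun Iser Rque 2) j%:R.

Let TE j : T j = T j.+1 + p j.+1.
Proof.
have b k : bounded_mfun (fun om => (k%:R < (Rque om)%:R :> R)%R%:R : R).
  by apply: (@bounded_mfun_nat _ _ _ P Rque (fun n => (k%:R < n%:R :> R)%R%:R)) => n; rewrite ler0n lern1 leq_b1.
suff <- : T j - T j.+1 = p j.+1 by ring.
rewrite /T /ftail /count_fun -on_serverB//; congr on_server; apply/funext => om.
by move: (Rque om) => m; rewrite !ltr_nat; case: (ltngtP m j.+1) => h; rewrite ?subrr ?subr0.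
Qed.

Let T_cvg0 : T j @[j --> \oo] --> 0.
Proof.
apply: (@cvg_comp _ _ _ (fun j : nat => j%:R : R) _ _ (pinfty_nbhs R)); first exact: cvgr_idn.
exact: pf_tail0 (pos_count Iser Rque 2).
Qed.

Lemma equivalent_tail_light : 0 < load Q Type2 ->
  equivalent_at \oo (fun j => cond_prob P [set w | (j < Rque w)%N] [set w | Iser w = 2%N])
    (fun j => l2 * l1 * (l1 + r) `^ (a2 - 1) / (load Q Type2 * r)
           * (l1 / (l1 + r)) ^+ j * j%:R `^ (- a2) * L j%:R).
Proof.
move=> rho2; have th01 : 0 < th < 1.
  by rewrite /th divr_gt0//= ltr_pdivrMr// mul1r ltrDl.
have HT := geometric_tail th01 p_gt0 TE T_cvg0 p_ratio.
(* Summation of the geometric tail from j + 1 on; this puts r in the denominator of the result. *)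
have thE : th / (1 - th) = l1 / r.
  by rewrite /th /gam; field; rewrite -/gam !gt_eqF//= addrC addKr gt_eqF.
rewrite thE in HT.
have toy : (fun j : nat => j%:R : R) j @[j --> \oo] --> pinfty_nbhs R by exact: cvgr_idn.
have gi : 0 < gam^-1 by rewrite invr_gt0.
have h1 : G (gam^-1 * j%:R) / ((gam^-1 * j%:R) `^ (- a2) * L (gam^-1 * j%:R)) @[j --> \oo] --> (1 : R).
  exact: (cvg_comp _ _ toy (cvg_scaley gi hGL)).
have h2 : L (gam^-1 * j%:R) / L j%:R @[j --> \oo] --> (1 : R).
  by have [_ _ /(_ _ gi) hl] := hL; exact: (cvg_comp _ _ toy hl).
have H : T j / p j * a j * (G (gam^-1 * j%:R) / ((gam^-1 * j%:R) `^ (- a2) * L (gam^-1 * j%:R))) *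
    (L (gam^-1 * j%:R) / L j%:R) * (r / l1) @[j --> \oo] --> l1 / r * 1 * 1 * 1 * (r / l1).
  apply: cvgM; last exact: cvg_cst.
  by apply: cvgM => //; apply: cvgM => //; exact: cvgM.
rewrite [X in _ --> X](_ : _ = 1) in H; last by field; rewrite !gt_eqF.
apply: cvg_trans H; apply: near_eq_cvg.
have ha : \forall k \near \oo, 2^-1 <= a k by apply: (cvgr_ge _ a_cvg); lra.
near=> j; have ak : 2^-1 <= a j by near: j.
have ak0 : 0 < a j by apply: lt_le_trans ak; lra.
have j0 : 0 < j%:R :> R by rewrite ltr0n; near: j; exact: nbhs_infty_gt.
rewrite /cond_prob -ftail_count -(count_fun1 Iser Rque) (prob_busy2 hstat hrho) -/(T j).
rewrite pE -/th -/gam [j%:R / gam]mulrC.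
have pw : (gam^-1 * j%:R) `^ (- a2) = gam `^ a2 * j%:R `^ (- a2).
  by rewrite powRM ?(ltW gi) ?(ltW j0)// -powR_inv1 ?(ltW gam0)// -powRrM mulN1r opprK.
have pg : gam `^ (a2 - 1) = gam `^ a2 / gam.
  by rewrite powRD ?(gt_eqF gam0) ?implybT// powR_inv1// ltW.
rewrite pw pg; have e1 := powR_gt0 a2 gam0; have e2 := powR_gt0 (- a2) j0.
have e3 := Lgt0 (mulr_gt0 gi j0); have e4 := Lgt0 j0; have e5 := Gpos (gam^-1 * j%:R).
have th0 : 0 < th by have /andP[] := th01.
have e6 : 0 < th ^+ j by exact: exprn_gt0.
move: (gam `^ a2) (j%:R `^ (- a2)) (L (gam^-1 * j%:R)) (L j%:R) (G (gam^-1 * j%:R)) (th ^+ j) (T j)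
  e1 e2 e3 e4 e5 e6 => c1 c2 c3 c4 c5 c6 c7 e1 e2 e3 e4 e5 e6.
by field; rewrite !gt_eqF.
Unshelve. all: end_near. Qed.

End light.

Lemma eventually_pos_gt0 (R : realType) (F W : R -> R) :
  (forall x, 0 <= F x) -> (forall x y, x <= y -> F y <= F x) ->
  (forall t, 0 < t -> 0 < W t) -> equivalent_at (pinfty_nbhs R) F W -> forall x, 0 < F x.
Proof.
move=> F0 Fdec W0 h x.
have hn : \forall y \near pinfty_nbhs R, 2^-1 <= F y / W y by apply: (cvgr_ge _ h); lra.
near (pinfty_nbhs R) => y; have y0 : 0 < y by near: y; exact: nbhs_pinfty_gt.
have xy : x <= y by near: y; exact: nbhs_pinfty_ge (num_real _).
apply: lt_le_trans (Fdec _ _ xy).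
have : 2^-1 <= F y / W y by near: y.
rewrite lt0r F0 andbT; apply: contraTneq => ->; rewrite mul0r -ltNge; lra.
Unshelve. all: end_near. Qed.

Lemma succ_floor (R : realType) (a : R) : 1 < a -> exists n, n.+1%:R <= a < n.+2%:R.
Proof.
move=> a1; have a0 : 0 <= a by lra.
have := truncn_itv a0; case: (Num.truncn a) => [|n] h; last by exists n.
by have /andP[_] := h; rewrite ltNge (ltW a1).
Qed.

Theorem theorem4p2 (R : realType) (d : measure_display)
    (Omega : measurableType d) (P : probability Omega R)
    (Q : retrial_queue P)
    (Iser Rque Rorb : {RV P >-> nat}) (X : {RV P >-> R})
    (L : R -> R) (a1 a2 r : R)
    (hrho : total_load Q < 1)
    (hstat : stationary Q Iser Rque Rorb X)
    (hL : slowly_varying L)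
    (ha1 : 1 < a1)
    (hr : 0 < r \/ (r = 0 /\ a1 < a2))
    (hT1 : equivalent_at (pinfty_nbhs R) (fun t : R => fine (ccdf (service Q Type1) t))
       (fun t => t `^ (- a1) * L t))
    (hT2 : equivalent_at (pinfty_nbhs R) (fun t : R => fine (ccdf (service Q Type2) t))
       (fun t => expR (- (r * t)) * t `^ (- a2) * L t)) :
  let l1 := rate Q Type1 in
  let l2 := rate Q Type2 in
  let rho1 := load Q Type1 in
  let rho2 := load Q Type2 in
  let rho := total_load Q in
  let tail (V : Omega -> nat) (i : nat) (j : nat) : R :=
    cond_prob P [set w | (j < V w)%N] [set w | Iser w = i] in
  [/\ equivalent_at \oo (tail Rque 1%N)
        (fun j : nat => l1 `^ a1 / (rho1 * (1 - rho1) * (a1 - 1))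
           * j%:R `^ (- a1 + 1) * L j%:R),
      equivalent_at \oo (tail Rorb 1%N)
        (fun j : nat => (rho2 / (1 - rho) + 1 / rho1)
           * (l1 * l2 `^ (a1 - 1) / ((a1 - 1) * (1 - rho1) `^ a1))
           * j%:R `^ (- a1 + 1) * L j%:R),
      (r = 0 -> equivalent_at \oo (tail Rque 2%N)
        (fun j : nat => l2 * l1 `^ (a2 - 1) / (rho2 * (a2 - 1))
           * j%:R `^ (- a2 + 1) * L j%:R))
      /\ (0 < r -> equivalent_at \oo (tail Rque 2%N)
        (fun j : nat => l2 * l1 * (l1 + r) `^ (a2 - 1) / (rho2 * r)
           * (l1 / (l1 + r)) ^+ j * j%:R `^ (- a2) * L j%:R)) &
      equivalent_at \oo (tail Rorb 2%N)
        (fun j : nat => l1 * l2 `^ (a1 - 1)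
             / ((1 - rho) * (a1 - 1) * (1 - rho1) `^ (a1 - 1))
           * j%:R `^ (- a1 + 1) * L j%:R)].
Proof.
move=> l1 l2 rho1 rho2 rho tail.
have L1 : 0 < l1 := rate_gt0 Q Type1; have L2 : 0 < l2 := rate_gt0 Q Type2.
have [_ L0 _] := hL.
have F0 c := rccdf_ge0 (service Q c).
have Fdec c x y : x <= y -> rccdf (service Q c) y <= rccdf (service Q c) x by exact: rccdf_le.
have dF c := density_service Q c.
have F1_gt0 : forall x, 0 < rccdf (service Q Type1) x.
  apply: (eventually_pos_gt0 (F0 _) (@Fdec _) _ hT1) => t t0.
  by rewrite mulr_gt0 ?powR_gt0 ?L0.
have F2_gt0 : forall x, 0 < rccdf (service Q Type2) x.
  apply: (eventually_pos_gt0 (F0 _) (@Fdec _) _ hT2) => t t0.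
  by rewrite !mulr_gt0 ?expR_gt0 ?powR_gt0 ?L0.
have load_gt0 c : (forall x, 0 < rccdf (service Q c) x) -> 0 < load Q c.
  by move=> Fc; rewrite loadE mulr_gt0 ?rate_gt0//; exact: mean_gt0 (dF c) (@Fdec c) Fc.
have r1 : 0 < rho1 := load_gt0 _ F1_gt0; have r2 : 0 < rho2 := load_gt0 _ F2_gt0.
have r11 : 0 < 1 - rho1 by rewrite subr_gt0 load1_lt1.
have rr : 0 < 1 - rho by rewrite subr_gt0.
have am : 0 < a1 - 1 by rewrite subr_gt0.
have rv1 := regularly_varying_of_equiv (F0 _) (@Fdec Type1) hL hT1.
have small := negligible_of_equiv (F0 _) hL hr hT1 hT2.
have [n na] := succ_floor ha1.
have pos1 := prob_busy1 hstat hrho; have pos2 := prob_busy2 hstat hrho.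
have pk : (l2 / (1 - rho1)) `^ (a1 - 1) = l2 `^ (a1 - 1) / (1 - rho1) `^ (a1 - 1).
  by rewrite powRM ?invr_ge0 ?(ltW L2) ?(ltW r11)// -[_^-1]powR_inv1 ?(ltW r11)// -powRrM mulN1r powRN.
have pS (y b : R) : 0 < y -> y `^ b = y * y `^ (b - 1).
  by move=> y0; rewrite -{2}[y]powRr1 ?(ltW y0)// -powRD ?(gt_eqF y0) ?implybT// addrC subrK.
have l1p := powR_gt0 (a1 - 1) L1; have l2p := powR_gt0 (a1 - 1) L2.
have r1p := powR_gt0 (a1 - 1) r11.
have kp := powR_gt0 (a1 - 1) (divr_gt0 L2 r11).
have r21 : 0 < 1 - rho2 by rewrite subr_gt0; apply: le_lt_trans hrho; rewrite /total_load lerDr ltW.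
split.
- apply: (equivalent_tail (dF Type1) (@Fdec Type1) hL hT1 ha1 na
    (divr_gt0 (mulr_gt0 L1 l1p) r11) r1 (pos1 _) (top_deriv_queue1 hstat hrho rv1 na small)).
  by rewrite (pS l1 a1 L1) -/l1 -/rho1; field; rewrite !gt_eqF.
- apply: (equivalent_tail (dF Type1) (@Fdec Type1) hL hT1 ha1 na
    (divr_gt0 (mulr_gt0 r21 (mulr_gt0 L1 kp)) rr) r1 (pos1 _)
    (top_deriv_orbit1 hstat hrho rv1 na small)).
  (* The two forms of the constant agree because (1 - rho1) (1 - rho2) = rho1 rho2 + 1 - rho. *)
  rewrite (pS _ a1 r11) -/l1 -/l2 -/rho1 -/rho2 -/rho pk /rho /total_load -/rho1 -/rho2.
  have rr' : 1 - (rho1 + rho2) != 0 by rewrite gt_eqF.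
  by field; rewrite rr' !gt_eqF.
- split=> [r0|r0].
    have a21 : a1 < a2 by case: hr => [h|[]//]; rewrite r0 ltxx in h.
    have ha2 : 1 < a2 by exact: lt_trans a21.
    (* For r = 0 the reference transform is that of the Type-2 tail itself: the queue during a
       Type-2 service involves [phi Type2] alone, which is negligible on the scale of the Type-1
       tail. *)
    have hT2' : equivalent_at (pinfty_nbhs R) (rccdf (service Q Type2)) (fun t => t `^ (- a2) * L t).
      have := hT2; rewrite r0 /equivalent_at.
      by under eq_fun do rewrite mul0r oppr0 expR0 mul1r.
    have rv2 := regularly_varying_of_equiv (F0 _) (@Fdec Type2) hL hT2'.
    have [m ma] := succ_floor ha2.
    have PL := Phi_large (dF Type2) (@Fdec Type2) rv2 ma.
    have t0 := top_deriv_eps (dF Type2) (@Fdec Type2) rv2 ma L1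
      (top_deriv_lap0 (dF Type2) (@Fdec Type2) rv2 ma).
    have top : top_deriv (lap (dens (rccdf (service Q Type2))) m.+1) m.+1
        ((-1) ^+ m.+1 * (l2 * l1 `^ (a2 - 1))) (lap (count_fun Iser Rque 2) 0).
      rewrite mulrCA; apply: eq_top_deriv (top_derivZ PL l2 t0) => t t0'.
      by rewrite (gf_queue_busy2 hstat hrho t0').
    apply: (equivalent_tail (dF Type2) (@Fdec Type2) hL hT2' ha2 ma
      (mulr_gt0 L2 (powR_gt0 (a2 - 1) L1)) r2 (pos2 _) top).
    have am2 : 0 < a2 - 1 by rewrite subr_gt0.
    by field; rewrite !gt_eqF.
  exact: (equivalent_tail_light hstat hrho hL r0 hT1 hT2 F2_gt0 r2).
- apply: (equivalent_tail (dF Type1) (@Fdec Type1) hL hT1 ha1 na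
    (divr_gt0 (mulr_gt0 r2 (mulr_gt0 L1 kp)) rr) r2 (pos2 _)
    (top_deriv_orbit2 hstat hrho rv1 na small)).
  rewrite -/l1 -/l2 -/rho1 -/rho2 -/rho pk.
  by field; rewrite !gt_eqF.
Qed.
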